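(* Let $C=C(v,v')$ belong to $L^2(M^{-1}(v)M(v')\,dv\,dv')$ and be invariant under rotations around $e_3$: $C({}^t\mathcal Ov,{}^t\mathcal Ov')=C(v,v')$ for all $v,v'\in\mathbb R^3$ and every rotation matrix $\mathcal O$ of $\mathbb R^3$ with $\mathcal Oe_3=e_3$, so that $C(v,v')=\tilde C(|\bar v|,v_3,|\bar v'|,v_3',\varphi)$ with $\varphi=\arg\bar v'-\arg\bar v$ (with $\tilde C$ being $2\pi$-periodic in $\varphi$). Then for any $f\in\ker\mathcal T$, $$\Big\langle\int_{\mathbb R^3}C(v,v')f(x,v')\,dv'\Big\rangle(x,v)=\omega_c^2\int_{\mathbb R^2}\int_{\mathbb R^3}\mathcal C(|\bar v|,v_3,|\bar v'|,v_3',z)\,f(\bar x',x_3,v')\,dv'\,d\bar x',$$ where $z=\omega_c\bar x+{}^\perp\bar v-(\omega_c\bar x'+{}^\perp\bar v')$, $$\mathcal C(r,v_3,r',v_3',z)=\frac{\tilde C(r,v_3,r',v_3',\varphi)+\tilde C(r,v_3,r',v_3',-\varphi)}{2\pi^2\sqrt{|z|^2-(r-r')^2}\sqrt{(r+r')^2-|z|^2}}\,\mathbf 1_{\{|r-r'|<|z|<r+r'\}},$$ and for any $|z|\in(|r-r'|,r+r')$, $\varphi\in(0,\pi)$ is the unique angle such that $|z|^2=r^2+(r')^2-2rr'\cos\varphi$.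
   Context: Notation. $x=(x_1,x_2,x_3)$, $v=(v_1,v_2,v_3)\in\mathbb R^3$, $\bar x=(x_1,x_2)$, $\bar v=(v_1,v_2)$ (likewise $\bar x',\bar v'$), $e_3=(0,0,1)$; for $w=(w_1,w_2)\in\mathbb R^2$, ${}^\perp w=(w_2,-w_1)$, and $\arg w$ is its polar angle. Constants $m>0$, $\theta>0$, $\omega_c\neq0$. $M(v)=(2\pi\theta/m)^{-3/2}e^{-m|v|^2/(2\theta)}$. $\mathcal Tu=\mathrm{div}_{x,v}(u\,(\bar v,0,\omega_c{}^\perp\bar v,0))=\bar v\cdot\nabla_{\bar x}u+\omega_c{}^\perp\bar v\cdot\nabla_{\bar v}u$, considered on $L^2(M^{-1}dx\,dv)$ (the $L^2$ space on $\mathbb R^3\times\mathbb R^3$ with weight $1/M(v)$) with domain $\{u\in L^2(M^{-1}dx\,dv):\mathcal Tu\in L^2(M^{-1}dx\,dv)\}$; $\ker\mathcal T$ is its kernel, i.e. the functions of $L^2(M^{-1}dx\,dv)$ that depend only on $\bar x+{}^\perp\bar v/\omega_c,\ x_3,\ |\bar v|,\ v_3$. Average operator on $L^2(M^{-1}dx\,dv)$: $$\langle u\rangle(x,v)=\frac1{2\pi}\int_0^{2\pi}u\Big(\bar x+\frac{{}^\perp\bar v}{\omega_c}-\frac{{}^\perp\{|\bar v|e^{i\alpha}\}}{\omega_c},x_3,|\bar v|e^{i\alpha},v_3\Big)d\alpha,\quad e^{i\alpha}=(\cos\alpha,\sin\alpha).$$ *)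

(* Defs.v *)
From HB Require Import structures.
From mathcomp Require Import all_boot all_order all_algebra.
From mathcomp Require Import all_classical all_reals all_analysis.
From mathcomp Require Import ring lra.

Set Implicit Arguments.
Unset Strict Implicit.
Unset Printing Implicit Defensive.

Import Order.TTheory GRing.Theory Num.Theory numFieldNormedType.Exports.

Local Open Scope classical_set_scope.
Local Open Scope ring_scope.

(* A vector (w1, w2, w3) of R^3 is the triple ((w1, w2), w3), so that [w.1]   *)
(* is its planar part and [w.2] its component along e3.  A point of phase     *)
(* space is the pair (x, v).  The library norm of a product is the sup norm;  *)
(* the Euclidean norm of R^2 is [norm2] below.                                *)
Notation vec2 R := (R * R)%type.
Notation vec3 R := (R * R * R)%type.
Notation phase R := ((R * R * R) * (R * R * R))%type.

(* The same types with the sigma-algebra on which the library defines the     *)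
(* Lebesgue measure.                                                          *)
Notation mvec2 R := (measurableTypeR R * measurableTypeR R)%type.
Notation mvec3 R := (mvec2 R * measurableTypeR R)%type.
Notation mphase R := (mvec3 R * mvec3 R)%type.

(* [m1 \x m2] under a new name: when iterated, canonical structures only find *)
(* the library's finite-measure instance on [\x], not the sigma-finite one.   *)
Section sigma_finite_product.
Context d1 d2 (T1 : measurableType d1) (T2 : measurableType d2) (R : realType).
Variable m1 : {sigma_finite_measure set T1 -> \bar R}.
Variable m2 : {sigma_finite_measure set T2 -> \bar R}.

Definition sfprod : set (T1 * T2) -> \bar R := (m1 \x m2)%E.

HB.instance Definition _ := Measure.on sfprod.

Lemma sfprod_sigma_finite : sigma_finite setT sfprod.
Proof.
have /sigma_finiteP[F [TF ndF Foo]] := sigma_finiteT m1.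
have /sigma_finiteP[G [TG ndG Goo]] := sigma_finiteT m2.
exists (fun n => F n `*` G n).
  rewrite -setXTT TF TG predeqE => -[x y]; split.
    move=> [/= [n _ Fnx] [k _ Gky]]; exists (maxn n k) => //; split.
    - by move: x Fnx; exact/subsetPset/ndF/leq_maxl.
    - by move: y Gky; exact/subsetPset/ndG/leq_maxr.
  by move=> [n _ []/= ? ?]; split; exists n.
move=> k; have [? ?] := Foo k; have [? ?] := Goo k.
split; first exact: measurableX.
by rewrite /sfprod product_measure1E// lte_mul_pinfty// ge0_fin_numE.
Qed.

HB.instance Definition _ :=
  Measure_isSigmaFinite.Build _ _ _ sfprod sfprod_sigma_finite.
End sigma_finite_product.

Definition leb2 (R : realType) :
    {sigma_finite_measure set (mvec2 R) -> \bar R} :=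
  sfprod (@lebesgue_measure R) (@lebesgue_measure R).
Definition leb3 (R : realType) :
    {sigma_finite_measure set (mvec3 R) -> \bar R} :=
  sfprod (leb2 R) (@lebesgue_measure R).
Definition leb6 (R : realType) :
    {sigma_finite_measure set (mphase R) -> \bar R} :=
  sfprod (leb3 R) (leb3 R).

Section plane_geometry.
Context {R : realType}.

Definition norm2 (w : vec2 R) : R := Num.sqrt (w.1 ^+ 2 + w.2 ^+ 2).

Definition perp (w : vec2 R) : vec2 R := (w.2, - w.1).

Definition expi (a : R) : vec2 R := (cos a, sin a).

(* The polar angle in ]-pi, pi]; its value at the origin is irrelevant.       *)
Definition polar_angle (w : vec2 R) : R :=
  if 0 <= w.2 then acos (w.1 / norm2 w) else - acos (w.1 / norm2 w).

End plane_geometry.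

Section rotations.
Context {R : realType}.

Definition col_of (v : vec3 R) : 'cV[R]_3 :=
  \col_i [:: v.1.1; v.1.2; v.2]`_i.

Definition of_col (c : 'cV[R]_3) : vec3 R := (c 0 0, c 1 0, c 2 0).

Definition rotation_around_e3 (O : 'M[R]_3) : Prop :=
  [/\ O^T *m O = 1%:M, \det O = 1 &
      O *m col_of (0, 0, 1) = col_of (0, 0, 1)].

Definition rotation_invariant (C : vec3 R -> vec3 R -> R) : Prop :=
  forall O : 'M[R]_3, rotation_around_e3 O -> forall v v' : vec3 R,
    C (of_col (O^T *m col_of v)) (of_col (O^T *m col_of v')) = C v v'.

End rotations.

(* [Ct] represents the rotation invariant function [C] through the variables  *)
(* |\bar v|, v3, |\bar v'|, v3' and arg \bar v' - arg \bar v.                 *)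
Definition cylindrical_form (R : realType) (C : vec3 R -> vec3 R -> R)
    (Ct : R -> R -> R -> R -> R -> R) : Prop :=
  (forall r v3 r' v3' phi, 0 <= r -> 0 <= r' ->
     Ct r v3 r' v3' (phi + 2 * pi) = Ct r v3 r' v3' phi) /\
  (forall v v' : vec3 R, C v v' =
     Ct (norm2 v.1) v.2 (norm2 v'.1) v'.2 (polar_angle v'.1 - polar_angle v.1)).

Section weighted_spaces.
Context {R : realType}.
Variables m theta : R.

Definition maxwellian (v : vec3 R) : R :=
  (2 * pi * theta / m) `^ (- (3 / 2)) *
  expR (- (m * (v.1.1 ^+ 2 + v.1.2 ^+ 2 + v.2 ^+ 2)) / (2 * theta)).

Definition L2_phase (u : phase R -> R) : Prop :=
  measurable_fun [set: mphase R] u /\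
  (\int[leb6 R]_p ((u p) ^+ 2 / maxwellian p.2)%:E < +oo)%E.

Definition L2_kernel (C : vec3 R -> vec3 R -> R) : Prop :=
  measurable_fun [set: mphase R] (fun p => C p.1 p.2) /\
  (\int[leb6 R]_p ((C p.1 p.2) ^+ 2 / maxwellian p.1 * maxwellian p.2)%:E
     < +oo)%E.

End weighted_spaces.

Section transport.
Context {R : realType}.

Fixpoint Ck (V : normedModType R) (k : nat) (phi : V -> R) : Prop :=
  if k is k'.+1 then
    (forall p, differentiable phi p) /\ (forall w, Ck k' ('D_w phi))
  else continuous phi.

Definition test_function (phi : phase R -> R) : Prop :=
  (forall k, Ck k phi) /\ compact (closure [set p | phi p != 0]).

Definition gyro_field (omega : R) (p : phase R) : phase R :=
  ((p.2.1, 0), (omega *: perp p.2.1, 0)).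

(* The graph of the operator T on L^2(M^{-1} dx dv): [w] is the divergence of *)
(* [u] times the gyro field, in the sense of distributions.                   *)
Definition transport (m theta omega : R) (u w : phase R -> R) : Prop :=
  [/\ L2_phase m theta u, L2_phase m theta w &
      forall phi, test_function phi ->
        \int[leb6 R]_p (u p * 'D_(gyro_field omega p) phi p) =
        - \int[leb6 R]_p (w p * phi p)].

Definition ker_transport (m theta omega : R) (u : phase R -> R) : Prop :=
  transport m theta omega u (cst 0).

Definition average (omega : R) (u : phase R -> R) (p : phase R) : R :=
  let x := p.1 in let v := p.2 in
  (2 * pi)^-1 * \int[lebesgue_measure]_(alpha in `[0, 2 * pi])
    u ((x.1 + omega^-1 *: perp v.1 - omega^-1 *: perp (norm2 v.1 *: expi alpha),
        x.2),
       (norm2 v.1 *: expi alpha, v.2)).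

End transport.

Section averaged_kernel.
Context {R : realType}.

(* Junk where no such angle exists.                                           *)
Definition gyro_angle (r r' rho : R) : R :=
  get [set phi | 0 < phi < pi /\
                 rho ^+ 2 = r ^+ 2 + r' ^+ 2 - 2 * r * r' * cos phi].

Lemma gyro_angle_unique (r r' rho : R) :
  0 <= r -> 0 <= r' -> `|r - r'| < rho < r + r' ->
  exists! phi, 0 < phi < pi /\
               rho ^+ 2 = r ^+ 2 + r' ^+ 2 - 2 * r * r' * cos phi.
Proof.
move=> r0 r'0 /andP[r1 r2].
have rho0 : 0 < rho by apply: le_lt_trans r1.
have [h1 h2] : r - r' < rho /\ r' - r < rho.
  by move: r1; rewrite ltr_norml => /andP[? ?]; split; lra.
have rr'0 : 0 < 2 * r * r'.
  rewrite -mulrA mulr_gt0// mulr_gt0//.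
    by rewrite lt_neqAle r0 andbT eq_sym; apply/eqP => r00; lra.
  by rewrite lt_neqAle r'0 andbT eq_sym; apply/eqP => r'00; lra.
pose c := (r ^+ 2 + r' ^+ 2 - rho ^+ 2) / (2 * r * r').
have cE : 2 * r * r' * c = r ^+ 2 + r' ^+ 2 - rho ^+ 2.
  by rewrite /c mulrCA mulfV ?mulr1// gt_eqF.
have c1 : c < 1 by rewrite /c ltr_pdivrMr//; nra.
have cN1 : -1 < c by rewrite /c ltr_pdivlMr//; nra.
have ccos : cos (acos c) = c by rewrite acosK// in_itv/= !ltW.
exists (acos c); split.
  split; last by rewrite ccos cE; lra.
  by rewrite acos_gt0 ?acos_ltpi// ?c1 ?cN1 ltW.
move=> phi [/andP[phi0 phipi] phiE].
have cosphi : cos phi = c.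
  by apply: (mulfI (lt0r_neq0 rr'0)); rewrite cE; lra.
by rewrite -cosphi cosK// in_itv/= !ltW.
Qed.

Definition averaged_kernel (Ct : R -> R -> R -> R -> R -> R)
    (r v3 r' v3' : R) (z : vec2 R) : R :=
  let rho := norm2 z in
  let phi := gyro_angle r r' rho in
  if `|r - r'| < rho < r + r' then
    (Ct r v3 r' v3' phi + Ct r v3 r' v3' (- phi)) /
    (2 * pi ^+ 2 * Num.sqrt (rho ^+ 2 - (r - r') ^+ 2) *
     Num.sqrt ((r + r') ^+ 2 - rho ^+ 2))
  else 0.

End averaged_kernel.

(* Main.v *)
Require Import Defs.
From HB Require Import structures.
From mathcomp Require Import all_boot all_order all_algebra.
From mathcomp Require Import all_classical all_reals all_analysis.
From mathcomp Require Import measurable_realfun real_interval.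
From mathcomp Require Import ring lra.

Set Implicit Arguments.
Unset Strict Implicit.
Unset Printing Implicit Defensive.

Import Order.TTheory GRing.Theory Num.Theory numFieldNormedType.Exports.

Local Open Scope classical_set_scope.
Local Open Scope ring_scope.

(** The proof has three parts.

  Functions of the kernel. In the variables [guide omega p], where the position
  is replaced by the guiding centre, the gyro field only rotates the planar
  velocity. The kernel equation is tested against products of bumps in these
  variables, rotated by an angle [t]: the derivative in [t] of the pairing with
  [f] is the distributional equation, so the pairing is constant
  ([integral_tensor_cst]), and since such products separate functions
  ([du_bois_reymond]), [f] is invariant under each rotation almost everywhere.
  Hence [f] agrees almost everywhere with its gyroaverage
  ([ker_transport_average]), which is exactly a function [Phi] of the guiding
  centre, [x3], the planar speed and [v3].

  The identity for nonnegative [C] and [Phi]. Fix [(x, v)] with planar speed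
  [r > 0]. On the left, rotating [v'] with the gyration angle [al] makes the factor
  [C] equal to [C ((r, 0), v3) w], independently of [al], and puts the guiding
  centre at the rotate by [al] of [(r, 0) - w], up to the factor [- omega^-1 perp]
  and a translation by the guiding centre of [(x, v)]. The integral of [Phi] in
  [al] then only depends on the distances of [w] to [0] and [(r, 0)]. On the right, taking
  the guiding centre as integration variable instead of [xb'] produces the vector
  [z], on whose norm alone the kernel depends, so that [Phi] can be averaged over
  the rotations of [z]. Both sides are thus integrals of the same
  function of two distances, on the left over [w] with the weight [C], on the right
  over the distances with the averaged kernel as weight. They agree by the change of
  variables to bipolar coordinates ([bipolar_coordinates]): its Jacobian is the
  product of square roots in the averaged kernel, and the two points with given distances to the foci give the two angles [phi]
  and [- phi] ([averaged_kernelE]). This is [average_collision_ge0].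

  Signed data. The inequality of the arithmetic and geometric means shows that
  [C(v, v') f(x, v')] is integrable in [v'] and, locally, in [(x, v)]
  ([collision_abs_locint]); the gyration preserves phase volume, so its integral
  along almost every orbit is finite ([ae_orbit_finite]). Where this holds, the
  identity for absolute values gives the integrability of the right side, and
  linearity gives the identity itself ([average_collision]). Finally, [f] and its
  representative [Phi] may be exchanged on both sides, since a null set of phase
  space meets almost every orbit, and almost every horizontal slice, in a null
  set. *)

(** * Measurability, measure-preserving maps and Tonelli's theorem *)

Local Notation meas_fun := (measurable_fun setT).
Local Notation mR := measurableTypeR.

Section sections.
Context d1 d2 d3 (T1 : measurableType d1) (T2 : measurableType d2) (T3 : measurableType d3).
Variables (f : T1 -> T2 -> T3).
Hypothesis mf : meas_fun (fun z => f z.1 z.2).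

Lemma meas_section1 x : meas_fun (f x).
Proof.
have mp : meas_fun (fun y : T2 => (x, y)) by exact/measurable_fun_pair.
exact: (measurableT_comp mf mp).
Qed.

Lemma meas_section2 y : meas_fun (f ^~ y).
Proof.
have mp : meas_fun (fun x : T1 => (x, y)) by exact/measurable_fun_pair.
exact: (measurableT_comp mf mp).
Qed.

End sections.

Section measure_preserving.
Local Open Scope ereal_scope.
Context d1 d2 (T1 : measurableType d1) (T2 : measurableType d2) (R : realType).
Variables (mu : {measure set T1 -> \bar R}) (nu : {measure set T2 -> \bar R}).

Definition mpres (phi : T1 -> T2) : Prop :=
  meas_fun phi /\
  forall A, measurable A -> mu (phi @^-1` A) = nu A.

Lemma mpres_ge0_integral phi (f : T2 -> \bar R) : mpres phi ->
  meas_fun f -> (forall y, 0 <= f y) ->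
  \int[mu]_x f (phi x) = \int[nu]_y f y.
Proof.
move=> [mphi phiE] mf f0.
rewrite -[LHS](@ge0_integral_pushforward _ _ T1 T2 R phi mphi mu setT f)//.
by apply: eq_measure_integral => A mA _; exact: phiE.
Qed.

Lemma mpres_integral phi (f : T2 -> \bar R) : mpres phi ->
  meas_fun f -> \int[mu]_x f (phi x) = \int[nu]_y f y.
Proof.
move=> mp mf; rewrite -[LHS]/(\int[mu]_x (f \o phi) x).
rewrite integralE [RHS]integralE; congr (_ - _).
- under eq_integral do rewrite funepos_comp.
  by apply: mpres_ge0_integral => //; exact: measurable_funepos.
- under eq_integral do rewrite funeneg_comp.
  by apply: mpres_ge0_integral => //; exact: measurable_funeneg.
Qed.

Lemma mpres_ae phi (P : T2 -> Prop) : mpres phi ->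
  {ae nu, forall y, P y} -> {ae mu, forall x, P (phi x)}.
Proof.
move=> [mphi phiE] [N [mN N0 PN]]; exists (phi @^-1` N); split.
- by rewrite -[X in measurable X]setTI; exact: mphi.
- by rewrite phiE.
- by move=> x /= nP; exact: PN.
Qed.

End measure_preserving.

Lemma mpres_comp d1 d2 d3 (T1 : measurableType d1) (T2 : measurableType d2)
    (T3 : measurableType d3) (R : realType) (m1 : {measure set T1 -> \bar R})
    (m2 : {measure set T2 -> \bar R}) (m3 : {measure set T3 -> \bar R})
    (f : T1 -> T2) (g : T2 -> T3) :
  mpres m1 m2 f -> mpres m2 m3 g -> mpres m1 m3 (g \o f).
Proof.
move=> [mf fE] [mg gE]; split; first exact: measurableT_comp.
move=> A mA; rewrite comp_preimage fE ?gE//.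
by rewrite -[X in measurable X]setTI; exact: mg.
Qed.

Section tonelli.
Local Open Scope ereal_scope.
Context d1 d2 (T1 : measurableType d1) (T2 : measurableType d2) (R : realType).
Variables (m1 : {sigma_finite_measure set T1 -> \bar R}).
Variables (m2 : {sigma_finite_measure set T2 -> \bar R}).

Lemma tonelli12 (f : T1 * T2 -> \bar R) : meas_fun f ->
  (forall z, 0 <= f z) -> \int[sfprod m1 m2]_z f z = \int[m1]_x \int[m2]_y f (x, y).
Proof. by move=> mf f0; exact: fubini_tonelli1. Qed.

Lemma tonelli21 (f : T1 * T2 -> \bar R) : meas_fun f ->
  (forall z, 0 <= f z) -> \int[sfprod m1 m2]_z f z = \int[m2]_y \int[m1]_x f (x, y).
Proof. by move=> mf f0; exact: fubini_tonelli2. Qed.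

Lemma tonelli_swap (f : T1 -> T2 -> \bar R) :
  meas_fun (fun z => f z.1 z.2) -> (forall x y, 0 <= f x y) ->
  \int[m1]_x \int[m2]_y f x y = \int[m2]_y \int[m1]_x f x y.
Proof. by move=> mf f0; rewrite -(fubini_tonelli (fun z => f z.1 z.2)). Qed.

Lemma measurable_integral1 (f : T1 -> T2 -> \bar R) :
  meas_fun (fun z => f z.1 z.2) -> (forall x y, 0 <= f x y) ->
  meas_fun (fun x => \int[m2]_y f x y).
Proof.
move=> mf f0; exact: (measurable_fun_fubini_tonelli_F (fun z => f z.1 z.2)).
Qed.

Lemma measurable_integral2 (f : T1 -> T2 -> \bar R) :
  meas_fun (fun z => f z.1 z.2) -> (forall x y, 0 <= f x y) ->
  meas_fun (fun y => \int[m1]_x f x y).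
Proof.
move=> mf f0; exact: (measurable_fun_fubini_tonelli_G (fun z => f z.1 z.2)).
Qed.

Lemma measureE_integral d (T : measurableType d) (mu : {measure set T -> \bar R})
  (A : set T) : measurable A -> mu A = \int[mu]_x (\1_A x)%:E.
Proof. by move=> mA; rewrite integral_indic// setIT. Qed.

End tonelli.
Arguments tonelli12 {d1 d2 T1 T2 R m1 m2 f}.
Arguments tonelli21 {d1 d2 T1 T2 R m1 m2 f}.

Section mpres_product.
Local Open Scope ereal_scope.
Context d1 d2 d3 (T1 : measurableType d1) (T2 : measurableType d2)
  (T3 : measurableType d3) (R : realType).
Variables (m1 : {sigma_finite_measure set T1 -> \bar R}).
Variables (m2 : {sigma_finite_measure set T2 -> \bar R}).
Variables (m3 : {sigma_finite_measure set T3 -> \bar R}).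

(** A map that acts on the first factor by measure-preserving maps depending on
  the second one preserves the product measure: integrate over the first factor
  first. Shears, rotations and the change to guiding centres are all of this
  form. *)
Lemma mpres_fst (phi : T2 -> T1 -> T3) :
  meas_fun (fun z : T1 * T2 => phi z.2 z.1) ->
  (forall y, mpres m1 m3 (phi y)) ->
  mpres (sfprod m1 m2) (sfprod m3 m2) (fun z => (phi z.2 z.1, z.2)).
Proof.
move=> mphi phiP.
have mP : meas_fun (fun z : T1 * T2 => (phi z.2 z.1, z.2)).
  by apply/measurable_fun_pair.
split => // A mA.
have mPA : measurable ((fun z : T1 * T2 => (phi z.2 z.1, z.2)) @^-1` A).
  by rewrite -[X in measurable X]setTI; exact: mP.
rewrite measureE_integral// [RHS]measureE_integral//.
have mi d (T : measurableType d) (B : set T) : measurable B ->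
    meas_fun (fun x => (\1_B x)%:E : \bar R).
  by move=> mB; apply/measurable_EFinP; exact: measurable_indic.
have i0 d (T : measurableType d) (B : set T) x : 0 <= (\1_B x)%:E :> \bar R.
  by rewrite lee_fin.
rewrite (tonelli21 (mi _ _ _ mPA))// (tonelli21 (mi _ _ _ mA))//.
apply: eq_integral => y _.
rewrite -(mpres_ge0_integral (phiP y) (f := fun x => (\1_A (x, y))%:E))//.
exact: measurableT_comp (mi _ _ _ mA) (measurable_pair2 y).
Qed.

End mpres_product.

Lemma mpres_swap d1 d2 (T1 : measurableType d1) (T2 : measurableType d2)
    (R : realType) (m1 : {sigma_finite_measure set T1 -> \bar R})
    (m2 : {sigma_finite_measure set T2 -> \bar R}) :
  mpres (sfprod m1 m2) (sfprod m2 m1) (fun z => (z.2, z.1)).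
Proof.
have ms : meas_fun (fun z : T1 * T2 => (z.2, z.1)) by exact/measurable_fun_pair.
split => // A mA.
have mA1 : meas_fun (fun x => (\1_A x)%:E : \bar R).
  by apply/measurable_EFinP; exact: measurable_indic.
rewrite measureE_integral; last by rewrite -[X in measurable X]setTI; exact: ms.
rewrite [RHS]measureE_integral// (tonelli21 mA1); last by move=> z; rewrite lee_fin.
rewrite (@tonelli12 _ _ _ _ _ m1 m2 (fun z => (\1_A (z.2, z.1))%:E))//.
by exact: measurableT_comp mA1 ms.
Qed.

Lemma mpres_snd d1 d2 d3 (T1 : measurableType d1) (T2 : measurableType d2)
    (T3 : measurableType d3) (R : realType) (m1 : {sigma_finite_measure set T1 -> \bar R})
    (m2 : {sigma_finite_measure set T2 -> \bar R})
    (m3 : {sigma_finite_measure set T3 -> \bar R}) (phi : T2 -> T1 -> T3) :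
  meas_fun (fun z : T2 * T1 => phi z.1 z.2) ->
  (forall y, mpres m1 m3 (phi y)) ->
  mpres (sfprod m2 m1) (sfprod m2 m3) (fun z => (z.1, phi z.1 z.2)).
Proof.
move=> mphi phiP.
have ms : meas_fun (fun z : T1 * T2 => (z.2, z.1)) by exact/measurable_fun_pair.
have m1P := @mpres_fst _ _ _ _ _ _ _ m1 m2 m3 phi (measurableT_comp mphi ms) phiP.
have m2P := mpres_comp (mpres_comp (mpres_swap m2 m1) m1P) (mpres_swap m3 m2).
exact: m2P.
Qed.


Lemma measurable_cstT d1 d2 (T1 : measurableType d1) (T2 : measurableType d2) (x : T2) :
  meas_fun (fun _ : T1 => x).
Proof. exact: measurable_cst. Qed.

Section measR.
Context d (T : measurableType d) (R : realType).
Implicit Types f g : T -> R.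

Lemma measD f g : meas_fun f -> meas_fun g ->
  meas_fun (fun x => f x + g x).
Proof. exact: measurable_funD. Qed.
Lemma measM f g : meas_fun f -> meas_fun g ->
  meas_fun (fun x => f x * g x).
Proof. exact: measurable_funM. Qed.
Lemma measN f : meas_fun f ->
  meas_fun (fun x => - f x).
Proof. exact: measurable_funN. Qed.
Lemma measX f n : meas_fun f ->
  meas_fun (fun x => f x ^+ n).
Proof. exact: measurable_funX. Qed.
Lemma meas_cont (h : R -> R) f : continuous h -> meas_fun f ->
  meas_fun (fun x => h (f x)).
Proof.
by move=> ch mf; apply: measurableT_comp => //; exact: continuous_measurable_fun.
Qed.
Lemma measurable_invr : meas_fun (fun x : R => x^-1).
Proof.
have : meas_fun (fun x : R => if x == 0 then 0 else x^-1).
  rewrite -(setvU [set 0 : R]); apply/measurable_funU => //.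
    exact: measurableC.
  split; last exact: measurable_fun_set1.
  apply: (@eq_measurable_fun _ _ _ _ _ (fun x : R => x^-1)).
    by move=> x; rewrite inE /= => /eqP/negbTE ->.
  apply: subspace_continuous_measurable_fun; first exact: measurableC.
  rewrite continuous_open_subspace; last first.
    rewrite (_ : ~` _ = [set x | x != 0]); first exact: open_neq.
    by apply/seteqP; split => x /= /eqP.
  by move=> x; rewrite inE /= => /eqP x0; exact: inv_continuous.
apply: eq_measurable_fun => x _.
by case: eqVneq => // ->; rewrite invr0.
Qed.
Lemma measV f : meas_fun f ->
  meas_fun (fun x => (f x)^-1).
Proof. by move=> mf; apply: (measurableT_comp measurable_invr). Qed.

Lemma measE f : meas_fun f ->
  meas_fun (fun x => (f x)%:E).
Proof. by move=> ?; exact/measurable_EFinP. Qed.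
End measR.

Section measE.
Local Open Scope ereal_scope.
Context d (T : measurableType d) (R : realType).
Implicit Types f g : T -> \bar R.

Lemma measDe f g : meas_fun f -> meas_fun g ->
  meas_fun (fun x => f x + g x).
Proof. exact: emeasurable_funD. Qed.
Lemma measMe f g : meas_fun f -> meas_fun g ->
  meas_fun (fun x => f x * g x).
Proof. exact: emeasurable_funM. Qed.
Lemma meas_if d' (T' : measurableType d') (P : T -> bool) (f g : T -> T') :
  meas_fun P -> meas_fun f -> meas_fun g ->
  meas_fun (fun x => if P x then f x else g x).
Proof. by move=> ? ? ?; exact: measurable_fun_ifT. Qed.
Lemma meas_ltr (f g : T -> R) :
  meas_fun f -> meas_fun g ->
  meas_fun (fun x => (f x < g x)%R).
Proof. by move=> ? ?; exact: measurable_fun_ltr. Qed.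
Lemma meas_ler (f g : T -> R) :
  meas_fun f -> meas_fun g ->
  meas_fun (fun x => (f x <= g x)%R).
Proof. by move=> ? ?; exact: measurable_fun_ler. Qed.
End measE.

(* The closure lemmas above are restated for applied functions so that they can
   be selected by the head of the body of the function. *)
Ltac meas_step :=
  match goal with
  | |- measurable_fun _ (fun x => x) => exact: measurable_id
  | |- measurable_fun _ fst => exact: measurable_fst
  | |- measurable_fun _ snd => exact: measurable_snd
  | |- measurable_fun _ Num.sqrt => apply: continuous_measurable_fun; exact: sqrt_continuous
  | |- measurable_fun _ cos => apply: continuous_measurable_fun; exact: continuous_cos
  | |- measurable_fun _ sin => apply: continuous_measurable_fun; exact: continuous_sin
  | |- measurable_fun _ expR => apply: continuous_measurable_fun; exact: continuous_expR
  | |- measurable_fun _ GRing.inv => exact: measurable_invr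
  | |- measurable_fun _ EFin => by apply/measurable_EFinP; exact: measurable_id
  | |- measurable_fun _ (fun x => fst x) => exact: measurable_fst
  | |- measurable_fun _ (fun x => snd x) => exact: measurable_snd
  | |- measurable_fun _ (fun x => EFin _) => apply: measE
  | |- measurable_fun _ (fun x => (_, _)) => apply/measurable_fun_pair
  | |- measurable_fun _ (fun x => fst _) => apply: (measurableT_comp (f := fst)); first exact: measurable_fst
  | |- measurable_fun _ (fun x => snd _) => apply: (measurableT_comp (f := snd)); first exact: measurable_snd
  | |- measurable_fun _ (fun x => (_ + _)%R) => apply: measD
  | |- measurable_fun _ (fun x => (- _)%R) => apply: measN
  | |- measurable_fun _ (fun x => (_ * _)%R) => apply: measM
  | |- measurable_fun _ (fun x => (_ ^+ _)%R) => apply: measX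
  | |- measurable_fun _ (fun x => (_ ^-1)%R) => apply: measV
  | |- measurable_fun _ (fun x => Num.sqrt _) => apply: meas_cont; first exact: sqrt_continuous
  | |- measurable_fun _ (fun x => cos _) => apply: meas_cont; first exact: continuous_cos
  | |- measurable_fun _ (fun x => sin _) => apply: meas_cont; first exact: continuous_sin
  | |- measurable_fun _ (fun x => expR _) => apply: meas_cont; first exact: continuous_expR
  end.
Ltac meas_step2 :=
  match goal with
  | |- measurable_fun _ (fun x => @GRing.add _ _ _) => apply: measDe
  | |- measurable_fun _ (fun x => (_ * _)%E) => apply: measMe
  | |- measurable_fun _ (Order.lt ?a) => apply: (@meas_ltr _ _ _ (fun=> a) (fun x => x))
  | |- measurable_fun _ (Order.le ?a) => apply: (@meas_ler _ _ _ (fun=> a) (fun x => x))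
  | |- measurable_fun _ (fun x => if _ then _ else _) => apply: meas_if
  | |- measurable_fun _ (fun x => (_ < _)%R) => apply: meas_ltr
  | |- measurable_fun _ (fun x => (_ <= _)%R) => apply: meas_ler
  | |- measurable_fun _ (fun x => _ && _) => apply: measurable_and
  | H : meas_fun ?f |- measurable_fun _ (fun x => ?f _) =>
     apply: (measurableT_comp H)
  | H : meas_fun (fun z => ?f (fst z) (snd z)) |- measurable_fun _ (fun x => ?f (@?u x) (@?v x)) =>
     refine (@measurableT_comp _ _ _ _ _ _ (fun z => f (fst z) (snd z)) setT (fun x => (u x, v x)) H _)
  | H : meas_fun (fun z => ?f (fst z) (snd z)) |- measurable_fun _ (?f ?u) =>
     apply: (measurableT_comp H (g := fun x => (u, x)))
  end.
Ltac meas_cst :=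
  match goal with |- measurable_fun _ (fun _ => ?c) => exact: measurable_cstT end.
Ltac meas := rewrite /=; repeat (first [assumption | meas_cst | meas_step | meas_step2]).

Lemma ge0_integral_tensor d1 d2 (T1 : measurableType d1) (T2 : measurableType d2)
    (R : realType) (m1 : {sigma_finite_measure set T1 -> \bar R})
    (m2 : {sigma_finite_measure set T2 -> \bar R}) (a : T1 -> \bar R) (b : T2 -> \bar R) :
  meas_fun a -> meas_fun b ->
  (forall x, 0 <= a x)%E -> (forall y, 0 <= b y)%E ->
  (\int[sfprod m1 m2]_z (a z.1 * b z.2) = \int[m1]_x a x * \int[m2]_y b y)%E.
Proof.
move=> ma mb a0 b0.
rewrite (@tonelli12 _ _ _ _ _ m1 m2 (fun z => a z.1 * b z.2)%E); first last.
- by move=> z; exact: mule_ge0.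
- apply: measMe; first exact: (measurableT_comp ma measurable_fst).
  exact: (measurableT_comp mb measurable_snd).
transitivity (\int[m1]_x (a x * \int[m2]_y b y))%E.
  by apply: eq_integral => x _; rewrite /= ge0_integralZl.
by rewrite ge0_integralZr// integral_ge0.
Qed.

(** * Affine changes of variables on the line and rotations of the plane *)

Section lines.
Context {R : realType}.
Local Notation leb := (@lebesgue_measure R).
Local Open Scope ereal_scope.

Lemma lebesgue_translate (c : R) :
  mpres leb leb (fun x : mR R => x + c : mR R)%R.
Proof.
have mp : meas_fun (fun x : mR R => x + c : mR R)%R.
  by meas.
split => // A mA.
have [mu muE] : exists mu : {measure set (mR R) -> \bar R},
    mu = pushforward leb (fun x : mR R => x + c : mR R)%R :> (set _ -> _).
  by unshelve eexists (pushforward leb (fun x : mR R => x + c : mR R)%R).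
transitivity (mu A); first by rewrite muE.
apply/esym/(lebesgue_measure_unique (mu := mu)) => // _ [[a b] _ <-].
rewrite muE /pushforward /=.
rewrite (_ : _ @^-1` `]a, b] = `](a - c)%R, (b - c)%R]%classic); last first.
  by apply/seteqP; split => x /=; rewrite !in_itv /= ltrBlDr lerBrDr.
rewrite !lebesgue_measure_itv /= !lte_fin ltrD2r; case: ifP => // _.
by rewrite -!EFinB; congr EFin; lra.
Qed.

Lemma lebesgue_reflect :
  mpres leb leb (fun x : mR R => - x : mR R)%R.
Proof.
split; first by meas.
by move=> A mA; exact: lebesgue_measureN.
Qed.

(** [|k|] times the image of Lebesgue measure under [x |-> k * x] agrees with
  Lebesgue measure on intervals. *)
Lemma ge0_integral_scale (k : R) (f : R -> \bar R) : (k != 0)%R ->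
  meas_fun f -> (forall x, 0 <= f x) ->
  \int[leb]_x f x = `|k|%:E * \int[leb]_x f (k * x)%R.
Proof.
wlog k0 : k f / (0 < k)%R => [wl|] kN0 mf f0.
  have [k0|k0|/eqP] := ltgtP 0%R k; first exact: wl.
  - rewrite (wl (- k)%R)//; last 2 first.
      by rewrite oppr_gt0.
      by rewrite oppr_eq0.
    rewrite normrN; congr (_ * _).
    rewrite -[RHS](mpres_ge0_integral lebesgue_reflect)//.
      by apply: eq_integral => x _; rewrite mulNr mulrN.
    by apply: measurableT_comp => //; meas.
  - by rewrite eq_sym (negbTE kN0).
have mk : meas_fun (fun x : mR R => k * x : mR R)%R.
  by meas.
have k0' : (0 <= k)%R by exact: ltW.
have [mu muE] : exists mu : {measure set (mR R) -> \bar R},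
    mu = mscale (NngNum k0') (pushforward leb (fun x : mR R => k * x : mR R)%R) :> (set _ -> _).
  by unshelve eexists (mscale (NngNum k0') (pushforward leb (fun x : mR R => k * x : mR R)%R)).
have lebE A : measurable A -> leb A = mu A.
  apply: (lebesgue_measure_unique (mu := mu)) => _ [[a b] _ <-].
  rewrite muE /mscale /= /pushforward /=.
  rewrite (_ : _ @^-1` `]a, b] = `](a / k)%R, (b / k)%R]%classic); last first.
    by apply/seteqP; split => x /=; rewrite !in_itv /= ltr_pdivrMr// ler_pdivlMr// mulrC.
  rewrite !lebesgue_measure_itv /= !lte_fin ltr_pM2r ?invr_gt0//; case: ifP => _; last by rewrite mule0.
  by rewrite -!EFinB -EFinM -mulrBl mulrCA divff ?mulr1.
rewrite (eq_measure_integral mu) => [|A mA _]; last exact: lebE.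
rewrite muE.
rewrite ge0_integral_mscale//= ger0_norm//; congr (_ * _).
by rewrite ge0_integral_pushforward.
Qed.

End lines.

Section planes.
Context {R : realType}.
Local Notation leb := (@lebesgue_measure R).
Local Open Scope ereal_scope.

Lemma leb2_translate (c : vec2 R) :
  mpres (leb2 R) (leb2 R) (fun w : mvec2 R => (w.1 + c.1, w.2 + c.2)%R : mvec2 R).
Proof.
have := mpres_comp
  (@mpres_fst _ _ _ _ _ _ _ leb leb leb
    (fun (y x : mR R) => (x + c.1)%R : mR R)
    ltac:(by meas) (fun=> lebesgue_translate _))
  (@mpres_snd _ _ _ _ _ _ _ leb leb leb
    (fun (y x : mR R) => (x + c.2)%R : mR R)
    ltac:(by meas) (fun=> lebesgue_translate _)).
exact.
Qed.

Definition rot2 (c s : R) (w : vec2 R) : vec2 R := (c * w.1 - s * w.2, s * w.1 + c * w.2)%R.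

(** A rotation is a product of three shears, a horizontal one by minus the
  tangent of the half angle on either side of a vertical one, each of which
  translates lines. That tangent is undefined only for the half turn, which is
  a product of two reflections. *)
Lemma leb2_rot (c s : R) : (c ^+ 2 + s ^+ 2 = 1)%R ->
  mpres (leb2 R) (leb2 R) (rot2 c s : mvec2 R -> mvec2 R).
Proof.
move=> cs1.
have sh1 (t : R) : mpres (leb2 R) (leb2 R) (fun w : mvec2 R => (w.1 + t * w.2, w.2)%R : mvec2 R).
  exact: (@mpres_fst _ _ _ _ _ _ _ leb leb leb
    (fun (y x : mR R) => (x + t * y)%R : mR R)
    ltac:(by meas) (fun=> lebesgue_translate _)).
have sh2 (t : R) : mpres (leb2 R) (leb2 R) (fun w : mvec2 R => (w.1, w.2 + t * w.1)%R : mvec2 R).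
  exact: (@mpres_snd _ _ _ _ _ _ _ leb leb leb
    (fun (y x : mR R) => (x + t * y)%R : mR R)
    ltac:(by meas) (fun=> lebesgue_translate _)).
have [c1|c1] := eqVneq c (-1)%R.
  have s0 : s = 0%R.
    by apply/eqP; rewrite -sqrf_eq0; apply/eqP; move: cs1; rewrite c1 expr2; lra.
  have r1 : mpres (leb2 R) (leb2 R) (fun w : mvec2 R => (- w.1, w.2)%R : mvec2 R).
    exact: (@mpres_fst _ _ _ _ _ _ _ leb leb leb
      (fun (y x : mR R) => (- x)%R : mR R)
      ltac:(by meas) (fun=> lebesgue_reflect)).
  have r2 : mpres (leb2 R) (leb2 R) (fun w : mvec2 R => (w.1, - w.2)%R : mvec2 R).
    exact: (@mpres_snd _ _ _ _ _ _ _ leb leb leb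
      (fun (y x : mR R) => (- x)%R : mR R)
      ltac:(by meas) (fun=> lebesgue_reflect)).
  have := mpres_comp r1 r2; congr mpres; apply/funext => w.
  by rewrite /rot2 c1 s0 /=; congr pair; lra.
have c10 : (1 + c != 0)%R by rewrite addrC addr_eq0.
have := mpres_comp (mpres_comp (sh1 (- (s / (1 + c))))%R (sh2 s)) (sh1 (- (s / (1 + c))))%R.
congr mpres; apply/funext => w; rewrite /rot2 /=.
have s2 : (s ^+ 2 = (1 - c) * (1 + c))%R by rewrite expr2 in cs1 *; lra.
congr pair; last first.
  rewrite mulrDr addrCA addrA addrAC -addrA; congr (_ + _)%R.
  rewrite -[X in (_ + X)%R]mul1r mulrA.
  have -> : (s * - (s / (1 + c)) = c - 1)%R.
    by rewrite mulrN mulrA -expr2 s2 mulfK//; lra.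
  by lra.
have E : (s * - (s / (1 + c)) = c - 1)%R.
  by rewrite mulrN mulrA -expr2 s2 mulfK//; lra.
set k := (- (s / (1 + c)))%R in E *.
have E2 : (k * (1 + c) = - s)%R by rewrite /k mulNr divfK.
transitivity ((1 + s * k) * w.1 + (k * (2 + s * k)) * w.2)%R; first by lra.
rewrite E (_ : 2 + (c - 1) = 1 + c)%R ?E2; lra.
Qed.

Lemma leb3_rot (c s : R) : (c ^+ 2 + s ^+ 2 = 1)%R ->
  mpres (leb3 R) (leb3 R) (fun v : mvec3 R => (rot2 c s v.1, v.2) : mvec3 R).
Proof.
move=> cs.
exact: (@mpres_fst _ _ _ _ _ _ _ (leb2 R) lebesgue_measure (leb2 R)
    (fun (y : mR R) (x : mvec2 R) => rot2 c s x : mvec2 R)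
    ltac:(by rewrite /rot2; meas) (fun=> leb2_rot cs)).
Qed.

End planes.

(** * The substitution s = w^2 *)

Section density.
Local Open Scope ereal_scope.
Context d (T : measurableType d) (R : realType) (mu : {measure set T -> \bar R}).
Variable k : T -> R.
Hypothesis mk : meas_fun k.
Hypothesis k0 : forall x, (0 <= k x)%R.

Definition density (A : set T) : \bar R := \int[mu]_(x in A) (k x)%:E.

Let density0 : density set0 = 0.
Proof. by rewrite /density integral_set0. Qed.

Let density_ge0 A : 0 <= density A.
Proof. by apply: integral_ge0 => x _; rewrite lee_fin. Qed.

Let density_sigma_additive : semi_sigma_additive density.
Proof.
move=> F mF tF mUF; rewrite /density ge0_integral_bigcup//=; last 2 first.
  by apply: measurable_funTS; meas.
  by move=> x _; rewrite lee_fin.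
apply: is_cvg_ereal_nneg_natsum_cond => n _ _.
by apply: integral_ge0 => x _; rewrite lee_fin.
Qed.

HB.instance Definition _ := isMeasure.Build _ _ _ density
  density0 density_ge0 density_sigma_additive.

Definition density_measure : {measure set T -> \bar R} := density.

Import HBNNSimple.

(** True for indicators by definition of [density], hence for simple functions,
  and in general by monotone convergence. *)
Lemma ge0_integral_density (f : T -> \bar R) :
  meas_fun f -> (forall x, 0 <= f x) ->
  \int[density_measure]_x f x = \int[mu]_x ((k x)%:E * f x).
Proof.
move=> mf f0.
pose f_ := nnsfun_approx measurableT mf.
have mkE : meas_fun (fun x => (k x)%:E) by meas.
transitivity (limn (fun n => \int[density_measure]_x (f_ n x)%:E)).
  rewrite -monotone_convergence//.
  - apply: eq_integral => y _; apply/esym/cvg_lim => //.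
    by apply: cvg_nnsfun_approx=> // *; exact: f0.
  - by move=> n; exact/measurable_EFinP/measurable_funP.
  - by move=> n y _; rewrite lee_fin.
  - by move=> y _ m n mn; rewrite lee_fin; exact/lefP/nd_nnsfun_approx.
rewrite [X in limn X](_ : _ = (fun n => \int[mu]_x ((k x)%:E * (f_ n x)%:E))).
  rewrite -monotone_convergence//; last 3 first.
    - move=> n /=; apply: emeasurable_funM => //.
      by exact/measurable_EFinP/measurable_funP.
    - by move=> n x _ /=; rewrite mule_ge0// lee_fin.
    - move=> x _ m n mn; rewrite lee_wpmul2l ?lee_fin//.
      exact/lefP/nd_nnsfun_approx.
  apply: eq_integral => x _ /=; apply/cvg_lim => //.
  apply: cvgeZl => //.
  by apply: cvg_nnsfun_approx=> // y Dy; exact: f0.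
apply/funext => n.
transitivity (\sum_(r \in range (f_ n))
    \int[mu]_x ((k x)%:E * (r * \1_(f_ n @^-1` [set r]) x)%:E)).
  under eq_integral do rewrite fimfunE -fsumEFin//.
  rewrite ge0_integral_fsum//; last 2 first.
  - by move=> y; exact/measurable_EFinP/measurable_funM.
  - by move=> y x _; rewrite nnfun_muleindic_ge0.
  apply: eq_fsbigr => r rr; rewrite integralZl_indic_nnsfun//.
  rewrite integral_indic//= setIT /density.
  have r0 : (0 <= r)%R by move: rr; rewrite inE => -[x _ <-].
  rewrite integral_mkcond -ge0_integralZl//; last 2 first.
  - apply/(measurable_restrictT _ _).1; last exact: measurable_funTS.
    by rewrite -[X in measurable X]setTI; exact: (measurable_funP (f_ n)).
  - by move=> x _; apply: erestrict_ge0 => y _; rewrite lee_fin.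
  apply: eq_integral => x _; rewrite patchE indicE.
  by case: ifP => _; rewrite ?mulr1 ?mulr0 ?mule0// muleC.
rewrite -ge0_integral_fsum//.
- apply: eq_integral => x _.
  rewrite -ge0_mule_fsumr; last first.
    by move=> r; rewrite nnfun_muleindic_ge0.
  by rewrite fsumEFin// -fimfunE.
- by move=> r; apply: emeasurable_funM => //; exact/measurable_EFinP/measurable_funM.
- by move=> r x _; rewrite mule_ge0 ?nnfun_muleindic_ge0 ?lee_fin.
Qed.

End density.

(** The fundamental theorem for a primitive of a continuous function on the whole
  line, where the one-sided conditions at the end points are automatic. *)
Lemma FTC2_everywhere (R : realType) (F f : R -> R) (a b : R) : a <= b ->
  (forall x : R, is_derive x (1 : R) F (f x)) -> continuous f ->
  (\int[lebesgue_measure]_(x in `[a, b]) (f x)%:E = (F b - F a)%:E)%E.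
Proof.
move=> + dF cf; rewrite le_eqVlt => /predU1P[->|ab].
  by rewrite set_itv1 integral_set1 subrr.
have cF : continuous F.
  move=> x; apply: differentiable_continuous; apply/derivable1_diffP.
  by case: (dF x).
rewrite (@continuous_FTC2 _ f F)//.
- exact: continuous_subspaceT.
- split.
  + by move=> x _; case: (dF x).
  + by apply: cvg_at_right_filter; exact: cF.
  + by apply: cvg_at_left_filter; exact: cF.
- by move=> x _; rewrite derive1E; case: (dF x).
Qed.

Lemma integral_if d (T : measurableType d) (R : realType) (mu : {measure set T -> \bar R})
    (A : set T) (P : T -> bool) (f : T -> \bar R) : A = [set x | P x] ->
  (\int[mu]_(x in A) f x = \int[mu]_x (if P x then f x else 0))%E.
Proof.
move=> ->; rewrite integral_mkcond; apply: eq_integral => x _.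
rewrite patchE; suff -> : x \in [set x | P x] = P x by [].
by apply/idP/idP; rewrite inE.
Qed.

Section square_substitution.
Context {R : realType}.
Local Notation leb := (@lebesgue_measure R).
Local Open Scope ereal_scope.

(* Substituting [s = w ^ 2] on the half line says that squaring maps the measure
   with density [kw] to the one with density [ks]; both are determined by their
   values on intervals. *)
Let kw (w : mR R) : R := if (0 < w)%R then (2 * w)%R else 0%R.
Let ks (w : mR R) : R := if (0 < w)%R then 1%R else 0%R.

Let mpos : meas_fun (fun w : mR R => (0 < w)%R).
Proof. exact: measurable_fun_ltr. Qed.

Let mkw : meas_fun kw.
Proof. by apply: measurable_fun_ifT => //; meas. Qed.

Let mks : meas_fun ks.
Proof. exact: measurable_fun_ifT. Qed.

Let kw0 w : (0 <= kw w)%R.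
Proof. by rewrite /kw; case: ifPn => // w0; rewrite mulr_ge0// ltW. Qed.

Let ks0 w : (0 <= ks w)%R.
Proof. by rewrite /ks; case: ifPn. Qed.

Let sq (w : mR R) : mR R := (w ^+ 2)%R.

Let msq : meas_fun sq.
Proof. by rewrite /sq; meas. Qed.

Let ocE (u v : R) (f : R -> \bar R) :
  \int[leb]_(x in `]u, v]) f x = \int[leb]_x (if (u < x <= v)%R then f x else 0).
Proof. by apply: integral_if; exact: set_itvoc. Qed.

Let kwE (a b : R) : density leb kw (sq @^-1` `]a, b]) = density leb ks `]a, b].
Proof.
rewrite /density.
have sqE : sq @^-1` `]a, b] = [set x | (a < sq x <= b)%R].
  by apply/seteqP; split => x /=; rewrite in_itv.
have [b0|b0] := leP b 0%R.
  apply: (etrans (integral_if _ _ sqE)).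
  rewrite ocE.
  apply: eq_integral => x _; rewrite /kw /ks.
  case: ifP => [/andP[_ xb]|_].
    have : (sq x <= 0)%R by exact: le_trans xb b0.
    rewrite /sq real_exprn_even_le0//= => /eqP ->; rewrite ltxx.
    by case: ifP.
  case: ifP => // /andP[_ xb]; rewrite ltNge (le_trans xb b0)//.
pose c := Num.max a 0%R.
have c0 : (0 <= c)%R by rewrite le_max lexx orbT.
have ac x : (0 < x)%R -> (a < x)%R = (c < x)%R.
  by move=> x0; rewrite /c gt_max x0 andbT.
transitivity (\int[leb]_(x in `]Num.sqrt c, Num.sqrt b]) (2 * x)%:E).
  apply: (etrans (integral_if _ _ sqE)).
  rewrite ocE.
  apply: eq_integral => x _; rewrite /kw.
  have [x0|x0] := ltP 0%R x; last first.
    rewrite if_same//; case: ifP => // /andP[cx _].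
    by move: (lt_le_trans cx x0); rewrite ltNge sqrtr_ge0.
  have xs : x = Num.sqrt (sq x) by rewrite sqrtr_sqr gtr0_norm.
  have sx0 : (0 < sq x)%R by rewrite /sq exprn_gt0.
  rewrite ac//; suff -> : (Num.sqrt c < x <= Num.sqrt b)%R = (c < sq x <= b)%R by [].
  by rewrite [in LHS]xs ltr_sqrt// ler_sqrt// ltW.
transitivity (\int[leb]_(x in `]c, b]) (1 : R)%:E); last first.
  rewrite !ocE.
  apply: eq_integral => x _; rewrite /ks.
  have [x0|x0] := ltP 0%R x; first by rewrite ac.
  rewrite if_same//; case: ifP => // /andP[cx _].
  by move: (lt_le_trans cx x0); rewrite ltNge c0.
have [bc|cb] := leP b c.
  by rewrite !set_itv_ge ?integral_set0// bnd_simp -leNgt// ler_wsqrtr.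
rewrite integral_cst//= lebesgue_measure_itv/= lte_fin cb mul1e.
rewrite integral_itv_obnd_cbnd; last by apply: measurable_funTS; meas.
have dF (x : R) : is_derive x (1%R : R) (fun x : R => x ^+ 2)%R (2 * x)%R.
  by apply: is_derive_eq; rewrite /GRing.scale /=; ring.
rewrite (FTC2_everywhere _ dF).
- by rewrite !sqr_sqrtr// ltW.
- by rewrite ler_wsqrtr// ltW.
- exact: mulrl_continuous.
Qed.

Lemma ge0_integral_sqr (h : R -> \bar R) : meas_fun h -> (forall x, 0 <= h x) ->
  \int[leb]_w (if (0 < w)%R then (2 * w)%:E * h (w ^+ 2)%R else 0) =
  \int[leb]_s (if (0 < s)%R then h s else 0).
Proof.
move=> mh h0.
have [mu muE] : exists mu : {measure set (mR R) -> \bar R},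
    mu = pushforward (density_measure leb mkw kw0) sq :> (set _ -> _).
  by unshelve eexists (pushforward (density_measure leb mkw kw0) sq).
have muks A : measurable A -> mu A = density_measure leb mks ks0 A.
  move=> mA.
  apply: (@measure_unique _ R (mR R) (@ocitv R) (fun n => `](- n%:R)%R, n%:R]%classic)) => //.
  - exact: ocitvI.
  - by move=> n; exact: is_ocitv.
  - exact: bigcup_itvT.
  - by move=> _ [[a b] _ <-]; rewrite muE; exact: kwE.
  - move=> n; rewrite muE /pushforward /density_measure /= kwE /density.
    apply: (@le_lt_trans _ _ (\int[leb]_(x in `](- n%:R)%R, n%:R]) (1 : R)%:E)).
      apply: ge0_le_integral => //.
      + by move=> x _; rewrite lee_fin.
      + by apply: measurable_funTS; meas.
      + by move=> x _; rewrite lee_fin /ks; case: ifP.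
    rewrite integral_cst//= lebesgue_measure_itv/= mul1e; case: ifP => // _.
    by rewrite -EFinB ltry.
transitivity (\int[density_measure leb mkw kw0]_w h (sq w)).
  rewrite ge0_integral_density//; last exact: measurableT_comp.
  apply: eq_integral => w _; rewrite /kw /sq; case: ifP => // _.
  by rewrite mul0e.
transitivity (\int[density_measure leb mks ks0]_s h s); last first.
  rewrite ge0_integral_density//.
  apply: eq_integral => w _; rewrite /ks; case: ifP => // _.
    by rewrite mul1e.
  by rewrite mul0e.
rewrite [RHS](eq_measure_integral mu); last by move=> A mA _; exact/esym/muks.
by rewrite muE ge0_integral_pushforward.
Qed.

Lemma ge0_integral_sqrt (h : R -> \bar R) : meas_fun h -> (forall x, 0 <= h x) ->
  \int[leb]_w (if (0 < w)%R then h w else 0) =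
  \int[leb]_s (if (0 < s)%R then (2 * Num.sqrt s)^-1%:E * h (Num.sqrt s) else 0).
Proof.
move=> mh h0.
rewrite -(@ge0_integral_sqr (fun s => (2 * Num.sqrt s)^-1%:E * h (Num.sqrt s))).
- apply: eq_integral => w _; case: ifP => // w0.
  rewrite sqrtr_sqr gtr0_norm// muleA -EFinM divff ?mul1e//.
  by rewrite mulf_neq0// gt_eqF.
- apply: emeasurable_funM; first by meas.
  by apply: measurableT_comp => //; meas.
- by move=> x; rewrite mule_ge0// lee_fin invr_ge0 mulr_ge0 ?sqrtr_ge0.
Qed.

End square_substitution.

(** * Radial integrals and bipolar coordinates *)

Section half_line.
Context {R : realType}.
Local Notation leb := (@lebesgue_measure R).
Local Open Scope ereal_scope.

Lemma ge0_integral_half_line (g : R -> \bar R) :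
  meas_fun g -> (forall x, 0 <= g x) ->
  \int[leb]_x g x = \int[leb]_x (if (0 < x)%R then g x + g (- x)%R else 0).
Proof.
move=> mg g0.
have mgN : meas_fun (fun x : mR R => g (- x)%R).
  by apply: measurableT_comp => //; meas.
pose f1 (x : mR R) := if (0 < x)%R then g x else 0.
pose f2 (x : mR R) := if (x < 0)%R then g x else 0.
have mf1 : meas_fun f1 by rewrite /f1; meas.
have mf2 : meas_fun f2 by rewrite /f2; meas.
have f10 x : 0 <= f1 x by rewrite /f1; case: ifP.
have f20 x : 0 <= f2 x by rewrite /f2; case: ifP.
transitivity (\int[leb]_x (f1 x + f2 x)).
  apply: ge0_ae_eq_integral => //.
  - exact: emeasurable_funD.
  - by move=> x _; rewrite adde_ge0.
  - exists [set 0%R]; split; [exact: measurable_set1|exact: lebesgue_measure_set1|].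
    move=> x /=; apply: contra_notP => /eqP x0 _.
    rewrite /f1 /f2; case: ltgtP x0 => //; by rewrite ?adde0 ?add0e.
rewrite ge0_integralD//.
have -> : \int[leb]_x f2 x = \int[leb]_x (if (0 < x)%R then g (- x)%R else 0).
  rewrite -(mpres_ge0_integral lebesgue_reflect mf2 f20).
  by apply: eq_integral => x _; rewrite /f2 oppr_lt0.
rewrite -ge0_integralD//.
- by apply: eq_integral => x _; rewrite /f1; case: ifP; rewrite ?adde0.
- by move=> x _; case: ifP.
- by meas.
Qed.

(** For fixed [x], the two half lines [y > 0] and [y < 0] are both parametrised by
  [a = x ^ 2 + y ^ 2]. *)
Lemma ge0_integral_leb2_sqr (f : R -> R -> \bar R) :
  meas_fun (fun w : mvec2 R => f w.1 w.2) ->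
  (forall x y, 0 <= f x y) ->
  \int[leb2 R]_w f w.1 w.2 =
  \int[leb]_a \int[leb]_x (if (x ^+ 2 < a)%R then
    (2 * Num.sqrt (a - x ^+ 2))^-1%:E *
    (f x (Num.sqrt (a - x ^+ 2)) + f x (- Num.sqrt (a - x ^+ 2))%R) else 0).
Proof.
move=> mf f0; rewrite tonelli12//=.
have mh (x : R) : meas_fun (fun y => f x y + f x (- y)%R).
  by meas.
rewrite -[RHS]tonelli_swap; last 2 first.
- by meas.
- move=> x a; case: ifP => // xa; apply: mule_ge0; last exact: adde_ge0.
  by rewrite lee_fin invr_ge0 mulr_ge0// sqrtr_ge0.
apply: eq_integral => x _.
rewrite ge0_integral_half_line//; last first.
  by meas.
rewrite (@ge0_integral_sqrt _ (fun y => f x y + f x (- y)%R))//; last first.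
  by move=> y; rewrite adde_ge0.
rewrite -(mpres_ge0_integral (lebesgue_translate (- x ^+ 2))); last 2 first.
- by meas.
- move=> y; case: ifP => // xa; apply: mule_ge0; last exact: adde_ge0.
  by rewrite lee_fin invr_ge0 mulr_ge0// sqrtr_ge0.
by apply: eq_integral => a _; rewrite subr_gt0.
Qed.

End half_line.

Section radial.
Context {R : realType}.
Local Notation leb := (@lebesgue_measure R).
Local Open Scope ereal_scope.

(* The mass of the unnormalised arcsine law, which does not depend on [a > 0] by scaling. *)
Let K (a : R) : \bar R :=
  \int[leb]_x (if (x ^+ 2 < a)%R then (Num.sqrt (a - x ^+ 2))^-1%:E else 0).

Let K0 a : 0 <= K a.
Proof.
by apply: integral_ge0 => x _; case: ifP => // _; rewrite lee_fin invr_ge0 sqrtr_ge0.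
Qed.

Let KE a : K a = if (0 < a)%R then K 1 else 0.
Proof.
rewrite /K; case: ifPn => a0; last first.
  apply: integral0_eq => x _; case: ifPn => // xa; exfalso.
  by move/negP: a0; apply; apply: le_lt_trans xa; rewrite sqr_ge0.
have sa0 : (0 < Num.sqrt a)%R by rewrite sqrtr_gt0.
rewrite (@ge0_integral_scale _ (Num.sqrt a)); last 3 first.
- by rewrite gt_eqF.
- by meas.
- by move=> x; case: ifP => // _; rewrite lee_fin invr_ge0 sqrtr_ge0.
rewrite -ge0_integralZl//; last 2 first.
- by meas.
- by move=> x _; case: ifP => // _; rewrite lee_fin invr_ge0 sqrtr_ge0.
apply: eq_integral => x _.
rewrite exprMn sqr_sqrtr ?ltW// gtr_pMr//; case: ifP => x1; last by rewrite mule0.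
rewrite -{2}(mulr1 a) -mulrBr sqrtrM ?ltW// -EFinM gtr0_norm// invfM mulrA.
by rewrite divff ?mul1r// gt_eqF.
Qed.

Let radialK (h : R -> \bar R) : meas_fun h -> (forall a, 0 <= h a) ->
  \int[leb2 R]_w h (w.1 ^+ 2 + w.2 ^+ 2)%R =
  K 1 * \int[leb]_a (if (0 < a)%R then h a else 0).
Proof.
move=> mh h0.
rewrite (@ge0_integral_leb2_sqr _ (fun x y => h (x ^+ 2 + y ^+ 2)%R))//; last by meas.
rewrite -ge0_integralZl//; last 2 first.
- by meas.
- by move=> x _; case: ifP.
apply: eq_integral => a _.
transitivity (\int[leb]_x (h a * (if (x ^+ 2 < a)%R then (Num.sqrt (a - x ^+ 2))^-1%:E else 0))).
  apply: eq_integral => x _; case: ifP => xa; last by rewrite mule0.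
  have xa0 : (0 <= a - x ^+ 2)%R by rewrite subr_ge0 ltW.
  rewrite sqrrN sqr_sqrtr// (_ : x ^+ 2 + (a - x ^+ 2) = a)%R; last by rewrite addrC subrK.
  rewrite -{1 2}(mul1e (h a)) -ge0_muleDl// -EFinD muleA -EFinM muleC; congr (_ * _%:E).
  by rewrite invfM mulrAC (_ : 1 + 1 = 2)%R// mulVf ?mul1r.
rewrite ge0_integralZl//; last 2 first.
- by meas.
- by move=> x _; case: ifP => // _; rewrite lee_fin invr_ge0 sqrtr_ge0.
rewrite -/(K a) KE muleC.
by case: ifP => // _; rewrite mule0 mul0e.
Qed.

(* The integral of the Gaussian over the plane is known in both forms. *)
Let K1 : K 1 = pi%:E.
Proof.
have := @radialK (fun a => (expR (- a))%:E) ltac:(by meas) (fun a => ltac:(by rewrite lee_fin expR_ge0)).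
have -> : \int[leb]_a (if (0 < a)%R then (expR (- a))%:E else 0) = 1 :> \bar R.
  rewrite -(@integral_exponential_pdf R 1)//; apply: ge0_ae_eq_integral => //.
  - by meas.
  - by apply/measurable_EFinP; exact: measurable_exponential_pdf.
  - by move=> x _; case: ifP => // _; rewrite lee_fin expR_ge0.
  - by move=> x _; rewrite lee_fin exponential_pdf_ge0.
  - exists [set 0%R]; split; [exact: measurable_set1|exact: lebesgue_measure_set1|].
    move=> x /=; apply: contra_notP => /eqP x0 _.
    case: ltgtP x0 => // x0 _; last by rewrite lt0_exponential_pdf.
    by rewrite exponential_pdfE ?(ltW x0)// mul1r mulN1r.
rewrite mule1 => <-.
rewrite tonelli12//=; last by meas.
have mg : meas_fun (fun x : mR R => (gauss_fun x)%:E).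
  by apply/measurable_EFinP; exact: measurable_gauss_fun.
have g0 (x : R) : 0 <= (gauss_fun x)%:E by rewrite lee_fin gauss_fun_ge0.
transitivity (\int[leb]_x ((gauss_fun x)%:E * (Num.sqrt pi)%:E)).
  apply: eq_integral => x _; rewrite -integralT_gauss -ge0_integralZl//.
  by apply: eq_integral => y _; rewrite -EFinM /gauss_fun -expRD opprD.
rewrite ge0_integralZr// ?lee_fin ?sqrtr_ge0//.
by rewrite integralT_gauss -EFinM -expr2 sqr_sqrtr ?pi_ge0.
Qed.

Lemma ge0_integral_radial (h : R -> \bar R) :
  meas_fun h -> (forall a, 0 <= h a) ->
  \int[leb2 R]_w h (w.1 ^+ 2 + w.2 ^+ 2)%R =
  pi%:E * \int[leb]_a (if (0 < a)%R then h a else 0).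
Proof. by rewrite -K1; exact: radialK. Qed.

End radial.

Section bipolar.
Context {R : realType}.
Local Notation leb := (@lebesgue_measure R).
Local Open Scope ereal_scope.

(** Sixteen times the squared area of the triangle with sides [r], [sqrt a],
  [sqrt b] (Heron's formula). *)
Definition heron (r a b : R) : R := (4 * r ^+ 2 * a - (r ^+ 2 + a - b) ^+ 2)%R.

(** The abscissa of the point at distance [sqrt a] from the origin and [sqrt b]
  from [(r, 0)]. *)
Definition apex (r a b : R) : R := ((r ^+ 2 + a - b) / (2 * r))%R.

(** The sum of the values of [c] at the two points of the plane at distance
  [sqrt a] from the origin and [sqrt b] from [(r, 0)], divided by the Jacobian
  [2 * sqrt (heron r a b)]. The factor [pi ^ 2] makes [a] and [b] the squared radii
  of two planes. *)
Definition bipolar_kernel (c : vec2 R -> R) (r a b : R) : R :=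
  if (0 < heron r a b)%R then
    ((c (apex r a b, Num.sqrt (a - apex r a b ^+ 2)) +
      c (apex r a b, - Num.sqrt (a - apex r a b ^+ 2))) /
    (2 * pi ^+ 2 * Num.sqrt (heron r a b)))%R
  else 0%R.

Lemma measurable_bipolar_kernel (c : vec2 R -> R) (r : R) :
  meas_fun (c : mvec2 R -> R) ->
  meas_fun (fun z : mvec2 R => bipolar_kernel c r z.1 z.2).
Proof. by move=> mc; rewrite /bipolar_kernel /heron /apex; meas. Qed.

Lemma bipolar_kernel_ge0 (c : vec2 R -> R) (r a b : R) :
  (forall w, 0 <= c w)%R -> (0 <= bipolar_kernel c r a b)%R.
Proof.
move=> c0; rewrite /bipolar_kernel; case: ifP => // _.
by rewrite divr_ge0 ?addr_ge0// !mulr_ge0// ?exprn_ge0 ?pi_ge0 ?sqrtr_ge0.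
Qed.

Lemma heronE (r a b : R) : (0 < r)%R -> heron r a b = (4 * r ^+ 2 * (a - apex r a b ^+ 2))%R.
Proof.
move=> r0; rewrite /heron /apex; field; lra.
Qed.

Lemma heron_gt0 (r a b : R) : (0 < r)%R -> (0 < heron r a b)%R = (apex r a b ^+ 2 < a)%R.
Proof.
by move=> r0; rewrite heronE// pmulr_rgt0 ?subr_gt0// mulr_gt0// exprn_gt0.
Qed.

Lemma apexE (r a b : R) : (0 < r)%R -> b = ((r - apex r a b) ^+ 2 + (a - apex r a b ^+ 2))%R.
Proof. by move=> r0; rewrite /apex; field; lra. Qed.

(** Both sides reduce to integrals over the squared distances [a] and [b] to the
  two foci: on the left by replacing the second coordinate by [a], then the
  first one, at fixed [a], by [b], which is an affine function of it; on the
  right because the integrand is radial in [w] and in [z], each plane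
  contributing a factor [pi]. *)
Lemma bipolar_coordinates (c : vec2 R -> R) (G : R -> R -> \bar R) (r : R) :
  (0 < r)%R ->
  meas_fun (c : mvec2 R -> R) -> (forall w, 0 <= c w)%R ->
  meas_fun (fun z : mvec2 R => G z.1 z.2) -> (forall a b, 0 <= G a b) ->
  \int[leb2 R]_w ((c w)%:E * G ((r - w.1) ^+ 2 + w.2 ^+ 2)%R (w.1 ^+ 2 + w.2 ^+ 2)%R) =
  \int[leb2 R]_w \int[leb2 R]_z
    ((bipolar_kernel c r (w.1 ^+ 2 + w.2 ^+ 2) (z.1 ^+ 2 + z.2 ^+ 2))%:E *
     G (z.1 ^+ 2 + z.2 ^+ 2)%R (w.1 ^+ 2 + w.2 ^+ 2)%R).
Proof.
move=> r0 mc c0 mG G0.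
have mk := measurable_bipolar_kernel r mc.
pose P a b := (bipolar_kernel c r a b)%:E * G b a.
have P0 a b : 0 <= P a b by rewrite mule_ge0// lee_fin bipolar_kernel_ge0.
have mP : meas_fun (fun z : mvec2 R => P z.1 z.2).
  by rewrite /P; apply: measMe; meas.
pose Q a := pi%:E * \int[leb]_b (if (0 < b)%R then P a b else 0).
have mQi : meas_fun (fun z : mvec2 R => if (0 < z.2)%R then P z.1 z.2 else 0).
  by meas.
have Q0 a : 0 <= Q a.
  rewrite mule_ge0 ?lee_fin ?pi_ge0//; apply: integral_ge0 => b _.
  by case: ifP.
have mQ : meas_fun Q.
  apply: measMe; first exact: measurable_cstT.
  apply: (@measurable_integral1 _ _ _ _ _ leb (fun a b : mR R => if (0 < b)%R then P a b else 0)) => //.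
  by move=> x y; case: ifP.
transitivity (\int[leb2 R]_w Q (w.1 ^+ 2 + w.2 ^+ 2)%R); last first.
  apply: eq_integral => w _; rewrite /Q -ge0_integral_radial//.
  by meas.
rewrite ge0_integral_radial//.
pose g (x y : R) := (c (x, y))%:E * G ((r - x) ^+ 2 + y ^+ 2)%R (x ^+ 2 + y ^+ 2)%R.
transitivity (\int[leb2 R]_w g w.1 w.2).
  by apply: eq_integral => -[x y] _.
rewrite ge0_integral_leb2_sqr; last 2 first.
- by rewrite /g; meas.
- by move=> x y; rewrite mule_ge0// lee_fin.
rewrite -ge0_integralZl//; last 3 first.
- by meas.
- by move=> a _; case: ifP.
- by rewrite lee_fin pi_ge0.
apply: eq_integral => a _.
pose k (x : R) := if (x ^+ 2 < a)%R then
    (2 * Num.sqrt (a - x ^+ 2))^-1%:E *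
      (((c (x, Num.sqrt (a - x ^+ 2)))%:E + (c (x, - Num.sqrt (a - x ^+ 2))%R)%:E) *
       G ((r - x) ^+ 2 + (a - x ^+ 2))%R a) else 0.
transitivity (\int[leb]_x k x).
  apply: eq_integral => x _; rewrite /k /g; case: ifP => // xa.
  have xa0 : (0 <= a - x ^+ 2)%R by rewrite subr_ge0 ltW.
  rewrite sqrrN sqr_sqrtr// (_ : x ^+ 2 + (a - x ^+ 2) = a)%R; last by rewrite addrC subrK.
  by rewrite ge0_muleDl// lee_fin.
have k0 x : 0 <= k x.
  rewrite /k; case: ifP => // _; apply: mule_ge0.
    by rewrite lee_fin invr_ge0 mulr_ge0// sqrtr_ge0.
  by rewrite mule_ge0// adde_ge0// lee_fin.
have mkk : meas_fun k.
  by rewrite /k; meas.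
rewrite (@ge0_integral_scale _ (- (2 * r)^-1)%R)//; last first.
  by rewrite oppr_eq0 invr_eq0 mulf_neq0// gt_eqF.
rewrite -(mpres_ge0_integral (lebesgue_translate (- (r ^+ 2 + a)))); last 2 first.
- by meas.
- by [].
have E b : (- (2 * r)^-1 * (b + - (r ^+ 2 + a)) = apex r a b)%R.
  by rewrite /apex; ring.
under eq_integral do rewrite E.
rewrite normrN ger0_norm; last by rewrite invr_ge0 mulr_ge0// ltW.
rewrite -ge0_integralZl//; last 2 first.
- by rewrite /apex; meas.
- by rewrite lee_fin invr_ge0 mulr_ge0// ltW.
have [a0|a0] := ltP 0%R a; last first.
  rewrite mule0; apply: integral0_eq => b _; rewrite /k ifF ?mule0//.
  by apply/negbTE; rewrite -leNgt (le_trans a0)// sqr_ge0.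
rewrite /Q muleA -EFinM -ge0_integralZl//; last 3 first.
- by meas.
- by move=> b _; case: ifP.
- by rewrite lee_fin mulr_ge0// pi_ge0.
apply: eq_integral => b _.
rewrite /k /P /bipolar_kernel heron_gt0//.
case: ifP => ab; last by rewrite mul0e if_same !mule0.
have sab0 : (0 < a - apex r a b ^+ 2)%R by rewrite subr_gt0.
have b0 : (0 < b)%R.
  by rewrite (apexE a b r0) ltr_wpDl// sqr_ge0.
rewrite b0 -apexE// !muleA -EFinD -!EFinM; congr (_%:E * _).
rewrite heronE// sqrtrM; last by rewrite mulr_ge0// sqr_ge0.
rewrite (_ : 4 * r ^+ 2 = (2 * r) ^+ 2)%R; last by ring.
rewrite sqrtr_sqr gtr0_norm ?mulr_gt0//.
have : Num.sqrt (a - apex r a b ^+ 2) != 0%R by rewrite gt_eqF// sqrtr_gt0.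
have : (pi : R) != 0%R by rewrite gt_eqF// pi_gt0.
move: (Num.sqrt _) (c _) (c _) (@pi R) => s c1 c2 p p0 s0; field.
by rewrite s0 p0 gt_eqF.
Qed.

End bipolar.

(** * Smooth bump functions *)

Section flat_function.
Context {R : realType}.

(** The whole family, and not only [n = 0], because its span is stable under
  derivation. *)
Definition flat (n : nat) (x : R) : R := if 0 < x then x^-1 ^+ n * expR (- x^-1) else 0.

Lemma flat_ge0 n x : 0 <= flat n x.
Proof.
by rewrite /flat; case: ifP => // x0; rewrite mulr_ge0 ?expR_ge0// exprn_ge0// invr_ge0 ltW.
Qed.

Lemma flat_le0 n x : x <= 0 -> flat n x = 0.
Proof. by move=> x0; rewrite /flat ltNge x0. Qed.

(** The exponential dominates every power. *)
Lemma flat_le (n k : nat) (x : R) : 0 <= x -> flat n x <= (n + k)`!%:R * x ^+ k.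
Proof.
rewrite le_eqVlt => /predU1P[<-|x0].
  by rewrite flat_le0// mulr_ge0// exprn_ge0.
rewrite /flat x0.
have t0 : 0 < x^-1 by rewrite invr_gt0.
have : x^-1 ^+ (n + k) <= (n + k)`!%:R * expR (x^-1).
  case: (n + k)%N => [|N]; first by rewrite expr0 mul1r ltW// pexpR_gt1.
  rewrite mulrC -ler_pdivrMr ?ltr0n ?fact_gt0//.
  by apply: le_trans (expR_ge1Dxn N (ltW t0)); rewrite lerDr.
rewrite exprD expRN => h.
rewrite -ler_pdivlMr ?invr_gt0 ?expR_gt0// invrK.
rewrite [X in _ <= X]mulrAC -ler_pdivrMr ?exprn_gt0//.
by rewrite -exprVn.
Qed.

Lemma flat_le_fact n x : flat n x <= n`!%:R.
Proof.
have [x0|x0] := leP 0 x; last by rewrite flat_le0 ?ler0n// ltW.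
by have := @flat_le n 0 x x0; rewrite addn0 expr0 mulr1.
Qed.

(** At the origin the difference quotient is bounded by a multiple of [h], by
  [flat_le]. *)
Lemma is_derive_flat n (x : R) :
  is_derive x (1 : R) (flat n) (flat n.+2 x - n%:R * flat n.+1 x).
Proof.
case: (ltgtP 0 x) => [x0|x0|<-].
- have : is_derive x (1 : R) (fun x : R => x^-1 ^+ n * expR (- x^-1))
    (flat n.+2 x - n%:R * flat n.+1 x).
    have dV : is_derive x (1 : R) (fun x : R => x^-1) (- (x ^- 2)).
      by apply: is_derive_eq; [apply: is_deriveV; rewrite gt_eqF|rewrite scaler1].
    have dX := @is_deriveX _ _ _ n _ _ _ dV.
    have dN := is_deriveN dV.
    have dE := @is_derive1_comp _ expR (fun x : R => - x^-1) x _ _ (is_derive_expR _) dN.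
    have dM := is_deriveM dX dE.
    have -> : (fun x : R => x^-1 ^+ n * expR (- x^-1)) =
        (fun x : R => x^-1) ^+ n * (expR \o (fun x : R => - x^-1)).
      by apply/funext => y; rewrite !fctE.
    apply: (@is_derive_eq _ _ _ _ _ _ _ _ dM).
    rewrite /flat x0 exprfctE /GRing.scale /=.
    case: n {dX dM} => [|n]; first by rewrite !expr0 !mul0r ?mulr0 -exprVn; ring.
    rewrite /= -exprVn !exprS -natr1; ring.
  apply: near_eq_is_derive.
  near=> y; rewrite /flat ifT//; near: y; exact: lt_nbhsr.
- rewrite !flat_le0 ?ltW// mulr0 subr0.
  have : is_derive x (1 : R) (cst 0 : R -> R) 0 by exact: is_derive_cst.
  apply: near_eq_is_derive.
  near=> y; rewrite flat_le0//; apply: ltW; near: y; exact: lt_nbhsl.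
- rewrite !flat_le0// mulr0 subr0.
  have lim0 : h^-1 *: (flat n (h *: 1 + 0) - flat n 0) @[h --> (0:R)^'] --> (0 : R).
    apply/cvgrPdist_le => e e0.
    near=> h.
    rewrite sub0r normrN (flat_le0 n (lexx 0)) subr0 addr0 /GRing.scale /= mulr1.
    have h0 : h != 0 by near: h; exact: nbhs_dnbhs_neq.
    have [hp|hn] := ltP 0 h; last by rewrite flat_le0// mulr0 normr0 ltW.
    rewrite ger0_norm ?mulr_ge0 ?flat_ge0 ?invr_ge0 ?(ltW hp)//.
    rewrite ler_pdivrMl//.
    apply: le_trans (flat_le n 2 (ltW hp)) _.
    rewrite expr2 mulrCA ler_pM2l// mulrC -ler_pdivlMr; last by rewrite ltr0n fact_gt0.
    rewrite -[h]ger0_norm ?(ltW hp)//; apply: ltW; near: h.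
    apply: dnbhs0_lt; rewrite divr_gt0// ltr0n fact_gt0//.
  apply: DeriveDef; first by apply/cvg_ex; exists 0.
  exact/cvg_lim.
Unshelve. all: by end_near.
Qed.

Lemma continuous_flat n : continuous (flat n).
Proof.
move=> x; apply: differentiable_continuous; apply/derivable1_diffP.
by case: (is_derive_flat n x).
Qed.

End flat_function.

Section Ck_closure.
Context {R : realType} (V : normedModType R).
Implicit Types f g : V -> R.

Lemma Ck_continuous k f : Ck k f -> continuous f.
Proof.
by case: k => [//|k] [df _] x; exact: differentiable_continuous.
Qed.

Lemma Ck_pred k f : Ck k.+1 f -> Ck k f.
Proof.
elim: k f => [|k IH] f; first by move=> ?; exact: Ck_continuous 1%N _ _.
by move=> [df Df]; split => // w; exact/IH/Df.
Qed.

Lemma Ck_cst k (c : R) : Ck k (cst c : V -> R).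
Proof.
elim: k c => [|k IH] c /=; first by move=> x; exact: cst_continuous.
split; first by move=> x; exact: differentiable_cst.
move=> w; rewrite (_ : 'D_w _ = cst 0); first exact: IH.
by apply/funext => x; rewrite derive_cst.
Qed.

Lemma CkD k f g : Ck k f -> Ck k g -> Ck k (f + g).
Proof.
elim: k f g => [|k IH] f g.
  by move=> cf cg x; apply: continuousD; [exact: cf|exact: cg].
move=> [df Df] [dg Dg]; split; first by move=> p; exact: differentiableD.
move=> w; rewrite (_ : 'D_w _ = 'D_w f + 'D_w g); first by apply: IH; [exact: Df|exact: Dg].
by apply/funext => x; rewrite deriveD//; exact: diff_derivable.
Qed.

Lemma CkM k f g : Ck k f -> Ck k g -> Ck k (f * g).
Proof.
elim: k f g => [|k IH] f g.
  by move=> cf cg x; apply: continuousM; [exact: cf|exact: cg].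
move=> Ckf Ckg; have [df Df] := Ckf; have [dg Dg] := Ckg.
split; first by move=> p; exact: differentiableM.
move=> w; rewrite (_ : 'D_w _ = f * 'D_w g + g * 'D_w f).
  by apply: CkD; apply: IH; [exact: Ck_pred|exact: Dg|exact: Ck_pred|exact: Df].
by apply/funext => x; rewrite deriveM//; exact: diff_derivable.
Qed.

(** The derivative of a flat function along [w] is a combination of flat functions
  with constant coefficients, so induction on the order of differentiability
  applies to all of them at once. *)
Lemma Ck_flat k n (l L : V -> R) : (forall p, is_diff p l L) -> Ck k (flat n \o l).
Proof.
move=> dl; have cl : continuous l.
  by move=> p; apply: differentiable_continuous; case: (dl p).
have dlp p : differentiable l p by case: (dl p).
elim: k n => [|k IH] n.
  by move=> p; apply: continuous_comp; [exact: cl|exact: continuous_flat].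
have dflat y : differentiable (flat n : R -> R) y.
  by apply/derivable1_diffP; case: (is_derive_flat n y).
have dcomp p : differentiable (flat n \o l) p.
  exact: differentiable_comp.
split => // w.
rewrite (_ : 'D_w _ = cst (L w) * (flat n.+2 \o l + cst (- n%:R) * (flat n.+1 \o l))).
  apply: CkM; first exact: Ck_cst.
  apply: CkD => //; apply: CkM => //; exact: Ck_cst.
apply/funext => p; rewrite deriveE// diff_comp//.
have -> : 'd l p = L :> (V -> R) by case: (dl p).
rewrite /= diff1E//.
have [_ D] := is_derive_flat n (l p).
rewrite derive1E D /GRing.scale /=.
by rewrite /GRing.mul/= /GRing.add/=; congr (_ * _); rewrite mulNr.
Qed.

End Ck_closure.

Section bump_function.
Context {R : realType}.
Implicit Types k a b x : R.

(** As [k] grows, these smooth functions increase to the indicator function of the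
  open interval from [a] to [b]. *)
Definition bumpf k a b x : R := flat 0 (k * (x - a)) * flat 0 (k * (b - x)).

Definition dbump k a b x : R :=
  k * flat 2 (k * (x - a)) * flat 0 (k * (b - x)) -
  k * flat 0 (k * (x - a)) * flat 2 (k * (b - x)).

Lemma is_derive_bump k a b x : is_derive x (1 : R) (bumpf k a b) (dbump k a b x).
Proof.
have d1 : is_derive x (1 : R) (fun x : R => k * (x - a)) k.
  by apply: is_derive_eq; rewrite /GRing.scale /=; ring.
have d2 : is_derive x (1 : R) (fun x : R => k * (b - x)) (- k).
  by apply: is_derive_eq; rewrite /GRing.scale /=; ring.
have f1 := @is_derive1_comp _ (flat 0) _ x _ _ (is_derive_flat 0 _) d1.
have f2 := @is_derive1_comp _ (flat 0) _ x _ _ (is_derive_flat 0 _) d2.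
apply: (@is_derive_eq _ _ _ _ _ _ _ _ (is_deriveM f1 f2)).
by rewrite /dbump /GRing.scale /= !mul0r; ring.
Qed.

Lemma bump_ge0 k a b x : 0 <= bumpf k a b x.
Proof. by rewrite mulr_ge0// flat_ge0. Qed.

Lemma bump_le1 k a b x : bumpf k a b x <= 1.
Proof. by apply: mulr_ile1; rewrite ?flat_ge0// flat_le_fact. Qed.

Lemma bump_eq0 k a b x : 0 <= k -> ~~ (a < x < b) -> bumpf k a b x = 0.
Proof.
move=> k0; rewrite negb_and -!leNgt => /orP[h|h]; rewrite /bumpf.
  by rewrite flat_le0 ?mul0r// mulr_ge0_le0// subr_le0.
by rewrite [X in _ * X]flat_le0 ?mulr0// mulr_ge0_le0// subr_le0.
Qed.

Lemma dbump_eq0 k a b x : 0 <= k -> ~~ (a < x < b) -> dbump k a b x = 0.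
Proof.
move=> k0; rewrite negb_and -!leNgt => /orP[h|h]; rewrite /dbump.
  by rewrite !(@flat_le0 _ _ (k * (x - a))) ?mulr0 ?mul0r ?subrr// mulr_ge0_le0// subr_le0.
by rewrite !(@flat_le0 _ _ (k * (b - x))) ?mulr0 ?mul0r ?subrr// mulr_ge0_le0// subr_le0.
Qed.

Lemma normr_dbump_le k a b x : 0 <= k -> `|dbump k a b x| <= 4 * k.
Proof.
move=> k0; apply: le_trans (ler_normB _ _) _.
have f01 (y : R) : 0 <= flat 0 y <= 1 by rewrite flat_ge0 flat_le_fact.
have f21 (y : R) : 0 <= flat 2 y <= 2 by rewrite flat_ge0 flat_le_fact.
rewrite !normrM !ger0_norm ?flat_ge0//.
have /andP[? ?] := f01 (k * (x - a)); have /andP[? ?] := f21 (k * (x - a)).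
have /andP[? ?] := f01 (k * (b - x)); have /andP[? ?] := f21 (k * (b - x)).
have -> : 4 * k = k * 2 * 1 + k * 1 * 2 by ring.
by apply: lerD; apply: ler_pM => //; rewrite ?mulr_ge0//; apply: ler_pM.
Qed.

Lemma continuous_bump k a b : continuous (bumpf k a b).
Proof.
move=> x; apply: differentiable_continuous; apply/derivable1_diffP.
by case: (is_derive_bump k a b x).
Qed.

Lemma continuous_dbump k a b : continuous (dbump k a b).
Proof.
have c1 n : continuous (fun x => flat n (k * (x - a))).
  move=> x; apply: (@continuous_comp _ _ _ (fun x => k * (x - a)) (flat n)); last exact: continuous_flat.
  by apply: cvgM; [exact: cvg_cst|apply: cvgB; [exact: cvg_id|exact: cvg_cst]].
have c2 n : continuous (fun x => flat n (k * (b - x))).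
  move=> x; apply: (@continuous_comp _ _ _ (fun x => k * (b - x)) (flat n)); last exact: continuous_flat.
  by apply: cvgM; [exact: cvg_cst|apply: cvgB; [exact: cvg_cst|exact: cvg_id]].
move=> x; apply: cvgB; apply: cvgM; try exact: c2; apply: cvgM; try exact: c1; exact: cvg_cst.
Qed.

End bump_function.

Section linear_forms.
Context {R : realType}.

(** A function that is everywhere its own differential, i.e. is continuous
    and linear. *)
Definition lform (U V : normedModType R) (l : U -> V) := forall p, is_diff p l l.

Lemma lform_fst (U V : normedModType R) : lform (fst : U * V -> U).
Proof.
move=> p; have cf : continuous (fst : U * V -> U) by move=> q; exact: cvg_fst.
apply: DiffDef.
  exact: (@linear_differentiable _ _ _ (fst : {linear (U * V)%type -> U})).
exact: (@diff_lin _ _ _ (fst : {linear (U * V)%type -> U})).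
Qed.

Lemma lform_snd (U V : normedModType R) : lform (snd : U * V -> V).
Proof.
move=> p; have cf : continuous (snd : U * V -> V) by move=> q; exact: cvg_snd.
apply: DiffDef.
  exact: (@linear_differentiable _ _ _ (snd : {linear (U * V)%type -> V})).
exact: (@diff_lin _ _ _ (snd : {linear (U * V)%type -> V})).
Qed.

Lemma lform_comp (U V W : normedModType R) (f : U -> V) (g : V -> W) :
  lform f -> lform g -> lform (g \o f).
Proof. by move=> lf lg p; apply: is_diff_comp; [exact: lf|exact: lg]. Qed.

Lemma lformD (U V : normedModType R) (f g : U -> V) : lform f -> lform g ->
  lform (fun p => f p + g p).
Proof. by move=> lf lg p; exact: (is_diffD (lf p) (lg p)). Qed.

Lemma lformZ (U V : normedModType R) (k : R) (f : U -> V) : lform f ->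
  lform (fun p => k *: f p).
Proof. by move=> lf p; exact: (is_diffZ k (lf p)). Qed.

Lemma is_derive_lform (U : normedModType R) (l : U -> R) (h : R -> R) (h' : R) p w :
  lform l -> is_derive (l p) (1 : R) h h' -> is_derive p w (h \o l) (h' * l w).
Proof.
move=> ll [dh hE].
have dl : differentiable l p by case: (ll p).
have lE : 'd l p = l :> (U -> R) by case: (ll p).
have dh' : differentiable h (l p) by apply/derivable1_diffP.
have dc : differentiable (h \o l) p by exact: differentiable_comp.
apply: DeriveDef; first exact: diff_derivable.
rewrite deriveE// diff_comp// lE /= diff1E//.
by rewrite derive1E hE /GRing.scale /= mulrC.
Qed.

Lemma Ck_bump (U : normedModType R) (l : U -> R) n k a b : lform l ->
  Ck n (bumpf k a b \o l).
Proof.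
move=> ll.
rewrite (_ : _ \o _ = (flat 0 \o (k *: (l - cst a))) * (flat 0 \o (k *: (cst b - l)))).
  apply: CkM; apply: Ck_flat => p; apply: is_diffZ; apply: is_diffB; try exact: is_diff_cst; exact: ll.
by apply/funext => p.
Qed.

End linear_forms.

(** * Guiding centre coordinates and product test functions *)

Section gyro_coordinates.
Context {R : realType}.
Variable omega : R.
Hypothesis omega0 : omega != 0.

(** The guiding centre replaces the position: it is constant along the gyro field,
  which then only rotates the planar velocity. *)
Definition guide (p : phase R) : phase R :=
  ((p.1.1.1 + omega^-1 * p.2.1.2, p.1.1.2 - omega^-1 * p.2.1.1, p.1.2), p.2).

Definition unguide (q : phase R) : phase R :=
  ((q.1.1.1 - omega^-1 * q.2.1.2, q.1.1.2 + omega^-1 * q.2.1.1, q.1.2), q.2).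

Lemma guideK : cancel guide unguide.
Proof.
move=> [[[x1 x2] x3] [[v1 v2] v3]]; rewrite /guide /unguide /=.
by rewrite addrK subrK.
Qed.

Definition rotv (c s : R) (q : phase R) : phase R := (q.1, (rot2 c s q.2.1, q.2.2)).

Lemma rotvK c s : c ^+ 2 + s ^+ 2 = 1 -> cancel (rotv c s) (rotv c (- s)).
Proof.
move=> cs [x [[v1 v2] v3]]; rewrite /rotv /rot2 /=; congr (_, (_, _, _)).
  by rewrite -[RHS]mul1r -cs; ring.
by rewrite -[RHS]mul1r -cs; ring.
Qed.

Definition inbox (N : R) (q : phase R) : bool :=
  [&& `|q.1.1.1| <= N, `|q.1.1.2| <= N, `|q.1.2| <= N,
      `|q.2.1.1| <= N, `|q.2.1.2| <= N & `|q.2.2| <= N].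

Lemma inbox_shear (N l : R) (q : phase R) : inbox N q -> inbox (N + `|l| * N)
  ((q.1.1.1 + l * q.2.1.2, q.1.1.2 - l * q.2.1.1, q.1.2), q.2).
Proof.
rewrite /inbox /= => /and5P[x1 x2 x3 v1 /andP[v2 v3]].
have N0 : 0 <= `|l| * N by rewrite mulr_ge0// (le_trans _ x1).
have h x v : `|x| <= N -> `|v| <= N -> `|x + l * v| <= N + `|l| * N.
  move=> xN vN; apply: le_trans (ler_normD _ _) _; apply: lerD => //.
  by rewrite normrM ler_wpM2l.
have k v : v <= N -> v <= N + `|l| * N by move=> /le_trans; apply; rewrite lerDl.
by rewrite -mulrN !h ?normrN// !k.
Qed.

Lemma inbox_guide N p : inbox N p -> inbox (N + `|omega^-1| * N) (guide p).
Proof. exact: inbox_shear. Qed.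

Lemma inbox_unguide N q : inbox N q -> inbox (N + `|omega^-1| * N) (unguide q).
Proof. by move=> /(inbox_shear (- omega^-1)); rewrite normrN !mulNr opprK. Qed.

Lemma inbox_rotv N c s q : c ^+ 2 + s ^+ 2 = 1 -> inbox N q -> inbox (2 * N) (rotv c s q).
Proof.
move=> cs; rewrite /inbox /rotv /rot2 /= => /and5P[x1 x2 x3 v1 /andP[v2 v3]].
have N0 : 0 <= N by rewrite (le_trans _ x1).
have c1 : `|c| <= 1.
  by rewrite -(@expr_le1 _ 2)// -normrX ger0_norm ?sqr_ge0// -cs lerDl sqr_ge0.
have s1 : `|s| <= 1.
  by rewrite -(@expr_le1 _ 2)// -normrX ger0_norm ?sqr_ge0// -cs lerDr sqr_ge0.
have k v : v <= N -> v <= 2 * N by move=> /le_trans; apply; rewrite ler_peMl// ler1n.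
have h : 2 * N = 1 * N + 1 * N by ring.
rewrite (k _ x1) (k _ x2) (k _ x3) (k _ v3) /= andbT; apply/andP; split; rewrite h.
  by apply: le_trans (ler_normB _ _) _; rewrite !normrM; apply: lerD; apply: ler_pM.
by apply: le_trans (ler_normD _ _) _; rewrite !normrM; apply: lerD; apply: ler_pM.
Qed.

Let X1 (p : phase R) : R := p.1.1.1 + omega^-1 * p.2.1.2.
Let X2 (p : phase R) : R := p.1.1.2 + - omega^-1 * p.2.1.1.
Let X3 (p : phase R) : R := p.1.2.
Let V3 (p : phase R) : R := p.2.2.
Let U1 (c s : R) (p : phase R) : R := c * p.2.1.1 + - s * p.2.1.2.
Let U2 (c s : R) (p : phase R) : R := s * p.2.1.1 + c * p.2.1.2.

Let lf11 : lform (fun p : phase R => p.1.1.1).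
Proof.
exact: (lform_comp (@lform_fst _ _ _) (lform_comp (@lform_fst _ _ _) (@lform_fst _ _ _))).
Qed.
Let lf12 : lform (fun p : phase R => p.1.1.2).
Proof.
exact: (lform_comp (@lform_fst _ _ _) (lform_comp (@lform_fst _ _ _) (@lform_snd _ _ _))).
Qed.
Let lf13 : lform X3.
Proof. exact: (lform_comp (@lform_fst _ _ _) (@lform_snd _ _ _)). Qed.
Let lf21 : lform (fun p : phase R => p.2.1.1).
Proof.
exact: (lform_comp (@lform_snd _ _ _) (lform_comp (@lform_fst _ _ _) (@lform_fst _ _ _))).
Qed.
Let lf22 : lform (fun p : phase R => p.2.1.2).
Proof.
exact: (lform_comp (@lform_snd _ _ _) (lform_comp (@lform_fst _ _ _) (@lform_snd _ _ _))).
Qed.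
Let lf23 : lform V3.
Proof. exact: (lform_comp (@lform_snd _ _ _) (@lform_snd _ _ _)). Qed.

Let lX1 : lform X1. Proof. exact: lformD lf11 (lformZ _ lf22). Qed.
Let lX2 : lform X2. Proof. exact: lformD lf12 (lformZ _ lf21). Qed.
Let lU1 c s : lform (U1 c s). Proof. exact: lformD (lformZ _ lf21) (lformZ _ lf22). Qed.
Let lU2 c s : lform (U2 c s). Proof. exact: lformD (lformZ _ lf21) (lformZ _ lf22). Qed.

Section tensor.
Variables (k b : R) (a : 'I_6 -> R).

Let A1 : R := a (inord 0).
Let A2 : R := a (inord 1).
Let A3 : R := a (inord 2).
Let A4 : R := a (inord 3).
Let A5 : R := a (inord 4).
Let A6 : R := a (inord 5).

(** The factors that depend only on the invariants of [rotv]. *)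
Definition tensor_guide (q : phase R) : R :=
  bumpf k A1 b q.1.1.1 * bumpf k A2 b q.1.1.2 * bumpf k A3 b q.1.2 * bumpf k A4 b q.2.2.

Definition tensor (q : phase R) : R :=
  tensor_guide q * (bumpf k A5 b q.2.1.1 * bumpf k A6 b q.2.1.2).

(** The derivative of [tensor] along the rotation field of the planar velocity. *)
Definition dtensor (q : phase R) : R :=
  tensor_guide q * (bumpf k A5 b q.2.1.1 * (dbump k A6 b q.2.1.2 * q.2.1.1) -
                    dbump k A5 b q.2.1.1 * q.2.1.2 * bumpf k A6 b q.2.1.2).

Let tensorE c s : (fun p => tensor (rotv c s (guide p))) =
  (bumpf k A1 b \o X1) * (bumpf k A2 b \o X2) * (bumpf k A3 b \o X3) * (bumpf k A4 b \o V3) *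
  ((bumpf k A5 b \o U1 c s) * (bumpf k A6 b \o U2 c s)).
Proof.
by apply/funext => p; rewrite !fctE /tensor /tensor_guide /= /X1 /X2 /U1 /U2 !mulNr.
Qed.

(** Only the two planar velocity factors vary along the gyro field, which rotates
  them with angular velocity [- omega]. *)
Lemma is_derive_gyro c s p :
  is_derive p (gyro_field omega p) (fun p => tensor (rotv c s (guide p)))
    (- omega * dtensor (rotv c s (guide p))).
Proof.
rewrite tensorE; set w := gyro_field omega p.
have h1 := is_derive_lform w lX1 (is_derive_bump k A1 b (X1 p)).
have h2 := is_derive_lform w lX2 (is_derive_bump k A2 b (X2 p)).
have h3 := is_derive_lform w lf13 (is_derive_bump k A3 b (X3 p)).
have h4 := is_derive_lform w lf23 (is_derive_bump k A4 b (V3 p)).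
have h5 := is_derive_lform w (lU1 c s) (is_derive_bump k A5 b (U1 c s p)).
have h6 := is_derive_lform w (lU2 c s) (is_derive_bump k A6 b (U2 c s p)).
have X10 : X1 w = 0 by rewrite /X1 /w /gyro_field /= /GRing.scale /=; field.
have X20 : X2 w = 0 by rewrite /X2 /w /gyro_field /= /GRing.scale /=; field.
have X30 : X3 w = 0 by [].
have V30 : V3 w = 0 by [].
have U1w : U1 c s w = omega * U2 c s p.
  by rewrite /U1 /U2 /w /gyro_field /= /GRing.scale /=; ring.
have U2w : U2 c s w = - (omega * U1 c s p).
  by rewrite /U1 /U2 /w /gyro_field /= /GRing.scale /=; ring.
rewrite X10 in h1; rewrite X20 in h2; rewrite X30 in h3; rewrite V30 in h4.
rewrite U1w in h5; rewrite U2w in h6.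
apply: (@is_derive_eq _ _ _ _ _ _ _ _ (is_deriveM
  (is_deriveM (is_deriveM (is_deriveM h1 h2) h3) h4) (is_deriveM h5 h6))).
rewrite /dtensor /tensor_guide !fctE /= /GRing.scale /= /X1 /X2 /X3 /V3 /U1 /U2 !mulNr.
ring.
Qed.

Lemma is_derive_rotation q (t : R) :
  is_derive t (1 : R) (fun t : R => tensor (rotv (cos t) (sin t) q))
    (dtensor (rotv (cos t) (sin t) q)).
Proof.
have dU1 : is_derive t (1 : R) (fun t : R => cos t * q.2.1.1 - sin t * q.2.1.2)
    (- (sin t * q.2.1.1 + cos t * q.2.1.2)).
  by apply: is_derive_eq; rewrite /GRing.scale /=; ring.
have dU2 : is_derive t (1 : R) (fun t : R => sin t * q.2.1.1 + cos t * q.2.1.2)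
    (cos t * q.2.1.1 - sin t * q.2.1.2).
  by apply: is_derive_eq; rewrite /GRing.scale /=; ring.
have h5 := @is_derive1_comp _ _ _ t _ _ (is_derive_bump k A5 b _) dU1.
have h6 := @is_derive1_comp _ _ _ t _ _ (is_derive_bump k A6 b _) dU2.
apply: (@is_derive_eq _ _ _ _ _ _ _ _
  (is_deriveM (is_derive_cst (tensor_guide q) t (1 : R)) (is_deriveM h5 h6))).
rewrite /dtensor /tensor_guide /= /GRing.scale /=; ring.
Qed.

Hypothesis k0 : 0 <= k.
Hypothesis b0 : 0 <= b.
Hypothesis ab : forall i, - b <= a i.

Let bump0 i x : ~~ (`|x| <= b) -> bumpf k (a i) b x = 0.
Proof.
move=> xb; apply: bump_eq0 => //; apply: contra xb => /andP[ax xb].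
by rewrite ler_norml (le_trans (ab i) (ltW ax)) ltW.
Qed.

Let dbump0 i x : ~~ (`|x| <= b) -> dbump k (a i) b x = 0.
Proof.
move=> xb; apply: dbump_eq0 => //; apply: contra xb => /andP[ax xb].
by rewrite ler_norml (le_trans (ab i) (ltW ax)) ltW.
Qed.

Lemma tensor_eq0 q : ~~ inbox b q -> tensor q = 0.
Proof.
rewrite /inbox !negb_and /tensor /tensor_guide => /or4P[h|h|h|/or3P[h|h|h]];
  by rewrite (bump0 _ h) ?mulr0 ?mul0r ?mulr0 ?mul0r.
Qed.

Lemma dtensor_eq0 q : ~~ inbox b q -> dtensor q = 0.
Proof.
rewrite /inbox !negb_and /dtensor /tensor_guide => /or4P[h|h|h|/or3P[h|h|h]];
  by rewrite ?(bump0 _ h) ?(dbump0 _ h) ?mulr0 ?mul0r ?subr0 ?mulr0 ?mul0r.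
Qed.

Let B i x : `|bumpf k (a i) b x| <= 1.
Proof. by rewrite ger0_norm ?bump_ge0 ?bump_le1. Qed.

Lemma normr_tensor_guide_le1 q : `|tensor_guide q| <= 1.
Proof.
have P1 (x y : R) : `|x| <= 1 -> `|y| <= 1 -> `|x * y| <= 1.
  by move=> ? ?; rewrite normrM mulr_ile1.
exact: (P1 _ _ (P1 _ _ (P1 _ _ (B _ _) (B _ _)) (B _ _)) (B _ _)).
Qed.

Lemma normr_tensor_le1 q : `|tensor q| <= 1.
Proof.
rewrite /tensor normrM; apply: mulr_ile1 => //; first exact: normr_tensor_guide_le1.
by rewrite normrM; apply: mulr_ile1 => //; exact: B.
Qed.

Lemma normr_dtensor_le q : `|dtensor q| <= 8 * k * b.
Proof.
have [qb|/dtensor_eq0->] := boolP (inbox b q); last by rewrite normr0 !mulr_ge0.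
have D i x : `|dbump k (a i) b x| <= 4 * k by exact: normr_dbump_le.
move: qb; rewrite /inbox => /and5P[_ _ _ v1 /andP[v2 _]].
rewrite /dtensor normrM -[leRHS]mul1r; apply: ler_pM => //; first exact: normr_tensor_guide_le1.
apply: le_trans (ler_normB _ _) _.
have -> : 8 * k * b = 1 * (4 * k * b) + 4 * k * b * 1 by ring.
have PM (x y c d : R) : `|x| <= c -> `|y| <= d -> `|x * y| <= c * d.
  by move=> ? ?; rewrite normrM; apply: ler_pM.
apply: lerD.
  exact: (PM _ _ _ _ (B _ _) (PM _ _ _ _ (D _ _) v1)).
exact: (PM _ _ _ _ (PM _ _ _ _ (D _ _) v2) (B _ _)).
Qed.

Let M := 2 * b + `|omega^-1| * (2 * b).

Lemma inbox_support c s p : c ^+ 2 + s ^+ 2 = 1 ->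
  inbox b (rotv c s (guide p)) -> inbox M p.
Proof.
move=> cs h; rewrite -(guideK p) -(rotvK cs (guide p)); apply: inbox_unguide.
by apply: inbox_rotv => //; rewrite sqrrN.
Qed.

(** The coordinates of the rotated guiding centre variables are linear forms, so
  the function is a product of bumps composed with linear forms. Its support
  lies in a box because a bounded set of guiding centre variables comes from a
  bounded set of phase space. *)
Lemma test_function_tensor c s : c ^+ 2 + s ^+ 2 = 1 ->
  test_function (fun p => tensor (rotv c s (guide p))).
Proof.
move=> cs; split.
  move=> n; rewrite tensorE.
  have c1 := Ck_bump n k A1 b lX1; have c2 := Ck_bump n k A2 b lX2.
  have c3 := Ck_bump n k A3 b lf13; have c4 := Ck_bump n k A4 b lf23.
  have c5 := Ck_bump n k A5 b (lU1 c s); have c6 := Ck_bump n k A6 b (lU2 c s).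
  exact: CkM (CkM (CkM (CkM c1 c2) c3) c4) (CkM c5 c6).
pose I := (`[- M, M]%classic : set R).
pose K := ((I `*` I) `*` I) `*` ((I `*` I) `*` I).
have cK : compact K by repeat apply: compact_setX; exact: segment_compact.
apply: (subclosed_compact _ cK); first exact: closed_closure.
have /closure_id -> : closed K.
  by apply: compact_closed => //; exact: norm_hausdorff.
apply: closureS => p /= tp.
have : inbox b (rotv c s (guide p)).
  by apply: contraNT tp => /tensor_eq0 ->.
move=> /(inbox_support cs); rewrite /inbox !ler_norml.
by move=> /and5P[? ? ? ? /andP[? ?]]; repeat split; rewrite /= ?in_itv.
Qed.

Let mbump i : meas_fun (bumpf k (a i) b).
Proof. apply: continuous_measurable_fun; exact: continuous_bump. Qed.

Let mdbump i : meas_fun (dbump k (a i) b).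
Proof. apply: continuous_measurable_fun; exact: continuous_dbump. Qed.

Lemma measurable_tensor : meas_fun (tensor : mphase R -> R).
Proof.
rewrite /tensor /tensor_guide /A1 /A2 /A3 /A4 /A5 /A6.
have := mbump; move=> mb.
have mb0 := mb (inord 0); have mb1 := mb (inord 1); have mb2 := mb (inord 2).
have mb3 := mb (inord 3); have mb4 := mb (inord 4); have mb5 := mb (inord 5).
meas.
Qed.

Lemma measurable_dtensor : meas_fun (dtensor : mphase R -> R).
Proof.
rewrite /dtensor /tensor_guide /A1 /A2 /A3 /A4 /A5 /A6.
have mb := mbump; have md := mdbump.
have mb0 := mb (inord 0); have mb1 := mb (inord 1); have mb2 := mb (inord 2).
have mb3 := mb (inord 3); have mb4 := mb (inord 4); have mb5 := mb (inord 5).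
have md4 := md (inord 4); have md5 := md (inord 5).
meas.
Qed.

End tensor.

Lemma measurable_guide : meas_fun (guide : mphase R -> mphase R).
Proof. by rewrite /guide; meas. Qed.

Lemma measurable_unguide : meas_fun (unguide : mphase R -> mphase R).
Proof. by rewrite /unguide; meas. Qed.

(** At fixed velocity the guiding centre is a translate of the position. *)
Lemma mpres_guide : mpres (leb6 R) (leb6 R) (guide : mphase R -> mphase R).
Proof.
have h (v : mvec3 R) : mpres (leb3 R) (leb3 R) (fun x : mvec3 R =>
    ((x.1.1 + omega^-1 * v.1.2, x.1.2 - omega^-1 * v.1.1), x.2) : mvec3 R).
  exact: (@mpres_fst _ _ _ _ _ _ _ (leb2 R) lebesgue_measure (leb2 R)
    (fun (y : mR R) (x : mvec2 R) => (x.1 + omega^-1 * v.1.2, x.2 - omega^-1 * v.1.1) : mvec2 R)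
    ltac:(by meas) (fun=> leb2_translate (omega^-1 * v.1.2, - (omega^-1 * v.1.1)))).
exact: (@mpres_fst _ _ _ _ _ _ _ (leb3 R) (leb3 R) (leb3 R)
   (fun (v x : mvec3 R) => ((x.1.1 + omega^-1 * v.1.2, x.1.2 - omega^-1 * v.1.1), x.2) : mvec3 R)
   ltac:(by meas) h).
Qed.

Lemma mpres_unguide : mpres (leb6 R) (leb6 R) (unguide : mphase R -> mphase R).
Proof.
split; first exact: measurable_unguide.
move=> A mA; have [_ <-] := mpres_guide.
  by rewrite -comp_preimage (_ : unguide \o guide = id)//; apply/funext; exact: guideK.
by rewrite -[X in measurable X]setTI; exact: measurable_unguide.
Qed.

Lemma mpres_rotv c s : c ^+ 2 + s ^+ 2 = 1 ->
  mpres (leb6 R) (leb6 R) (rotv c s : mphase R -> mphase R).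
Proof.
move=> cs.
exact: (@mpres_snd _ _ _ _ _ _ _ (leb3 R) (leb3 R) (leb3 R)
   (fun (x v : mvec3 R) => (rot2 c s v.1, v.2) : mvec3 R)
   ltac:(by rewrite /rot2; meas) (fun=> leb3_rot cs)).
Qed.

End gyro_coordinates.

(** * Local integrability *)

Section local_integrability.
Context {R : realType}.
Local Open Scope ereal_scope.

Definition locint (f : phase R -> R) : Prop :=
  meas_fun (f : mphase R -> R) /\
  forall N : R, \int[leb6 R]_p (if inbox N p then `|f p| else 0%R)%:E < +oo.

Lemma meas_norm d (T : measurableType d) (f : T -> R) :
  meas_fun f -> meas_fun (fun x => `|f x|%R).
Proof. by move=> mf; apply: meas_cont => //; exact: norm_continuous. Qed.

Lemma measurable_inbox N : meas_fun (fun p : mphase R => inbox N p).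
Proof.
rewrite /inbox; repeat (apply: measurable_and; [|]); apply: meas_ler;
  try exact: measurable_cstT; apply: meas_norm; by meas.
Qed.

Lemma leb6_inbox N : leb6 R [set p | inbox N p] < +oo.
Proof.
pose I := (`[(- N)%R, N]%classic : set (mR R)).
have mI : measurable I by exact: measurable_itv.
have I1 : lebesgue_measure I < +oo.
  by rewrite lebesgue_measure_itv/=; case: ifP => // _; rewrite -EFinB ltry.
have X d1 d2 (T1 : measurableType d1) (T2 : measurableType d2)
    (m1 : {sigma_finite_measure set T1 -> \bar R})
    (m2 : {sigma_finite_measure set T2 -> \bar R}) (A : set T1) (B : set T2) :
    measurable A -> measurable B -> m1 A < +oo -> m2 B < +oo -> sfprod m1 m2 (A `*` B) < +oo.
  move=> mA mB A1 B1; rewrite /sfprod product_measure1E//.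
  by rewrite lte_mul_pinfty// ge0_fin_numE.
have m2I : measurable (I `*` I : set (mvec2 R)) by exact: measurableX.
have m3I : measurable ((I `*` I) `*` I : set (mvec3 R)) by exact: measurableX.
have I2 : leb2 R (I `*` I) < +oo by exact: X.
have I3 : leb3 R ((I `*` I) `*` I) < +oo by exact: X.
have := X _ _ _ _ (leb3 R) (leb3 R) _ _ m3I m3I I3 I3.
rewrite (_ : _ `*` _ = [set p | inbox N p])//.
apply/seteqP; split => -[[[x1 x2] x3] [[v1 v2] v3]]; rewrite /inbox /I /= !in_itv /= -!ler_norml.
  by move=> [[[-> ->] ->] [[-> ->] ->]].
by move=> /and5P[-> -> -> -> /andP[-> ->]].
Qed.

Lemma locint_dominated (f g : phase R -> R) : locint f ->
  meas_fun (g : mphase R -> R) ->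
  (exists B, exists2 N : R, (0 <= B)%R & forall p, (`|g p| <= if inbox N p then B * `|f p| else 0)%R) ->
  (leb6 R).-integrable setT (fun p => (g p)%:E).
Proof.
move=> [mf foo] mg [B [N B0 gf]]; apply/integrableP; split; first by meas.
have mi := measurable_inbox N.
have mbox : meas_fun (fun p : mphase R => (if inbox N p then `|f p| else 0)%R%:E).
  by apply: measE; apply: meas_if => //; exact: meas_norm.
apply: (@le_lt_trans _ _ (\int[leb6 R]_p (B%:E * (if inbox N p then `|f p| else 0)%R%:E))).
  apply: ge0_le_integral => //.
  - by apply: measurableT_comp => //; meas.
  - by apply: emeasurable_funM => //; exact: measurable_cst.
  - move=> p _; rewrite abse_EFin -EFinM lee_fin (le_trans (gf p))//.
    by case: ifP => _; rewrite ?mulr0.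
rewrite ge0_integralZl//.
- by rewrite lte_mul_pinfty// lee_fin.
- by move=> p _; rewrite lee_fin; case: ifP.
Qed.

Lemma locint_comp (f : phase R -> R) (T : phase R -> phase R) : locint f ->
  mpres (leb6 R) (leb6 R) (T : mphase R -> mphase R) ->
  (forall N : R, exists N' : R, forall p, inbox N p -> inbox N' (T p)) ->
  locint (f \o T).
Proof.
move=> [mf foo] mT TN; split; first by apply: measurableT_comp mf _; case: mT.
move=> N; have [N' NN'] := TN N.
apply: le_lt_trans (foo N').
have mb : meas_fun (fun p : mphase R => (if inbox N' p then `|f p| else 0)%R%:E).
  apply: measE; apply: meas_if => //; [exact: measurable_inbox|exact: meas_norm].
rewrite -(mpres_ge0_integral mT mb); last by move=> p; rewrite lee_fin; case: ifP.
apply: ge0_le_integral => //.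
- by move=> p _; rewrite lee_fin; case: ifP.
- apply: measE; apply: meas_if => //; first exact: measurable_inbox.
  by apply: meas_norm; apply: measurableT_comp mf _; case: mT.
- by apply: measurableT_comp mb _; case: mT.
- move=> p _; rewrite lee_fin; case: ifP => [/NN' ->//|_].
  by case: ifP.
Qed.

Lemma maxwellian_gt0 (m theta : R) (v : vec3 R) : (0 < m -> 0 < theta -> 0 < maxwellian m theta v)%R.
Proof.
move=> m0 t0; rewrite /maxwellian mulr_gt0 ?expR_gt0// powR_gt0//.
by rewrite divr_gt0// !mulr_gt0// pi_gt0.
Qed.

Lemma maxwellian_le (m theta : R) (v : vec3 R) : (0 < m -> 0 < theta ->
  maxwellian m theta v <= (2 * pi * theta / m) `^ (- (3 / 2)))%R.
Proof.
move=> m0 t0; rewrite /maxwellian ler_piMr ?powR_ge0//.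
rewrite -expR0 ler_expR mulNr oppr_le0.
by rewrite divr_ge0 ?mulr_ge0 ?(ltW m0) ?(ltW t0)// !addr_ge0 ?sqr_ge0.
Qed.

Lemma measurable_maxwellian (m theta : R) :
  meas_fun (maxwellian m theta : mvec3 R -> R).
Proof. by rewrite /maxwellian; meas. Qed.

(** On a box the Maxwellian is bounded and [|f| <= f ^ 2 / M + M]. *)
Lemma L2_phase_locint (m theta : R) (f : phase R -> R) : (0 < m)%R -> (0 < theta)%R ->
  L2_phase m theta f -> locint f.
Proof.
move=> m0 t0 [mf foo]; split => // N.
set C0 := ((2 * pi * theta / m) `^ (- (3 / 2)))%R.
have C00 : (0 <= C0)%R by rewrite powR_ge0.
have mi := measurable_inbox N.
have mM : meas_fun (fun p : mphase R => maxwellian m theta p.2).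
  by apply: (measurableT_comp (measurable_maxwellian m theta)); meas.
have m1 : meas_fun (fun p : mphase R => (f p ^+ 2 / maxwellian m theta p.2)%:E).
  by meas.
have m2 : meas_fun (fun p : mphase R => (if inbox N p then C0 else 0%R)%:E).
  by apply: measE; apply: meas_if => //; exact: measurable_cstT.
have p1 p : 0 <= (f p ^+ 2 / maxwellian m theta p.2)%:E.
  by rewrite lee_fin divr_ge0 ?sqr_ge0// ltW// maxwellian_gt0.
have p2 (p : mphase R) : 0 <= (if inbox N p then C0 else 0%R)%:E.
  by rewrite lee_fin; case: ifP.
apply: (@le_lt_trans _ _ (\int[leb6 R]_p ((f p ^+ 2 / maxwellian m theta p.2)%:E +
    (if inbox N p then C0 else 0%R)%:E))).
  apply: ge0_le_integral => //.
  - by move=> p _; rewrite lee_fin; case: ifP.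
  - apply: measE; apply: meas_if => //; exact: meas_norm.
  - exact: emeasurable_funD.
  - move=> p _; case: ifP => // _; last by rewrite adde0.
    rewrite -EFinD lee_fin.
    have M0 := maxwellian_gt0 p.2 m0 t0.
    apply: (@le_trans _ _ (f p ^+ 2 / maxwellian m theta p.2 + maxwellian m theta p.2)%R); last first.
      by rewrite lerD2l maxwellian_le.
    set M := maxwellian _ _ _ in M0 *.
    rewrite -(ler_pM2r M0) mulrDl divfK ?gt_eqF//.
    have := sqr_ge0 (`|f p| - M)%R; have := sqr_ge0 M; rewrite -(real_normK (num_real (f p))); nra.
rewrite ge0_integralD// lte_add_pinfty//.
rewrite (_ : \int[leb6 R]_p _ = C0%:E * leb6 R [set p | inbox N p]).
  by rewrite lte_mul_pinfty ?lee_fin// leb6_inbox.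
have mb : measurable [set p : mphase R | inbox N p].
  by rewrite -[X in measurable X]setTI; exact: mi.
rewrite -(integral_cst (leb6 R) mb).
by rewrite (integral_if _ _ (erefl _)); apply: eq_integral => p _; case: ifP.
Qed.

End local_integrability.

(** * Weak invariance of the kernel under rotation of the velocity *)

Lemma integral_segment_if (R : realType) (u v : R) (f : R -> \bar R) :
  (\int[lebesgue_measure]_(x in `[u, v]) f x =
   \int[lebesgue_measure]_x (if (u <= x <= v)%R then f x else 0))%E.
Proof. by apply: integral_if; exact: set_itvcc. Qed.

Lemma continuous_dtensor_rotation {R : realType} (k b : R) (a : 'I_6 -> R) (q : phase R) :
  continuous (fun t : R => dtensor k b a (rotv (cos t) (sin t) q)).
Proof.
have cu1 : continuous (fun t : R => cos t * q.2.1.1 - sin t * q.2.1.2).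
  move=> t; apply: cvgB; apply: cvgMl; [exact: continuous_cos|exact: continuous_sin].
have cu2 : continuous (fun t : R => sin t * q.2.1.1 + cos t * q.2.1.2).
  move=> t; apply: cvgD; apply: cvgMl; [exact: continuous_sin|exact: continuous_cos].
have cc (h u : R -> R) : continuous h -> continuous u -> continuous (fun t => h (u t)).
  by move=> ch cu t; apply: (@continuous_comp _ _ _ u h); [exact: cu|exact: ch].
have cM (h u : R -> R) : continuous h -> continuous u -> continuous (fun t => h t * u t).
  by move=> ch cu t; apply: cvgM; [exact: ch|exact: cu].
rewrite /dtensor /rotv /rot2 /=; refine (cM (fun=> _) _ _ _); first by move=> t; exact: cst_continuous.
have cb i := @continuous_bump R k (a i) b.
have cd i := @continuous_dbump R k (a i) b.
move=> t; apply: cvgB.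
  exact: (cM _ _ (cc _ _ (cb _) cu1) (cM _ _ (cc _ _ (cd _) cu2) cu1)).
exact: (cM _ _ (cM _ _ (cc _ _ (cd _) cu1) cu2) (cc _ _ (cb _) cu2)).
Qed.

Section weak_invariance.
Context {R : realType}.
Variables (m theta omega : R).
Hypotheses (m0 : 0 < m) (theta0 : 0 < theta) (omega0 : omega != 0).
Variable f : phase R -> R.
Hypothesis kerf : ker_transport m theta omega f.
Variables (k b : R) (a : 'I_6 -> R).
Hypotheses (k0 : 0 <= k) (b0 : 0 <= b) (ab : forall i, - b <= a i).
Local Notation leb := (@lebesgue_measure R).
Local Notation H t p := (tensor k b a (rotv (cos t) (sin t) (guide omega p))).
Local Notation dH t p := (dtensor k b a (rotv (cos t) (sin t) (guide omega p))).
Local Notation N := (2 * b + `|omega^-1| * (2 * b)).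

Let lf : locint f. Proof. by case: kerf => /(L2_phase_locint m0 theta0). Qed.

Let mf : meas_fun (f : mphase R -> R). Proof. by case: lf. Qed.

Let cs t : cos t ^+ 2 + sin t ^+ 2 = 1 :> R. Proof. exact: cos2Dsin2. Qed.

Let mrot : meas_fun (fun z : mphase R * mR R =>
  rotv (cos z.2) (sin z.2) (guide omega z.1) : mphase R).
Proof. by rewrite /rotv /rot2 /guide; meas. Qed.

Let mrot1 t : meas_fun (fun p : mphase R =>
  rotv (cos t) (sin t) (guide omega p) : mphase R).
Proof. by rewrite /rotv /rot2 /guide; meas. Qed.

Let mH t : meas_fun (fun p : mphase R => H t p).
Proof. by apply: measurableT_comp (measurable_tensor k b a) _; exact: mrot1. Qed.

Let mdH t : meas_fun (fun p : mphase R => dH t p).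
Proof. by apply: measurableT_comp (measurable_dtensor k b a) _; exact: mrot1. Qed.

Let H0 t p : ~~ inbox N p -> H t p = 0.
Proof. by move=> pN; apply: tensor_eq0 => //; apply: contra pN; exact: inbox_support. Qed.

Let dH0 t p : ~~ inbox N p -> dH t p = 0.
Proof. by move=> pN; apply: dtensor_eq0 => //; apply: contra pN; exact: inbox_support. Qed.

Let ifH t : (leb6 R).-integrable setT (fun p => (f p * H t p)%:E).
Proof.
apply: (locint_dominated lf); first by apply: measM => //; exact: mH.
exists 1, N => // p; have [pN|/H0->] := boolP (inbox N p); last by rewrite mulr0 normr0.
by rewrite normrM mulrC ler_wpM2r// normr_tensor_le1.
Qed.

Let ifdH t : (leb6 R).-integrable setT (fun p => (f p * dH t p)%:E).
Proof.
apply: (locint_dominated lf); first by apply: measM => //; exact: mdH.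
exists (8 * k * b), N; first by rewrite !mulr_ge0.
move=> p; have [pN|/dH0->] := boolP (inbox N p); last by rewrite mulr0 normr0.
by rewrite normrM mulrC ler_wpM2r// normr_dtensor_le.
Qed.

Local Open Scope ereal_scope.

(** This is the weak form of the kernel equation, tested against
  [tensor k b a] precomposed with the rotation. *)
Lemma integral_dtensor_eq0 t : \int[leb6 R]_p (f p * dH t p)%:E = 0.
Proof.
have [_ _ /(_ _ (test_function_tensor omega k0 ab (cs t)))] := kerf.
rewrite (_ : Rintegral _ _ (fun p => cst 0%R p * _)%R = 0%R); last first.
  by rewrite /Rintegral (eq_integral (cst 0)) ?integral0// => p _; rewrite mul0r.
rewrite oppr0 /Rintegral.
have -> : \int[leb6 R]_p (f p * 'D_(gyro_field omega p) (fun p => H t p) p)%:E =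
    (- omega)%:E * \int[leb6 R]_p (f p * dH t p)%:E.
  rewrite -integralZl//.
  apply: eq_integral => p _.
  have [_ ->] := is_derive_gyro omega0 k b a (cos t) (sin t) p.
  by rewrite -EFinM; congr (_%:E); ring.
have fin := integrable_fin_num measurableT (ifdH t).
rewrite -(fineK fin) -EFinM /= => /eqP; rewrite mulf_eq0 oppr_eq0 (negbTE omega0) /=.
by move=> /eqP ->.
Qed.

(** The derivative in [t] of the left side vanishes by [integral_dtensor_eq0]. Rather
  than differentiating under the integral sign, write [H t p - H 0 p] as the integral
  of its derivative and exchange the integrals by Fubini's theorem. *)
Lemma integral_tensor_cst t : (0 <= t)%R ->
  \int[leb6 R]_p (f p * H t p)%:E = \int[leb6 R]_p (f p * H 0 p)%:E.
Proof.
move=> t0.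
pose q (z : mphase R * mR R) : \bar R :=
  (if (0 <= z.2 <= t)%R then f z.1 * dH z.2 z.1 else 0)%R%:E.
have mfdH : meas_fun (fun z : mphase R * mR R => f z.1 * dH z.2 z.1)%R.
  apply: measM; first by apply: (measurableT_comp mf); meas.
  exact: (measurableT_comp (measurable_dtensor k b a) mrot).
have mq : meas_fun q.
  rewrite /q; apply: measE; apply: meas_if => //.
  by apply: measurable_and; apply: meas_ler; meas.
pose g p := (if inbox N p then `|f p| else 0)%R.
have g0 p : (0 <= g p)%R by rewrite /g; case: ifP.
have mg : meas_fun (fun p : mphase R => (g p)%:E).
  by apply: measE; apply: meas_if => //; [exact: measurable_inbox|exact: meas_norm].
have kb0 : (0 <= 8 * k * b)%R by rewrite !mulr_ge0.
have qle z : `|q z| <= (8 * k * b * g z.1)%:E * (\1_(`[0%R, t]%classic) z.2)%R%:E.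
  rewrite /q indicE mem_setE in_itv /=; case: ifP => _; last first.
    by rewrite normr0 mule0.
  rewrite mule1 lee_fin /g; have [pN|/dH0->] := boolP (inbox N z.1); last by rewrite !mulr0 normr0.
  by rewrite normrM mulrC ler_wpM2r// normr_dtensor_le.
have iq : (sfprod (leb6 R) leb).-integrable setT q.
  have m8 : meas_fun (fun p : mphase R => (8 * k * b * g p)%:E).
    by apply: measE; apply: measM; [exact: measurable_cstT|exact/measurable_EFinP].
  have m1 : meas_fun (fun s : mR R => (\1_(`[0%R, t]%classic) s)%:E : \bar R).
    by apply/measurable_EFinP; exact: measurable_indic.
  have g8 p : 0 <= (8 * k * b * g p)%:E by rewrite lee_fin mulr_ge0.
  have i1 (s : R) : 0 <= (\1_(`[0%R, t]%classic) s)%:E :> \bar R by rewrite lee_fin.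
  apply/integrableP; split => //.
  apply: (@le_lt_trans _ _ (\int[sfprod (leb6 R) leb]_z
      ((8 * k * b * g z.1)%:E * (\1_(`[0%R, t]%classic) z.2)%:E))).
    apply: ge0_le_integral => //; first exact: measurableT_comp.
    by apply: measMe; [exact: (measurableT_comp m8 measurable_fst)|
      exact: (measurableT_comp m1 measurable_snd)].
  rewrite (ge0_integral_tensor _ _ m8 m1 g8 i1) muleC; apply: lte_mul_pinfty.
  - exact: integral_ge0.
  - rewrite integral_indic// setIT /= lebesgue_measure_itv /=.
    by case: ifP => // _; rewrite -EFinB.
  - under eq_integral do rewrite EFinM.
    rewrite ge0_integralZl//; last by move=> p _; rewrite lee_fin.
    by rewrite lte_mul_pinfty// ?lee_fin//; case: lf => _; exact.
have q1 p : \int[leb]_s q (p, s) = (f p * (H t p - H 0 p))%:E.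
  transitivity (\int[leb]_(s in `[0%R, t]) (f p * dH s p)%:E).
    rewrite integral_segment_if; apply: eq_integral => s _.
    by rewrite /q /=; case: ifP.
  rewrite mulrBr; apply: (@FTC2_everywhere _ (fun s => f p * H s p)%R (fun s => f p * dH s p)%R 0%R t) => //.
    move=> s; apply: (@is_derive_eq _ _ _ _ _ _ _ _
      (is_deriveZ (f p) (is_derive_rotation k b a (guide omega p) s))) => //.
  by move=> s; apply: cvgMr; exact: continuous_dtensor_rotation.
have q2 s : \int[leb6 R]_p q (p, s) = 0.
  have [st|st] := boolP (0 <= s <= t)%R.
    rewrite -[RHS](integral_dtensor_eq0 s).
    by apply: eq_integral => p _; rewrite /q /= st.
  by apply: integral0_eq => p _; rewrite /q /= (negbTE st).
have sub_eq (x y : \bar R) : x \is a fin_num -> y \is a fin_num -> x - y = 0 -> x = y.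
  by move: x y => [x| |] [y| |]// _ _ [] /eqP; rewrite subr_eq0 => /eqP ->.
have := integral12_prod_meas1 iq; rewrite -(integral21_prod_meas1 iq) /fubini_F /fubini_G.
under eq_integral do rewrite q1.
under [RHS]eq_integral do rewrite q2.
rewrite integral0.
under eq_integral do rewrite mulrBr EFinB.
rewrite (integralB measurableT (ifH t) (ifH 0%R)).
have fin1 := integrable_fin_num measurableT (ifH t).
have fin2 := integrable_fin_num measurableT (ifH 0).
exact: (sub_eq _ _ fin1 fin2).
Qed.

End weak_invariance.

(** * The fundamental lemma for product test functions *)

Section vanishing_integrals.
Local Open Scope ereal_scope.
Context d (T : measurableType d) (R : realType) (mu : {measure set T -> \bar R}).
Variable g : T -> \bar R.
Hypothesis ig : mu.-integrable setT g.

Definition null_integral (B : set T) : Prop := \int[mu]_(x in B) g x = 0.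

(** The sets over which [g] has integral zero form a Dynkin class as soon as the
  whole space is one of them. *)
Lemma null_integral_dynkin (G : set (set T)) : G `<=` measurable -> setI_closed G ->
  null_integral setT -> (forall A, G A -> null_integral A) ->
  forall A, <<s G >> A -> null_integral A.
Proof.
move=> Gm GI nT nG.
have GE : @measurable _ (g_sigma_algebraType G) = <<s G >> by [].
have sm : <<s G >> `<=` @measurable _ T := smallest_sub (@sigma_algebra_measurable _ T) Gm.
apply: (dynkin_induction GE GI) => //.
- move=> S /sm mS S0.
  have : \int[mu]_x g x = \int[mu]_(x in S) g x + \int[mu]_(x in ~` S) g x.
    rewrite -integral_setU ?setUv//.
    - exact: measurableC.
    - exact: (measurable_int _ ig).
    - by apply/disj_setPRL => x Sx; exact.
  by rewrite (_ : \int[mu]_x g x = 0)// S0 add0e => /esym.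
- move=> F mF tF F0.
  rewrite /null_integral integral_bigcup//.
  + by apply: eseries0 => n _ _; exact: F0.
  + by move=> n; exact: (sm _ (mF n)).
  + by apply: integrableS ig => //; apply: bigcup_measurable => n _; exact: (sm _ (mF n)).
Qed.

End vanishing_integrals.

Section du_bois_reymond.
Context {R : realType}.

Definition coord (i : 'I_6) (q : phase R) : R :=
  [:: q.1.1.1; q.1.1.2; q.1.2; q.2.2; q.2.1.1; q.2.1.2]`_i.

Lemma coordE (q : phase R) : [/\ coord (inord 0) q = q.1.1.1, coord (inord 1) q = q.1.1.2,
  coord (inord 2) q = q.1.2, coord (inord 3) q = q.2.2 &
  coord (inord 4) q = q.2.1.1 /\ coord (inord 5) q = q.2.1.2].
Proof. by rewrite /coord !inordK. Qed.

Let ord6 (P : 'I_6 -> Prop) : P (inord 0) -> P (inord 1) -> P (inord 2) ->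
  P (inord 3) -> P (inord 4) -> P (inord 5) -> forall i, P i.
Proof.
move=> P0 P1 P2 P3 P4 P5 i; rewrite -(inord_val i).
by case: i => [[|[|[|[|[|[|//]]]]]] Hi].
Qed.

Let tensor0 k b a (q : phase R) i : 0 <= k -> ~~ (a i < coord i q < b) -> tensor k b a q = 0.
Proof.
move=> k0; have [e0 e1 e2 e3 [e4 e5]] := coordE q.
rewrite /tensor /tensor_guide.
by move: i; apply: ord6; rewrite ?e0 ?e1 ?e2 ?e3 ?e4 ?e5 => h;
  rewrite (bump_eq0 k0 h) ?mulr0 ?mul0r ?mulr0 ?mul0r.
Qed.

Lemma cvg_bump (a b x : R) : a < x < b -> bumpf n.+1%:R a b x @[n --> \oo] --> (1 : R).
Proof.
move=> /andP[ax xb].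
have fl (y : R) : 0 < y -> flat 0 (n.+1%:R * y) @[n --> \oo] --> (1 : R).
  move=> y0; rewrite -[X in _ --> X](@expR0 R) -[X in expR X]oppr0.
  rewrite (_ : (fun n : nat => flat 0 (n.+1%:R * y)) = (fun n : nat => expR (- (n.+1%:R^-1 * y^-1)))).
    apply: (@continuous_cvg _ _ _ _ _ _ (expR : R -> R)); first exact: continuous_expR.
    apply: cvgN; rewrite -[X in _ --> X](mul0r y^-1); apply: cvgMl.
    exact: cvg_harmonic.
  by apply/funext => n; rewrite /flat mulr_gt0// expr0 mul1r invfM.
rewrite -[X in _ --> X]mulr1.
by apply: cvgM; apply: fl; rewrite subr_gt0.
Qed.

(** The support condition is strict, so the limit is the indicator function of the
  open box. *)
Lemma cvg_tensor (b : R) a (q : phase R) :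
  tensor n.+1%:R b a q @[n --> \oo] --> (if [forall i, a i < coord i q < b] then 1 else 0 : R).
Proof.
case: ifPn => [/forallP h|]; last first.
  rewrite negb_forall => /existsP[i hi].
  rewrite (_ : (fun n : nat => tensor n.+1%:R b a q) = cst 0); first exact: cvg_cst.
  by apply/funext => n; rewrite (@tensor0 _ _ _ _ i).
have [e0 e1 e2 e3 [e4 e5]] := coordE q.
rewrite /tensor /tensor_guide -e0 -e1 -e2 -e3 -e4 -e5.
rewrite [X in _ --> X](_ : 1 = 1 * 1 * 1 * 1 * (1 * 1)); last by rewrite !mulr1.
apply: cvgM; apply: cvgM; last exact: cvg_bump.
- apply: cvgM; last exact: cvg_bump.
  by apply: cvgM; exact: cvg_bump.
- exact: cvg_bump.
- exact: cvg_bump.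
Qed.

Variable g : phase R -> R.
Hypothesis lg : locint g.
Hypothesis g0 : forall (k b : R) (a : 'I_6 -> R), 0 <= k -> 0 <= b -> (forall i, - b <= a i) ->
  (\int[leb6 R]_q (g q * tensor k b a q)%:E = 0)%E.

Let mg : meas_fun (g : mphase R -> R). Proof. by case: lg. Qed.

Lemma measurable_coord i : meas_fun (coord i : mphase R -> R).
Proof.
rewrite /coord; move: i => [[|[|[|[|[|[|//]]]]]] Hi] /=; meas.
Qed.

Let inside (a : 'I_6 -> R) (b : R) (q : phase R) : bool := [forall i, a i < coord i q < b].

Let minside a b : meas_fun (inside a b : mphase R -> bool).
Proof.
rewrite (_ : inside a b = fun q => all (fun i => a i < coord i q < b) (enum 'I_6)); last first.
  apply/funext => q; apply/forallP/allP => h i; first by move=> _; exact: h.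
  by apply: h; rewrite mem_enum.
elim: (enum 'I_6) => [|i s IH] /=; first exact: measurable_cstT.
apply: measurable_and => //; apply: measurable_and; apply: meas_ltr => //; exact: measurable_coord.
Qed.

Local Open Scope ereal_scope.

Let inside_inbox a b q : (forall i, - b <= a i)%R -> inside a b q -> inbox b q.
Proof.
move=> ab /forallP h.
have {}h i : (`|coord i q| <= b)%R.
  have /andP[h1 h2] := h i.
  by rewrite ler_norml (le_trans (ab i) (ltW h1)) ltW.
have [e0 e1 e2 e3 [e4 e5]] := coordE q.
by rewrite /inbox -e0 -e1 -e2 -e3 -e4 -e5 !h.
Qed.

Let integral_inside a b : (0 <= b)%R -> (forall i, - b <= a i)%R ->
  \int[leb6 R]_q (if inside a b q then g q else 0%R)%:E = 0.
Proof.
move=> b0 ab.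
pose f_ (n : nat) (q : mphase R) := (g q * tensor n.+1%:R b a q)%:E.
pose G (q : mphase R) := (if inbox b q then `|g q| else 0)%R%:E.
have [] := @dominated_convergence _ _ R (leb6 R) setT measurableT f_
    (fun q => (if inside a b q then g q else 0%R)%:E) G.
- by move=> n; rewrite /f_; apply: measE; apply: measM => //; exact: measurable_tensor.
- by apply: measE; apply: meas_if => //; exact: minside.
- apply: aeW => q _; rewrite /f_.
  rewrite (_ : (if inside a b q then g q else 0%R) = g q * (if inside a b q then 1 else 0))%R; last first.
    by case: ifP => _; rewrite ?mulr1 ?mulr0.
  apply: cvg_EFin; first by near=> n.
  by apply: cvgMr; exact: cvg_tensor.
- apply: (locint_dominated lg).
    by apply: meas_if => //; [exact: measurable_inbox|exact: meas_norm].
  exists 1%R, b => // q; case: ifP => _; last by rewrite normr0.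
  by rewrite mul1r normr_id.
- apply: aeW => q n _; rewrite /f_ /G abse_EFin lee_fin.
  have [qb|/tensor_eq0 ->//] := boolP (inbox b q).
    by rewrite normrM ler_piMr// normr_tensor_le1.
  by rewrite mulr0 normr0.
move=> _ _ /=.
rewrite (_ : (fun n => \int[leb6 R]_x f_ n x) = cst 0); last first.
  by apply/funext => n; exact: g0.
by move=> /(cvg_unique _ (cvg_cst _)) => <-.
Unshelve. all: by end_near. Qed.

(* The restriction of [g] to an open box. The intersection of that box with a
   product of rays is again an open box, over which [g] has integral zero. *)
Let gN (N : R) (q : mphase R) : \bar R := (if inside (fun=> - N)%R N q then g q else 0%R)%:E.

Let igN N : (0 <= N)%R -> (leb6 R).-integrable setT (gN N).
Proof.
move=> N0; apply: (locint_dominated lg).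
  by apply: meas_if => //; exact: minside.
exists 1%R, N => // q; rewrite mul1r; case: ifPn => [/inside_inbox ->//|_].
by rewrite normr0; case: ifP.
Qed.

Let cyl (A : 'I_6 -> set R) : set (mphase R) := [set q | forall i, A i (coord i q)].

Let mcyl A : (forall i, measurable (A i)) -> measurable (cyl A).
Proof.
move=> mA; rewrite (_ : cyl A = \bigcap_(i in [set: 'I_6]) (coord i @^-1` A i)); last first.
  by apply/seteqP; split => q /= h i; [move=> _|]; exact: h.
apply: fin_bigcap_measurable => // i _.
by rewrite -[X in measurable X]setTI; exact: measurable_coord.
Qed.

Let isray (A : set R) := A = setT \/ exists a, A = `]a, +oo[%classic.

Let misray A : isray A -> measurable A.
Proof. by move=> [->|[a ->]]. Qed.

Let null_rays N A : (0 <= N)%R -> (forall i, isray (A i)) ->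
  null_integral (leb6 R) (gN N) (cyl A).
Proof.
move=> N0 rA.
have /choice[a aP] : forall i, exists a : R, (- N <= a)%R /\
    forall x, (- N < x)%R -> (A i x <-> (a < x)%R).
  move=> i; have [->|[a ->]] := rA i; first by exists (- N)%R; split.
  exists (Num.max a (- N)%R); split; first by rewrite le_max lexx orbT.
  by move=> x Nx; rewrite /= in_itv /= andbT gt_max Nx andbT.
rewrite /null_integral -[RHS](integral_inside (a := a) N0); last by move=> i; case: (aP i).
rewrite integral_mkcond; apply: eq_integral => q _; rewrite patchE /gN.
have [iq|iq] := boolP (inside (fun=> - N)%R N q).
  suff -> : q \in cyl A = inside a N q by case: ifP.
  apply/idP/forallP => [|h].
    rewrite inE => h i; move/forallP: iq => /(_ i) /andP[Nq ->].
    by rewrite andbT; apply/(aP i).2.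
  rewrite inE => i; move/forallP: iq => /(_ i) /andP[Nq _].
  by apply/(aP i).2 => //; case/andP: (h i).
rewrite if_same ifF//; apply/negbTE; apply: contra iq => /forallP h.
apply/forallP => i; case/andP: (h i) => h1 ->; rewrite andbT.
by apply: le_lt_trans h1; case: (aP i).
Qed.

Let rays : set (set (mphase R)) := [set cyl A | A in [set A | forall i, isray (A i)]].

(* The coordinates are measurable for the sigma-algebra generated by the
   products of rays, hence so is the identity. *)
Let measurable_rays (E : set (mphase R)) : measurable E -> <<s rays >> E.
Proof.
move=> mE.
have mc i : meas_fun (coord i : g_sigma_algebraType rays -> R).
  apply: (measurability _ (RGenOInfty.measurableE R)) => _ [_ [a ->] <-].
  rewrite setTI; apply: sub_sigma_algebra.
  exists (fun j => if j == i then `]a, +oo[%classic else setT).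
    by move=> j; case: ifP => _; [right; exists a|left].
  apply/seteqP; split => q /=; first by move=> /(_ i); rewrite eqxx.
  by move=> qi j; case: eqP => [->|].
have mid : meas_fun (id : g_sigma_algebraType rays -> mphase R).
  rewrite (_ : id = (fun q => (((coord (inord 0) q, coord (inord 1) q), coord (inord 2) q),
    ((coord (inord 4) q, coord (inord 5) q), coord (inord 3) q)))).
    by repeat apply/measurable_fun_pair; exact: mc.
  apply/funext => q; have [-> -> -> -> [-> ->]] := coordE q.
  by case: q => [[[? ?] ?] [[? ?] ?]].
by have := mid measurableT E mE; rewrite setTI.
Qed.

Let null_all N E : (0 <= N)%R -> measurable E -> null_integral (leb6 R) (gN N) E.
Proof.
move=> N0 mE; apply: (null_integral_dynkin (igN N0) (G := rays)) (measurable_rays mE).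
- by move=> _ [A rA <-]; apply: mcyl => i; exact: misray.
- move=> _ _ [A rA <-] [B rB <-]; exists (fun i => A i `&` B i).
    move=> i; have [->|[a ->]] := rA i; first by rewrite setTI; exact: rB.
    have [->|[b ->]] := rB i; first by rewrite setIT; right; exists a.
    right; exists (Num.max a b).
    by apply/seteqP; split => x; rewrite /= !in_itv /= !andbT gt_max => /andP.
  apply/seteqP; split => q /=; first by move=> h; split => i; case: (h i).
  by move=> [h1 h2] i; split.
- rewrite (_ : setT = cyl (fun=> setT)); last by apply/seteqP.
  by apply: null_rays => // i; left.
- by move=> _ [A rA <-]; exact: null_rays.
Qed.

(** Letting the bumps increase to indicator functions, [g] has integral zero over
  all open boxes, and therefore, boxes being stable under intersection, over
  all measurable subsets of a box. *)
Lemma du_bois_reymond : {ae leb6 R, forall q, g q = 0%R}.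
Proof.
have aeN (n : nat) : {ae leb6 R, forall q : mphase R, gN n%:R q = 0}.
  have := @integral_ae_eq _ _ _ (leb6 R) setT measurableT (cst 0) (gN n%:R).
  move=> /(_ (igN (ler0n _ n)) (measurable_cst _)) h.
  have : ae_eq (leb6 R) setT (gN n%:R) (cst 0).
    by apply: h => E _ mE; rewrite integral0; exact: null_all.
  by apply: filterS => q /(_ Logic.I).
have := ae_foralln aeN; apply: filterS => q hq.
pose M := (\sum_i `|coord i q|)%R.
pose n := Num.bound M.
have nM : (M < n%:R)%R.
  by apply: archi_boundP; apply: sumr_ge0.
have := hq n; rewrite /gN ifT; first by move=> [].
apply/forallP => i; rewrite -ltr_norml; apply: le_lt_trans nM.
by rewrite /M (bigD1 i)//= lerDl sumr_ge0.
Qed.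

End du_bois_reymond.

(** * Functions of the kernel are their own gyroaverages *)

Section ae_swap.
Local Open Scope ereal_scope.
Context d1 d2 (T1 : measurableType d1) (T2 : measurableType d2) (R : realType).
Variables (m1 : {sigma_finite_measure set T1 -> \bar R}).
Variables (m2 : {sigma_finite_measure set T2 -> \bar R}).

(** Almost everywhere statements become vanishing integrals, to which Tonelli's
  theorem applies. *)
Lemma ae_integral0P d (T : measurableType d) (mu : {measure set T -> \bar R}) (P : T -> bool) :
  meas_fun P ->
  \int[mu]_x (if P x then 0 else 1) = 0 <-> {ae mu, forall x, P x}.
Proof.
move=> mP; have mi : meas_fun (fun x => (if P x then 0 else 1) : \bar R).
  exact: meas_if.
have := @ae_eq_integral_abs _ _ _ mu setT measurableT _ mi.
have -> : \int[mu]_x `|if P x then 0 else 1| = \int[mu]_x (if P x then 0 else 1).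
  by apply: eq_integral => x _; case: ifP => _; rewrite gee0_abs.
move=> ->; split; apply: filterS => x /=; first by move=> /(_ Logic.I); case: (P x) => // /eqP; rewrite onee_eq0.
by move=> ->.
Qed.

Lemma ae_swap (P : T1 -> T2 -> bool) : meas_fun (fun z : T1 * T2 => P z.1 z.2) ->
  (forall t, {ae m1, forall x, P x t}) -> {ae m1, forall x, {ae m2, forall t, P x t}}.
Proof.
move=> mP aeP.
have mi : meas_fun (fun z : T1 * T2 => (if P z.1 z.2 then 0 else 1) : \bar R).
  exact: meas_if.
have i0 x t : 0 <= (if P x t then 0 else 1) :> \bar R by case: ifP.
have m1P t : meas_fun (P^~ t) := meas_section2 mP t.
have m2P x : meas_fun (P x) := meas_section1 mP x.
have : \int[m1]_x \int[m2]_t (if P x t then 0 else 1) = 0.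
  rewrite (tonelli_swap m1 m2 mi i0) integral0_eq// => t _.
  exact/ae_integral0P.
have mI : meas_fun (fun x => \int[m2]_t (if P x t then 0 else 1)).
  exact: (measurable_integral1 m2 mi i0).
have := @ae_eq_integral_abs _ _ _ m1 setT measurableT _ mI.
have -> : \int[m1]_x `|\int[m2]_t (if P x t then 0 else 1)| = \int[m1]_x \int[m2]_t (if P x t then 0 else 1).
  by apply: eq_integral => x _; rewrite gee0_abs// integral_ge0.
move=> h1 h2; move/h1: h2; apply: filterS => x /(_ Logic.I) /= h.
exact/ae_integral0P.
Qed.

End ae_swap.

Section polar.
Context {R : realType}.
Implicit Types w : vec2 R.

Lemma norm2_ge0 w : 0 <= norm2 w. Proof. exact: sqrtr_ge0. Qed.

Lemma sqr_norm2 w : norm2 w ^+ 2 = w.1 ^+ 2 + w.2 ^+ 2.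
Proof. by rewrite /norm2 sqr_sqrtr// addr_ge0// sqr_ge0. Qed.

Lemma norm2_eq0 w : norm2 w = 0 -> w = (0, 0).
Proof.
move=> /eqP; rewrite -sqrf_eq0 sqr_norm2 paddr_eq0 ?sqr_ge0// !sqrf_eq0.
by case: w => w1 w2 /= /andP[/eqP -> /eqP ->].
Qed.

Lemma polar_decomposition w : w = norm2 w *: expi (polar_angle w).
Proof.
have [w0|w0] := eqVneq (norm2 w) 0.
  by rewrite w0 scale0r (norm2_eq0 w0).
have r0 : 0 < norm2 w by rewrite lt_neqAle eq_sym w0 norm2_ge0.
have le1 : `|w.1 / norm2 w| <= 1.
  rewrite normrM normfV (gtr0_norm r0) ler_pdivrMr// mul1r.
  by rewrite -sqrtr_sqr /norm2 ler_wsqrtr// lerDl sqr_ge0.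
have c : norm2 w * cos (acos (w.1 / norm2 w)) = w.1.
  by rewrite acosK ?in_itv/= -?ler_norml// mulrC divfK.
have s : norm2 w * sin (acos (w.1 / norm2 w)) = `|w.2|.
  have le1' : -1 <= w.1 / norm2 w <= 1 by rewrite -ler_norml.
  have rE : norm2 w = Num.sqrt (norm2 w ^+ 2) by rewrite sqrtr_sqr gtr0_norm.
  rewrite sin_acos// [X in X * _]rE -sqrtrM ?sqr_ge0// mulrBr mulr1 -exprMn.
  rewrite (_ : norm2 w * (w.1 / norm2 w) = w.1); last by rewrite mulrC divfK.
  by rewrite sqr_norm2 addrAC subrr add0r sqrtr_sqr.
rewrite [LHS]surjective_pairing /expi /polar_angle /GRing.scale /=.
rewrite /scale_pair /= /GRing.scale /=.
case: ifPn => w2; first by rewrite c s ger0_norm.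
by rewrite cosN sinN c mulrN s ltr0_norm ?opprK// ltNge.
Qed.

Lemma norm2Z (r a : R) : 0 <= r -> norm2 (r *: expi a) = r.
Proof.
move=> r0; rewrite /norm2 /expi /= /GRing.scale /= !exprMn -mulrDr cos2Dsin2 mulr1.
by rewrite sqrtr_sqr ger0_norm.
Qed.

Lemma rot2_polar (r a t : R) : rot2 (cos t) (sin t) (r *: expi a) = r *: expi (a + t).
Proof.
rewrite /rot2 /expi /= /GRing.scale /= /scale_pair /GRing.scale /= cosD sinD.
by congr pair; ring.
Qed.

End polar.

Section kernel_is_averaged.
Context {R : realType}.
Variables (m theta omega : R).
Hypotheses (m0 : 0 < m) (theta0 : 0 < theta) (omega0 : omega != 0).
Variable f : phase R -> R.
Hypothesis kerf : ker_transport m theta omega f.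

Local Notation F := (f \o unguide omega).

Let lf : locint f. Proof. by case: kerf => /(L2_phase_locint m0 theta0). Qed.

Let mf : meas_fun (f : mphase R -> R). Proof. by case: lf. Qed.

Let cs t : cos t ^+ 2 + sin t ^+ 2 = 1 :> R. Proof. exact: cos2Dsin2. Qed.

Let csN t : cos t ^+ 2 + (- sin t) ^+ 2 = 1 :> R. Proof. by rewrite sqrrN. Qed.

Let lF : locint F.
Proof.
apply: (locint_comp lf (mpres_unguide omega)) => N.
by exists (N + `|omega^-1| * N) => q; exact: inbox_unguide.
Qed.

Let lFr c s : c ^+ 2 + s ^+ 2 = 1 -> locint (F \o rotv c s).
Proof.
move=> e; apply: (locint_comp lF (mpres_rotv e)) => N.
by exists (2 * N) => q; exact: inbox_rotv.
Qed.

(** Pairing [F] and its rotate with a test function gives, after moving the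
  rotation to the test function, two values of the function of [t] that is
  constant by [integral_tensor_cst]. *)
Lemma ae_rotation_invariant_le0 t : 0 <= t ->
  {ae leb6 R, forall q : mphase R, F (rotv (cos t) (- sin t) q) = F q}.
Proof.
move=> t0.
pose g q := F (rotv (cos t) (- sin t) q) - F q.
suff : {ae leb6 R, forall q : mphase R, g q = 0}.
  by apply: filterS => q /eqP; rewrite subr_eq0 => /eqP.
have [mF _] := lF; have [mFr locFr] := lFr (csN t).
have dom (h : phase R -> R) k b a : locint h -> 0 <= k -> 0 <= b -> (forall i, - b <= a i) ->
    (leb6 R).-integrable setT (fun q => (h q * tensor k b a q)%:E).
  move=> lh k0 b0 ab; apply: (locint_dominated lh).
    by apply: measM; [case: lh|exact: measurable_tensor].
  exists 1, b => // q; have [qb|/tensor_eq0->//] := boolP (inbox b q); last by rewrite mulr0 normr0.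
  by rewrite normrM mulrC ler_wpM2r// normr_tensor_le1.
apply: du_bois_reymond.
  split; first by apply: measD => //; exact: measN.
  move=> N.
  have [_ /(_ N) i1] := lFr (csN t); have [_ /(_ N) i2] := lF.
  have mi := measurable_inbox (R := R) N.
  have mm (h : mphase R -> R) : meas_fun h ->
      meas_fun (fun q => (if inbox N q then `|h q| else 0)%:E).
    by move=> mh; apply: measE; apply: meas_if => //; exact: meas_norm.
  apply: (@le_lt_trans _ _ (\int[leb6 R]_q (
      (if inbox N q then `|F (rotv (cos t) (- sin t) q)| else 0)%:E +
      (if inbox N q then `|F q| else 0)%:E)))%E.
    apply: ge0_le_integral => //.
    - by move=> q _; rewrite lee_fin; case: ifP.
    - by apply: mm; apply: measD => //; exact: measN.
    - by apply: emeasurable_funD; exact: mm.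
    - move=> q _; rewrite -EFinD lee_fin; case: ifP => _; rewrite ?addr0//.
      exact: ler_normB.
  rewrite ge0_integralD//; [by rewrite lte_add_pinfty| | | |].
  - by move=> q _; rewrite lee_fin; case: ifP.
  - exact: mm mFr.
  - by move=> q _; rewrite lee_fin; case: ifP.
  - exact: mm mF.
move=> k b a k0 b0 ab.
have I1 := dom _ _ _ _ (lFr (csN t)) k0 b0 ab.
have I2 := dom _ _ _ _ lF k0 b0 ab.
transitivity (\int[leb6 R]_q (((F \o rotv (cos t) (- sin t)) q * tensor k b a q)%:E -
    (F q * tensor k b a q)%:E))%E.
  by apply: eq_integral => q _; rewrite -EFinB -mulrBl.
rewrite (integralB measurableT I1 I2).
have E := integral_tensor_cst m0 theta0 omega0 kerf k0 b0 ab.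
have mT s : mpres (leb6 R) (leb6 R) (rotv (cos s) (sin s) \o guide omega : mphase R -> mphase R).
  exact: (mpres_comp (mpres_guide omega) (mpres_rotv (cs s))).
have e1 : (\int[leb6 R]_q ((F \o rotv (cos t) (- sin t)) q * tensor k b a q)%:E =
    \int[leb6 R]_p (f p * tensor k b a (rotv (cos t) (sin t) (guide omega p)))%:E)%E.
  rewrite -(mpres_integral (mT t)); last by case/integrableP: I1.
  by apply: eq_integral => p _; rewrite /= rotvK// guideK.
have e2 : (\int[leb6 R]_q (F q * tensor k b a q)%:E =
    \int[leb6 R]_p (f p * tensor k b a (rotv (cos 0) (sin 0) (guide omega p)))%:E)%E.
  rewrite -(mpres_integral (mpres_guide omega)); last by case/integrableP: I2.
  apply: eq_integral => p _; rewrite /= guideK cos0 sin0; congr (_ * tensor _ _ _ _)%:E.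
  rewrite /rotv /rot2 !mul1r !mul0r subr0 add0r.
  by case: (guide omega p) => [? [[? ?] ?]].
have fin := integrable_fin_num measurableT I2.
by move: fin; rewrite e1 e2 (E t t0) => fin; rewrite subee.
Qed.

Lemma ae_rotation_invariant t :
  {ae leb6 R, forall q : mphase R, F (rotv (cos t) (sin t) q) = F q}.
Proof.
have [t0|t0] := leP 0 t; last first.
  have Nt0 : 0 <= - t by rewrite oppr_ge0 ltW.
  by have := ae_rotation_invariant_le0 Nt0; rewrite cosN sinN opprK.
have := mpres_ae (mpres_rotv (cs t)) (ae_rotation_invariant_le0 t0).
by apply: filterS => q; rewrite rotvK.
Qed.

Lemma averageE p : average omega f p = (2 * pi)^-1 *
  \int[lebesgue_measure]_(alpha in `[0, 2 * pi])
     F ((guide omega p).1, (norm2 p.2.1 *: expi alpha, p.2.2)).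
Proof.
rewrite /average; congr (_ * _); apply: eq_Rintegral => alpha _ /=.
congr f; case: p => [[[x1 x2] x3] [[v1 v2] v3]]; rewrite /unguide /guide /perp /=.
rewrite /GRing.scale /= /scale_pair /GRing.scale /=.
by congr (_, _, _, _) => /=; rewrite ?mulrN ?opprK.
Qed.

(** The null set of [ae_rotation_invariant] depends on the angle. By Tonelli's
  theorem, for almost every point the invariance holds at almost every angle, and
  then averaging over the angle does not change the value. *)
Lemma ker_transport_average : {ae leb6 R, forall p : mphase R, f p = average omega f p}.
Proof.
have [mF _] := lF.
pose P (q : mphase R) (t : mR R) : bool := F (rotv (cos t) (sin t) q) == F q.
have mrot : meas_fun (fun z : mphase R * mR R => rotv (cos z.2) (sin z.2) z.1 : mphase R).
  by rewrite /rotv /rot2; meas.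
have mP : meas_fun (fun z : mphase R * mR R => P z.1 z.2).
  apply: measurable_fun_eqr.
    exact: (measurableT_comp mF mrot).
  by apply: (measurableT_comp mF); meas.
have := ae_swap (m1 := leb6 R) (@lebesgue_measure R) mP _.
have aeP t : {ae leb6 R, forall q : mphase R, P q t}.
  by apply: filterS (ae_rotation_invariant t) => q /eqP.
move=> /(_ aeP) /(mpres_ae (mpres_guide omega)).
apply: filterS => p /=; set q := guide omega p => h.
have Fq : F q = f p by rewrite /= guideK.
rewrite averageE -/q.
set b := polar_angle p.2.1.
have h' : {ae (@lebesgue_measure R), forall alpha : mR R,
    F (q.1, (norm2 p.2.1 *: expi alpha, p.2.2)) = f p}.
  have := mpres_ae (lebesgue_translate (- b)) h.
  apply: filterS => alpha; rewrite /P => /eqP; rewrite Fq => <-.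
  congr F; rewrite /rotv /q /guide /=; congr (_, (_, _)).
  rewrite [X in rot2 _ _ X](polar_decomposition p.2.1) rot2_polar -/b.
  by rewrite addrC subrK.
have pi2 : 0 < 2 * pi :> R by rewrite mulr_gt0// pi_gt0.
rewrite /Rintegral (ae_eq_integral (cst (f p)%:E)) //.
- by rewrite integral_cst//= lebesgue_measure_itv/= lte_fin pi2 -EFinB subr0 /= mulrCA mulVf ?mulr1// gt_eqF.
- apply: measurable_funTS; apply: measE; apply: (measurableT_comp mF).
  by rewrite /expi /GRing.scale /= /scale_pair /GRing.scale /=; meas.
- by apply: filterS h' => alpha /= -> _.
Qed.

End kernel_is_averaged.

(** * Circle averages and rotation invariant kernels *)

Section circle_averages.
Context {R : realType}.
Local Notation leb := (@lebesgue_measure R).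
Local Open Scope ereal_scope.

Lemma ge0_integral_translate (h : R -> \bar R) (c : R) : meas_fun h ->
  (forall x, 0 <= h x) -> \int[leb]_x h (x + c)%R = \int[leb]_x h x.
Proof. by move=> mh h0; exact: (mpres_ge0_integral (lebesgue_translate c) mh h0). Qed.

Lemma ge0_integral_affine (h : R -> \bar R) (k c : R) : (k != 0)%R -> meas_fun h ->
  (forall x, 0 <= h x) -> `|k|%:E * \int[leb]_x h (k * x + c)%R = \int[leb]_x h x.
Proof.
move=> k0 mh h0; rewrite -[RHS](ge0_integral_translate c)//.
rewrite [RHS](ge0_integral_scale k0)//.
by apply: (measurableT_comp mh); meas.
Qed.

Let ge0_integral_period_pos (h : R -> \bar R) (T b : R) : (0 <= b <= T)%R ->
  meas_fun h -> (forall x, 0 <= h x) -> (forall x, h (x + T)%R = h x) ->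
  \int[leb]_x (if (0 <= x < T)%R then h (x + b)%R else 0) =
  \int[leb]_x (if (0 <= x < T)%R then h x else 0).
Proof.
move=> /andP[b0 bT] mh h0 hT.
have mi (u v : R) : meas_fun (fun x : mR R => if (u <= x < v)%R then h x else 0).
  by meas.
have i0 (u v : R) x : 0 <= (if (u <= x < v)%R then h x else 0) by case: ifP.
transitivity (\int[leb]_x (if (b <= x < T + b)%R then h x else 0)).
  rewrite -[RHS](ge0_integral_translate b (mi _ _) (i0 _ _)).
  by apply: eq_integral => x _; rewrite lerDr ltrD2r.
transitivity (\int[leb]_x ((if (b <= x < T)%R then h x else 0) +
    (if (T <= x < T + b)%R then h x else 0))).
  apply: eq_integral => x _.
  have [xT|xT] := ltP x T; rewrite ?andbT ?andbF /= ?adde0.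
    by rewrite (lt_le_trans xT) ?andbT// lerDl.
  by rewrite (le_trans bT xT) add0e.
rewrite ge0_integralD//.
rewrite -[X in _ + X](ge0_integral_translate T (mi _ _) (i0 _ _)).
rewrite [X in _ + X](_ : _ = \int[leb]_x (if (0 <= x < b)%R then h x else 0)); last first.
  by apply: eq_integral => x _; rewrite lerDr (addrC T b) ltrD2r hT.
rewrite -ge0_integralD//.
apply: eq_integral => x _.
have [bx|xb] := leP b x; rewrite ?andbT ?andbF /= ?adde0.
  by rewrite (le_trans b0 bx).
by rewrite (lt_le_trans xb bT) add0e andbT.
Qed.

Lemma ge0_integral_period (h : R -> \bar R) (T b : R) : (- T <= b <= T)%R ->
  meas_fun h -> (forall x, 0 <= h x) -> (forall x, h (x + T)%R = h x) ->
  \int[leb]_(x in `[0%R, T]) h (x + b)%R = \int[leb]_(x in `[0%R, T]) h x.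
Proof.
move=> /andP[Tb bT] mh h0 hT.
have E (g : R -> \bar R) : meas_fun g ->
    \int[leb]_(x in `[0%R, T]) g x = \int[leb]_x (if (0 <= x < T)%R then g x else 0).
  move=> mg; rewrite -integral_itv_bndo_bndc; last exact: measurable_funTS.
  by apply: integral_if; exact: set_itvco.
have mhb : meas_fun (fun x : mR R => h (x + b)%R).
  by apply: (measurableT_comp mh); meas.
rewrite E// E//; have [b0|b0] := leP 0%R b.
  by apply: ge0_integral_period_pos => //; rewrite b0.
rewrite -[RHS](@ge0_integral_period_pos h T (b + T)%R)//.
  by apply: eq_integral => x _; rewrite addrA hT.
by rewrite -lerBlDr sub0r Tb gerDr ltW.
Qed.

(** Rotating [w] shifts its polar angle, and the integral of a periodic function
  over a period does not depend on the starting point. *)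
Lemma ge0_integral_circle (H : vec2 R -> \bar R) (w : vec2 R) :
  meas_fun (H : mvec2 R -> \bar R) -> (forall u, 0 <= H u) ->
  \int[leb]_(t in `[0%R, (2 * pi)%R]) H (rot2 (cos t) (sin t) w) =
  \int[leb]_(t in `[0%R, (2 * pi)%R]) H (norm2 w *: expi t).
Proof.
move=> mH H0; set b := polar_angle w.
have bb : (- (2 * pi) <= b <= 2 * pi)%R.
  have p0 := pi_ge0 R.
  have pp : ((pi : R) <= 2 * pi)%R by rewrite ler_peMl// ler1n.
  have w1 : (-1 <= w.1 / norm2 w <= 1)%R.
    rewrite -ler_norml; have [->|n0] := eqVneq (norm2 w) 0%R; first by rewrite invr0 mulr0 normr0.
    have r0 : (0 < norm2 w)%R by rewrite lt_neqAle eq_sym n0 norm2_ge0.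
    rewrite normrM normfV (gtr0_norm r0) ler_pdivrMr// mul1r.
    by rewrite -sqrtr_sqr /norm2 ler_wsqrtr// lerDl sqr_ge0.
  have a0 := acos_ge0 w1; have api := acos_lepi w1.
  rewrite -ler_norml /b /polar_angle; case: ifP => _; rewrite ?normrN ger0_norm//;
  exact: le_trans pp.
rewrite -[RHS](@ge0_integral_period (fun t => H (norm2 w *: expi t)) _ _ bb)//.
- by apply: eq_integral => t _; rewrite {1}(polar_decomposition w) rot2_polar addrC.
- apply: (measurableT_comp mH).
  by rewrite /expi /GRing.scale /= /scale_pair /GRing.scale /=; meas.
- by move=> t; rewrite /expi mulr_natl cosD2pi sinD2pi.
Qed.

Lemma ge0_integral_leb2_gyro (h : vec2 R -> \bar R) (omega : R) (Y : vec2 R) : (omega != 0)%R ->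
  meas_fun (h : mvec2 R -> \bar R) -> (forall u, 0 <= h u) ->
  (omega ^+ 2)%:E * \int[leb2 R]_x h x =
  \int[leb2 R]_z h (Y - omega^-1 *: perp z)%R.
Proof.
move=> o0 mh h0.
have o1 : (omega^-1 != 0)%R by rewrite invr_eq0.
have oN1 : (- omega^-1 != 0)%R by rewrite oppr_eq0.
have oo : (`|omega^-1| * `|omega| = 1)%R by rewrite -normrM mulVf// normr1.
rewrite [in RHS](eq_integral (fun z : mvec2 R => h (- omega^-1 * z.2 + Y.1, omega^-1 * z.1 + Y.2)%R)); last first.
  move=> z _; congr h; rewrite [LHS]surjective_pairing; congr pair.
    by rewrite /= /GRing.scale /= /GRing.scale /= mulNr addrC.
  by rewrite /= /GRing.scale /= /GRing.scale /= mulrN opprK addrC.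
rewrite [RHS]tonelli12//=; last first.
  by apply: (measurableT_comp mh); meas.
rewrite tonelli21//=.
have mh2 : meas_fun (fun y : mR R => \int[leb]_x h (x, y)).
  apply: (@measurable_integral2 _ _ _ _ _ leb (fun x y => h (x, y))) => //.
  by apply: (measurableT_comp mh); meas.
have e1 (y : R) : \int[leb]_x h (x, y) =
    `|omega^-1|%:E * \int[leb]_x h (- omega^-1 * x + Y.1, y)%R.
  rewrite -(normrN (omega^-1)%R) (ge0_integral_affine Y.1 oN1 (h := fun x => h (x, y)))//.
  by apply: (measurableT_comp mh); meas.
rewrite -(ge0_integral_affine Y.2 o1 mh2); last by move=> y; exact: integral_ge0.
under eq_integral do rewrite e1.
rewrite ge0_integralZl//.
- rewrite !muleA -!EFinM -real_normK ?num_real// expr2.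
  rewrite (_ : `|omega| * `|omega| * _ * _ = 1)%R ?mul1e//.
  transitivity ((`|omega^-1| * `|omega|) * (`|omega^-1| * `|omega|))%R; first by ring.
  by rewrite oo mulr1.
- apply: (@measurable_integral1 _ _ _ _ _ leb (fun z x => h (- omega^-1 * x + Y.1, omega^-1 * z + Y.2)%R)) => //.
  by apply: (measurableT_comp mh); meas.
- by move=> y _; exact: integral_ge0.
Qed.

End circle_averages.

Section rotation_invariance.
Context {R : realType}.

Definition rotmx (c s : R) : 'M[R]_3 :=
  \matrix_(i, j) (nth [::] [:: [:: c; - s; 0]; [:: s; c; 0]; [:: 0; 0; 1]] i)`_j.

Lemma rotmxE c s (v : vec3 R) :
  of_col (rotmx c s *m col_of v) = (rot2 c s v.1, v.2).
Proof.
rewrite /of_col /rotmx /col_of /rot2 !mxE !big_ord_recl !big_ord0 !mxE /=.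
by congr (_, _, _); ring.
Qed.

Lemma rotation_around_e3_rotmx c s : c ^+ 2 + s ^+ 2 = 1 ->
  rotation_around_e3 (rotmx c s)^T.
Proof.
move=> cs; split.
- apply/matrixP => i j; rewrite trmxK !mxE !big_ord_recl big_ord0 !mxE /=.
  case: i => [[|[|[|//]]]] /= ?; case: j => [[|[|[|//]]]] /= ?; rewrite ?mulr1n ?mulr0n;
    first [ring|rewrite -[RHS]cs; ring].
- rewrite det_tr (expand_det_row _ ord_max) !big_ord_recl big_ord0 /cofactor !mxE /=.
  rewrite !mul0r !add0r addr0 mul1r.
  rewrite (expand_det_row _ ord0) !big_ord_recl big_ord0 /cofactor !mxE /=.
  rewrite !det_mx11 !mxE /= /bump /= -[RHS]cs; ring.
- apply/matrixP => i j; rewrite !mxE !big_ord_recl big_ord0 !mxE /=.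
  case: i => [[|[|[|//]]]] /= ?; ring.
Qed.

Lemma rotation_invariantE (C : vec3 R -> vec3 R -> R) c s (v v' : vec3 R) :
  rotation_invariant C -> c ^+ 2 + s ^+ 2 = 1 ->
  C (rot2 c s v.1, v.2) (rot2 c s v'.1, v'.2) = C v v'.
Proof.
move=> Crot cs; rewrite -!rotmxE -[in LHS](trmxK (rotmx c s)).
exact: Crot (rotation_around_e3_rotmx cs) _ _.
Qed.

Definition cylindrical_kernel (C : vec3 R -> vec3 R -> R) (r v3 r' v3' phi : R) : R :=
  C ((r, 0), v3) (r' *: expi phi, v3').

(** Rotate [v] to the half plane of polar angle zero. *)
Lemma cylindrical_form_exists (C : vec3 R -> vec3 R -> R) :
  rotation_invariant C -> cylindrical_form C (cylindrical_kernel C).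
Proof.
move=> Crot; split.
  by move=> r v3 r' v3' phi _ _; rewrite /cylindrical_kernel /expi mulr_natl cosD2pi sinD2pi.
move=> v v'; rewrite /cylindrical_kernel.
set b := polar_angle v.1.
rewrite -(@rotation_invariantE C (cos b) (sin b) (norm2 v.1, 0, v.2) _ Crot (cos2Dsin2 _)) /=.
have e : (norm2 v.1, 0) = norm2 v.1 *: expi 0 :> vec2 R.
  by rewrite /expi cos0 sin0 /GRing.scale /= /scale_pair /GRing.scale /= mulr1 mulr0.
rewrite e !rot2_polar add0r -polar_decomposition subrK -polar_decomposition.
by rewrite -!surjective_pairing.
Qed.

(** [C] and [Ct] are related through differences of polar angles; with [v] at polar
  angle zero these are the angles in the range of [polar_angle]. *)
Lemma cylindrical_form_kernel (C : vec3 R -> vec3 R -> R) Ct (r v3 r' v3' phi : R) :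
  cylindrical_form C Ct -> 0 < r -> 0 < r' -> - pi < phi <= pi ->
  Ct r v3 r' v3' phi = C ((r, 0), v3) (r' *: expi phi, v3').
Proof.
move=> [_ ->] r0 r'0 /andP[phi1 phi2] /=.
have n1 : norm2 (r, 0) = r.
  by rewrite /norm2 /= expr0n addr0 sqrtr_sqr gtr0_norm.
have a1 : polar_angle (r, 0) = 0 by rewrite /polar_angle n1 /= lexx divff ?gt_eqF// acos1.
rewrite n1 norm2Z ?ltW// a1 subr0; congr Ct.
rewrite /polar_angle (norm2Z _ (ltW r'0)) /expi /= /GRing.scale /= /scale_pair /GRing.scale /=  (mulrC r' (cos phi)) mulfK ?gt_eqF//.
rewrite pmulr_rge0//; case: ifPn => s0.
  rewrite cosK// in_itv/= phi2 andbT leNgt; apply/negP => phi0.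
  have : 0 < sin (- phi) by apply: sin_gt0_pi; rewrite oppr_gt0 phi0 /= ltrNl.
  by rewrite sinN oppr_gt0 ltNge s0.
have phi0 : phi <= 0.
  rewrite leNgt; apply/negP => phi0; move/negP: s0; apply.
  by apply: sin_ge0_pi; rewrite (ltW phi0) phi2.
by rewrite cosKN ?opprK// (ltW phi1) phi0.
Qed.

(** The product of the two radicands is Heron's expression, and the two points at distances
  [r'] from the origin and [norm2 z] from [(r, 0)] have polar angles plus and
  minus [gyro_angle], by the law of cosines. *)
Lemma averaged_kernelE (C : vec3 R -> vec3 R -> R) Ct (r v3 r' v3' : R) (z : vec2 R) :
  cylindrical_form C Ct -> 0 < r -> 0 <= r' ->
  averaged_kernel Ct r v3 r' v3' z =
  bipolar_kernel (fun w => C ((r, 0), v3) (w, v3')) r (r' ^+ 2) (norm2 z ^+ 2).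
Proof.
move=> cyl r0 r'0; rewrite /averaged_kernel /bipolar_kernel.
set rho := norm2 z; have rho0 : 0 <= rho := norm2_ge0 z.
have fact : heron r (r' ^+ 2) (rho ^+ 2) =
    (rho ^+ 2 - (r - r') ^+ 2) * ((r + r') ^+ 2 - rho ^+ 2).
  by rewrite /heron; ring.
have c1 : (`|r - r'| < rho) = (0 < rho ^+ 2 - (r - r') ^+ 2).
  by rewrite subr_gt0 -(real_normK (num_real (r - r'))) ltr_sqr ?nnegrE.
have c2 : (rho < r + r') = (0 < (r + r') ^+ 2 - rho ^+ 2).
  by rewrite subr_gt0 ltr_sqr ?nnegrE// addr_ge0// ltW.
have cond : (`|r - r'| < rho < r + r') = (0 < heron r (r' ^+ 2) (rho ^+ 2)).
  rewrite fact c1 c2; apply/andP/idP => [[h1 h2]|h]; first by rewrite mulr_gt0.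
  have rr' : 0 <= r * r' by rewrite mulr_ge0// ltW.
  by split; rewrite ltNge; apply/negP => hh; nra.
rewrite -cond; case: ifP => // /[dup] rr.
rewrite c1 c2 => /andP[h1 h2].
have r'gt0 : 0 < r'.
  rewrite lt_neqAle r'0 andbT eq_sym; apply/eqP => r'00.
  by move: h1 h2; rewrite r'00; lra.
set phi := gyro_angle r r' rho.
have [/andP[phi0 phipi] phiE] : 0 < phi < pi /\
    rho ^+ 2 = r ^+ 2 + r' ^+ 2 - 2 * r * r' * cos phi.
  have [p [Pp _]] := gyro_angle_unique (ltW r0) r'0 rr.
  exact: (@getI _ [set phi | 0 < phi < pi /\ rho ^+ 2 = r ^+ 2 + r' ^+ 2 - 2 * r * r' * cos phi] p Pp).
have s0 : 0 < sin phi by apply: sin_gt0_pi; rewrite phi0.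
have apexc : apex r (r' ^+ 2) (rho ^+ 2) = r' * cos phi.
  by rewrite /apex phiE; field; lra.
have apexs : Num.sqrt (r' ^+ 2 - apex r (r' ^+ 2) (rho ^+ 2) ^+ 2) = r' * sin phi.
  rewrite apexc (_ : _ - _ = (r' * sin phi) ^+ 2).
    by rewrite sqrtr_sqr gtr0_norm// mulr_gt0.
  by rewrite !exprMn sin2cos2; ring.
rewrite apexs apexc.
have e (t : R) : r' *: expi t = (r' * cos t, r' * sin t) by [].
rewrite !(cylindrical_form_kernel _ _ cyl r0 r'gt0); last 2 first.
- by rewrite ltrN2 phipi/= (le_trans _ (pi_ge0 R))// oppr_le0 ltW.
- by rewrite (lt_trans _ phi0) ?oppr_lt0 ?pi_gt0//= ltW.
rewrite !e cosN sinN mulrN; congr (_ / _).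
rewrite fact sqrtrM; last exact: ltW.
by rewrite [RHS]mulrA.
Qed.

End rotation_invariance.

(** * The averaged collision operator for nonnegative data *)

Section measurability_of_plane_maps.
Context {R : realType} d (T : measurableType d).
Implicit Types (u : T -> mvec2 R) (c s : T -> R).

Lemma meas_gyro (omega : R) (Y : vec2 R) u : meas_fun u ->
  meas_fun (fun x => (Y - omega *: perp (u x))%R : mvec2 R).
Proof.
move=> mu.
rewrite (_ : (fun _ => _) = (fun x => (Y.1 - omega * (u x).2, Y.2 + omega * (u x).1))); last first.
  apply/funext => x; rewrite [LHS]surjective_pairing /=; congr pair.
  by rewrite /GRing.scale /= mulrN opprK.
by meas.
Qed.

Lemma meas_rot2 c s u : meas_fun c -> meas_fun s -> meas_fun u ->
  meas_fun (fun x => rot2 (c x) (s x) (u x) : mvec2 R).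
Proof. by move=> mc ms mu; rewrite /rot2; meas. Qed.

Lemma meas_norm2 u : meas_fun u ->
  meas_fun (fun x => norm2 (u x)).
Proof. by move=> mu; rewrite /norm2; meas. Qed.

Lemma meas_polar c s : meas_fun c -> meas_fun s ->
  meas_fun (fun x => c x *: expi (s x) : mvec2 R).
Proof.
by move=> mc ms; rewrite /expi /GRing.scale /= /scale_pair /GRing.scale /=; meas.
Qed.

Lemma meas_subvec (Y : vec2 R) u : meas_fun u ->
  meas_fun (fun x => (Y - u x)%R : mvec2 R).
Proof.
move=> mu; rewrite (_ : (fun _ => _) = (fun x => (Y.1 - (u x).1, Y.2 - (u x).2))); last first.
  by apply/funext => x; rewrite [LHS]surjective_pairing.
by meas.
Qed.

End measurability_of_plane_maps.

Ltac meas_plane_step :=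
  match goal with
  | |- measurable_fun _ (fun x => (_ - _ *: perp _)%R) => apply: meas_gyro
  | |- measurable_fun _ (fun x => (_ - _)%R) => apply: meas_subvec
  | |- measurable_fun _ (fun x => rot2 _ _ _) => apply: meas_rot2
  | |- measurable_fun _ (fun x => norm2 _) => apply: meas_norm2
  | |- measurable_fun _ (fun x => (_ *: expi _)%R) => apply: meas_polar
  end.
Ltac meas_plane := rewrite /=; repeat (first [assumption | meas_cst | meas_plane_step | meas_step | meas_step2]).

Lemma gyro_shiftE (R : realType) (omega : R) (x v u w : vec2 R) : omega != 0 ->
  omega *: x + perp v - (omega *: u + perp w) =
  omega *: (x + omega^-1 *: perp v -
    (u.1 + (omega^-1 *: perp w).1, u.2 + (omega^-1 *: perp w).2)).
Proof.
move=> omega0; case: x v u w => [x1 x2] [v1 v2] [u1 u2] [w1 w2].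
rewrite [LHS]surjective_pairing [RHS]surjective_pairing /perp.
congr pair; rewrite /= /GRing.scale /= /scale_pair /GRing.scale /=; field; exact: omega0.
Qed.

Section collision_integrands.
Context {R : realType}.
Variables (omega : R) (C : vec3 R -> vec3 R -> R) (Phi : vec3 R * vec2 R -> R) (x v : vec3 R).

(** The general function that is constant along the gyration, through the guiding
  centre, the height [x3], the planar speed and [v3]. *)
Definition of_invariants (p : phase R) : R := Phi ((guide omega p).1, (norm2 p.2.1, p.2.2)).

(** The position at the angle [al] of the orbit through [(x, v)]. *)
Definition gyro_position (al : R) : vec3 R :=
  (x.1 + omega^-1 *: perp v.1 - omega^-1 *: perp (norm2 v.1 *: expi al), x.2).

Definition orbit_kernel (al : R) (v' : vec3 R) : R := C (norm2 v.1 *: expi al, v.2) v'.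

(** The kernel of the right-hand side, as the bipolar kernel of [C]. *)
Definition nonlocal_kernel (xb' : vec2 R) (v' : vec3 R) : R :=
  bipolar_kernel (fun w => C ((norm2 v.1, 0), v.2) (w, v'.2)) (norm2 v.1) (norm2 v'.1 ^+ 2)
    (norm2 (omega *: x.1 + perp v.1 - (omega *: xb' + perp v'.1)) ^+ 2).

Hypotheses (mC : meas_fun (fun p : mphase R => C p.1 p.2)).
Hypotheses (mPhi : meas_fun (Phi : mvec3 R * mvec2 R -> R)).

Lemma measurable_orbit_kernel :
  meas_fun (fun z : mR R * mvec3 R => orbit_kernel z.1 z.2).
Proof.
apply: (measurableT_comp mC (g := fun z => ((norm2 v.1 *: expi z.1, v.2), z.2))).
by meas_plane.
Qed.

Lemma measurable_of_invariants : meas_fun (of_invariants : mphase R -> R).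
Proof. by rewrite /of_invariants /guide; meas_plane. Qed.

Lemma measurable_orbit_invariants :
  meas_fun (fun z : mR R * mvec3 R => of_invariants (gyro_position z.1, z.2)).
Proof.
have my : meas_fun (fun z : mR R * mvec3 R =>
  (gyro_position z.1, z.2) : mphase R) by rewrite /gyro_position; meas_plane.
exact: (measurableT_comp measurable_of_invariants my).
Qed.

Lemma measurable_slice_invariants :
  meas_fun (fun z : mvec2 R * mvec3 R => of_invariants ((z.1, x.2), z.2)).
Proof.
have my : meas_fun (fun z : mvec2 R * mvec3 R => ((z.1, x.2), z.2) : mphase R).
  by meas_plane.
exact: (measurableT_comp measurable_of_invariants my).
Qed.

Lemma measurable_nonlocal_kernel :
  meas_fun (fun z : mvec2 R * mvec3 R => nonlocal_kernel z.1 z.2).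
Proof.
have mcw (a b : mvec2 R * mvec3 R -> R) : meas_fun a -> meas_fun b ->
    meas_fun (fun z => C ((norm2 v.1, 0), v.2) ((a z, b z), z.2.2)).
  move=> ma mb.
  have mg : meas_fun (fun z : mvec2 R * mvec3 R =>
    ((((norm2 v.1, 0), v.2)%R : mvec3 R), ((a z, b z), z.2.2)) : mphase R) by meas_plane.
  exact: (measurableT_comp mC mg).
have mb : meas_fun (fun z : mvec2 R * mvec3 R => norm2 (omega *: x.1 + perp v.1 -
    (omega *: z.1 + perp z.2.1)) ^+ 2)%R.
  rewrite (_ : (fun _ => _) = (fun z : mvec2 R * mvec3 R =>
    (omega * x.1.1 + v.1.2 - (omega * z.1.1 + z.2.1.2)) ^+ 2 +
    (omega * x.1.2 - v.1.1 - (omega * z.1.2 - z.2.1.1)) ^+ 2)%R).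
    by meas_plane.
  by apply/funext => z; rewrite sqr_norm2.
have ma : meas_fun (fun z : mvec2 R * mvec3 R => norm2 z.2.1 ^+ 2)%R by meas_plane.
rewrite /nonlocal_kernel /bipolar_kernel /heron /apex.
move: ma mb; set a := (fun z : mvec2 R * mvec3 R => norm2 z.2.1 ^+ 2)%R.
set b := (fun z : mvec2 R * mvec3 R => norm2 _ ^+ 2)%R => ma mb.
apply: meas_if => //; last first.
  apply: measM; last by apply: measV; meas_plane.
  by apply: measD; apply: mcw; meas_plane.
by apply: meas_ltr; meas_plane.
Qed.

End collision_integrands.

Section nonnegative_identity.
Context {R : realType}.
Local Notation leb := (@lebesgue_measure R).
Local Open Scope ereal_scope.
Variables (omega : R) (C : vec3 R -> vec3 R -> R) (Phi : vec3 R * vec2 R -> R).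
Hypotheses (omega0 : (omega != 0)%R).
Hypotheses (mC : meas_fun (fun p : mphase R => C p.1 p.2)).
Hypotheses (C0 : forall v v', (0 <= C v v')%R) (Crot : rotation_invariant C).
Hypotheses (mPhi : meas_fun (Phi : mvec3 R * mvec2 R -> R)).
Hypotheses (Phi0 : forall z, (0 <= Phi z)%R).

Local Notation Psi := (of_invariants omega Phi).

Variables (x v : vec3 R).
Local Notation r := (norm2 v.1).
Hypothesis r0 : (0 < r)%R.
Let Y : vec2 R := (x.1 + omega^-1 *: perp v.1)%R.
Local Notation I a := (0 <= a <= 2 * pi)%R.
Let c (v3' : R) (w : vec2 R) : R := C ((r, 0), v.2)%R (w, v3').
Let k (v3' a b : R) : R := bipolar_kernel (c v3') r a b.

Let mI : meas_fun (fun a : mR R => I a).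
Proof. by apply: measurable_and; apply: meas_ler; meas. Qed.

(* [Phi] integrated over guiding centres on the circle of centre [Y] and radius
   [sqrt b / |omega|], at squared planar speed [a]. Both sides of the identity
   reduce to integrals of [Gam] against a kernel. *)
Let Gam (v3' b a : R) : \bar R := \int[leb]_al (if I al then
  (Phi ((Y - omega^-1 *: perp (Num.sqrt b *: expi al), x.2), (Num.sqrt a, v3'))%R)%:E else 0).

Let Gam0 v3' b a : 0 <= Gam v3' b a.
Proof. by apply: integral_ge0 => al _; case: ifP => // _; rewrite lee_fin. Qed.

Let mGam : meas_fun (fun z : mvec2 R * mR R => Gam z.2 z.1.1 z.1.2).
Proof.
apply: (@measurable_integral1 _ _ _ _ _ leb (fun (z : mvec2 R * mR R) al => (if I al then
  (Phi ((Y - omega^-1 *: perp (Num.sqrt z.1.1 *: expi al), x.2), (Num.sqrt z.1.2, z.2))%R)%:E else 0))).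
  by meas_plane.
by move=> z al; case: ifP => // _; rewrite lee_fin.
Qed.

Let circleE (a v3' : R) (zeta : vec2 R) : (0 <= a)%R ->
  \int[leb]_al (if I al then
    (Phi ((Y - omega^-1 *: perp (rot2 (cos al) (sin al) zeta), x.2), (a, v3'))%R)%:E else 0) =
  Gam v3' (zeta.1 ^+ 2 + zeta.2 ^+ 2)%R (a ^+ 2)%R.
Proof.
move=> a0.
pose H (u : vec2 R) : \bar R := (Phi ((Y - omega^-1 *: perp u, x.2), (a, v3'))%R)%:E.
have mH : meas_fun (H : mvec2 R -> \bar R) by rewrite /H; meas_plane.
have H0 u : 0 <= H u by rewrite lee_fin.
have := @ge0_integral_circle R H zeta mH H0.
rewrite !integral_segment_if => ->.
rewrite /Gam; apply: eq_integral => al _; case: ifP => // _.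
by rewrite /H sqrtr_sqr ger0_norm// -sqr_norm2 sqrtr_sqr ger0_norm// norm2_ge0.
Qed.

Let norm2_rot (al : R) (w : vec2 R) : norm2 (rot2 (cos al) (sin al) w) = norm2 w.
Proof.
rewrite {1}(polar_decomposition w) rot2_polar norm2Z//; exact: norm2_ge0.
Qed.

Let left_integrand (al : R) (v' : vec3 R) : R :=
  (orbit_kernel C v al v' * Psi (gyro_position omega x v al, v'))%R.

Let mleft : meas_fun (fun z : mR R * mvec3 R => left_integrand z.1 z.2).
Proof.
by apply: measM; [exact: measurable_orbit_kernel|exact: measurable_orbit_invariants].
Qed.

(* Rotating [v'] with the gyration angle turns [C] into a function independent of
   that angle. The difference vector [(r, 0) - w.1] is then what rotates in the
   guiding centre of [(gyro_position al, v')]. *)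
Let left_rotated (al : R) : \int[leb3 R]_v' (left_integrand al v')%:E =
  \int[leb3 R]_w (C ((r, 0), v.2) w *
    Phi ((Y - omega^-1 *: perp (rot2 (cos al) (sin al) ((r, 0) - w.1)), x.2), (norm2 w.1, w.2)))%R%:E.
Proof.
have ml : meas_fun (fun v' : mvec3 R => (left_integrand al v')%:E).
  by apply: measE; exact: (meas_section1 mleft al).
rewrite -(mpres_ge0_integral (leb3_rot (cos2Dsin2 al)) ml); last first.
  move=> v'; rewrite lee_fin; apply: mulr_ge0; [exact: C0|exact: Phi0].
apply: eq_integral => w _; congr EFin; rewrite /left_integrand /orbit_kernel; congr (_ * _)%R.
  rewrite -[RHS](rotation_invariantE _ _ Crot (cos2Dsin2 al)); congr C; congr pair.
  by rewrite /rot2 /expi /GRing.scale /= /scale_pair /GRing.scale /= !mulr0 subr0 addr0 ![(r * _)%R]mulrC.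
rewrite /of_invariants /= norm2_rot; congr (Phi (_, _, _)).
rewrite /guide /= [RHS]surjective_pairing /=; congr pair.
  by rewrite /rot2 /expi /GRing.scale /= /scale_pair /GRing.scale /=; ring.
by rewrite /rot2 /expi /GRing.scale /= /scale_pair /GRing.scale /=; ring.
Qed.

Let left_identity :
  \int[leb]_al (if I al then \int[leb3 R]_v' (left_integrand al v')%:E else 0) =
  \int[leb3 R]_w ((C ((r, 0), v.2)%R w)%:E *
    Gam w.2 ((r - w.1.1) ^+ 2 + w.1.2 ^+ 2)%R (w.1.1 ^+ 2 + w.1.2 ^+ 2)%R).
Proof.
pose K (al : mR R) (w : mvec3 R) : \bar R := (C ((r, 0), v.2) w)%R%:E * (if I al then
    (Phi ((Y - omega^-1 *: perp (rot2 (cos al) (sin al) ((r, 0) - w.1)), x.2), (norm2 w.1, w.2)))%R%:E else 0).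
pose PK (z : mR R * mvec3 R) : \bar R := if I z.1 then
    (Phi ((Y - omega^-1 *: perp (rot2 (cos z.1) (sin z.1) ((r, 0) - z.2.1)), x.2), (norm2 z.2.1, z.2.2)))%R%:E else 0.
have mPK : meas_fun PK.
  apply: meas_if => //; first by apply: (measurableT_comp mI); meas.
  by meas_plane.
have mK : meas_fun (fun z => K z.1 z.2).
  apply: measMe => //; apply: measE.
  have mg : meas_fun (fun z : mR R * mvec3 R => ((((r, 0), v.2)%R : mvec3 R), z.2) : mphase R).
    by meas_plane.
  exact: (measurableT_comp mC mg).
have K0 al w : 0 <= K al w.
  by rewrite mule_ge0 ?lee_fin//; case: ifP => // _; rewrite lee_fin.
transitivity (\int[leb]_al \int[leb3 R]_w K al w).
  apply: eq_integral => al _; case: ifPn => Ial.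
    rewrite left_rotated; apply: eq_integral => w _.
    by rewrite /K Ial -EFinM.
  by rewrite integral0_eq// => w _; rewrite /K (negbTE Ial) mule0.
rewrite (tonelli_swap leb (leb3 R) mK K0); apply: eq_integral => w _.
rewrite /K ge0_integralZl//; last 3 first.
- have mp : meas_fun (fun al : mR R => (al, w)).
    exact/measurable_fun_pair.
  exact: (measurableT_comp mPK mp).
- by move=> al _; case: ifP => // _; rewrite lee_fin.
- by rewrite lee_fin.
rewrite circleE; last exact: norm2_ge0.
by rewrite sqr_norm2 /= sub0r sqrrN.
Qed.

Let J (v3' a : R) : \bar R := \int[leb2 R]_z ((k v3' a (z.1 ^+ 2 + z.2 ^+ 2)%R)%:E *
  Gam v3' (z.1 ^+ 2 + z.2 ^+ 2)%R a).

Let mc v3' : meas_fun (c v3' : mvec2 R -> R).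
Proof.
have mg : meas_fun (fun w : mvec2 R => ((((r, 0), v.2)%R : mvec3 R), (w, v3')) : mphase R).
  by meas_plane.
exact: (measurableT_comp mC mg).
Qed.

Let mGam2 v3' : meas_fun (fun z : mvec2 R => Gam v3' z.1 z.2).
Proof.
have mp : meas_fun (fun z : mvec2 R => (z, v3' : mR R)).
  exact/measurable_fun_pair.
exact: (measurableT_comp mGam mp).
Qed.

Let left_bipolar :
  \int[leb3 R]_w ((C ((r, 0), v.2)%R w)%:E *
    Gam w.2 ((r - w.1.1) ^+ 2 + w.1.2 ^+ 2)%R (w.1.1 ^+ 2 + w.1.2 ^+ 2)%R) =
  \int[leb]_v3' \int[leb2 R]_w J v3' (w.1 ^+ 2 + w.2 ^+ 2)%R.
Proof.
have mG : meas_fun (fun w : mvec3 R =>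
    Gam w.2 ((r - w.1.1) ^+ 2 + w.1.2 ^+ 2)%R (w.1.1 ^+ 2 + w.1.2 ^+ 2)%R).
  have mp : meas_fun (fun w : mvec3 R =>
    (((r - w.1.1) ^+ 2 + w.1.2 ^+ 2, w.1.1 ^+ 2 + w.1.2 ^+ 2), w.2)%R : mvec2 R * mR R).
    by meas_plane.
  exact: (measurableT_comp mGam mp).
have mCw : meas_fun (fun w : mvec3 R => C ((r, 0), v.2)%R w).
  have mg : meas_fun (fun w : mvec3 R => ((((r, 0), v.2)%R : mvec3 R), w) : mphase R).
    by meas_plane.
  exact: (measurableT_comp mC mg).
rewrite (@tonelli21 _ _ _ _ _ (leb2 R) leb); first last.
- by move=> w; apply: mule_ge0; [rewrite lee_fin; exact: C0|exact: Gam0].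
- by apply: measMe => //; exact: measE.
apply: eq_integral => v3' _.
exact: (bipolar_coordinates r0 (mc v3') (fun=> C0 _ _) (mGam2 v3') (Gam0 v3')).
Qed.

Let integral_circle_cst (t : \bar R) : \int[leb]_al (if I al then t else 0) = (2 * pi)%R%:E * t.
Proof.
rewrite -(integral_segment_if 0%R (2 * pi)%R (fun=> t)) integral_cst//=.
rewrite lebesgue_measure_itv/= lte_fin mulr_gt0 ?pi_gt0//= oppr0 adde0.
by rewrite muleC.
Qed.

Local Notation right_kernel := (nonlocal_kernel omega C x v).

(* In terms of the guiding centre [Y - omega^-1 *: perp z] the kernel only depends
   on the norm of [z], so [Phi] may be replaced by its mean over rotations. *)
Let right_inner (v' : vec3 R) :
  (2 * pi)%R%:E * ((omega ^+ 2)%R%:E *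
    \int[leb2 R]_xb' (right_kernel xb' v' * Psi ((xb', x.2), v'))%:E) =
  J v'.2 (v'.1.1 ^+ 2 + v'.1.2 ^+ 2)%R.
Proof.
set a := norm2 v'.1.
have a0 : (0 <= a)%R := norm2_ge0 _.
have mk b : meas_fun (fun t : mR R => k v'.2 b t).
  exact: (meas_section1 (measurable_bipolar_kernel r (mc v'.2)) b).
have k0 b t : (0 <= k v'.2 b t)%R by apply: bipolar_kernel_ge0 => w; exact: C0.
pose h (u : vec2 R) : R := (k v'.2 (a ^+ 2) (norm2 (omega *: (Y - u)) ^+ 2) *
  Phi ((u, x.2), (a, v'.2)))%R.
have mnorm : meas_fun (fun u : mvec2 R => norm2 (omega *: (Y - u)) ^+ 2)%R.
  rewrite (_ : (fun _ => _) = (fun u : vec2 R => omega ^+ 2 * ((Y.1 - u.1) ^+ 2 + (Y.2 - u.2) ^+ 2))%R).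
    by meas_plane.
  by apply/funext => u; rewrite sqr_norm2 /GRing.scale /= /scale_pair /GRing.scale /=; ring.
have mh : meas_fun (h : mvec2 R -> R).
  by apply: measM; [exact: (measurableT_comp (mk _) mnorm)|meas_plane].
have h0 u : (0 <= h u)%R by apply: mulr_ge0.
have -> : \int[leb2 R]_xb' (right_kernel xb' v' * Psi ((xb', x.2), v'))%:E =
    \int[leb2 R]_u (h u)%:E.
  have mpt := @leb2_translate R (omega^-1 *: perp v'.1)%R.
  rewrite -(mpres_ge0_integral mpt (measE mh)); last first.
    by move=> u; rewrite lee_fin.
  apply: eq_integral => u _; congr EFin; rewrite /h /nonlocal_kernel /of_invariants.
  congr (k _ _ (norm2 _ ^+ 2) * Phi (_, _, _))%R; last first.
    by rewrite /GRing.scale /= /scale_pair /GRing.scale /= mulrN.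
  exact: gyro_shiftE.
have hE0 (u : vec2 R) : 0 <= (h u)%:E by rewrite lee_fin.
have /= -> := ge0_integral_leb2_gyro Y omega0 (measE mh) hE0.
pose q (z : vec2 R) : R := (k v'.2 (a ^+ 2) (z.1 ^+ 2 + z.2 ^+ 2))%R.
have mq : meas_fun (q : mvec2 R -> R) by apply: (measurableT_comp (mk _)); meas_plane.
pose P (z : vec2 R) : R := Phi ((Y - omega^-1 *: perp z, x.2), (a, v'.2))%R.
have mP : meas_fun (P : mvec2 R -> R) by rewrite /P; meas_plane.
have -> : \int[leb2 R]_z (h (Y - omega^-1 *: perp z)%R)%:E = \int[leb2 R]_z (q z * P z)%:E.
  apply: eq_integral => z _; congr EFin; rewrite /h /q /P; congr (k _ _ _ * _)%R.
  by rewrite sqr_norm2 /GRing.scale /= /scale_pair /GRing.scale /=; field.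
rewrite -integral_circle_cst.
have mrot (al : R) : \int[leb2 R]_z (q z * P z)%:E = \int[leb2 R]_z (q z * P (rot2 (cos al) (sin al) z))%:E.
  have mpt := leb2_rot (cos2Dsin2 al).
  rewrite -(mpres_ge0_integral mpt (measE (measM mq mP))); last first.
    by move=> z; rewrite lee_fin; apply: mulr_ge0; [exact: k0|exact: Phi0].
  apply: eq_integral => z _; congr EFin; congr (_ * _)%R.
  by rewrite /q -!sqr_norm2 norm2_rot.
pose K (al : mR R) (z : mvec2 R) : \bar R := (q z)%:E * (if I al then (P (rot2 (cos al) (sin al) z))%:E else 0).
have mK : meas_fun (fun z => K z.1 z.2).
  apply: measMe; first by apply: measE; apply: (measurableT_comp mq).
  apply: meas_if => //; first by apply: (measurableT_comp mI); meas.
  by apply: measE; apply: (measurableT_comp mP); meas_plane.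
have K0 al z : 0 <= K al z.
  apply: mule_ge0; first by rewrite lee_fin; exact: k0.
  by case: ifP => // _; rewrite lee_fin; exact: Phi0.
transitivity (\int[leb]_al \int[leb2 R]_z K al z).
  apply: eq_integral => al _; case: ifPn => Ial.
    by rewrite (mrot al); apply: eq_integral => z _; rewrite /K Ial -EFinM.
  by rewrite integral0_eq// => z _; rewrite /K (negbTE Ial) mule0.
rewrite (tonelli_swap leb (leb2 R) mK K0); apply: eq_integral => z _.
rewrite /K ge0_integralZl//; last 3 first.
- have mp : meas_fun (fun al : mR R => (al, z)).
    exact/measurable_fun_pair.
  apply: meas_if => //.
  apply: measE; apply: (measurableT_comp mP); meas_plane.
- by move=> al _; case: ifP => // _; rewrite lee_fin; exact: Phi0.
- by rewrite lee_fin; exact: k0.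
rewrite /P circleE//; congr (_ * Gam _ _ _).
  by rewrite /q /a sqr_norm2.
by rewrite /a sqr_norm2.
Qed.

Let right_measurable : meas_fun (fun z : mvec2 R * mvec3 R =>
  (right_kernel z.1 z.2 * Psi ((z.1, x.2), z.2))%:E).
Proof.
apply: measE; apply: measM; last exact: measurable_slice_invariants.
exact: measurable_nonlocal_kernel.
Qed.

(** The left side is an integral over the rotated velocity [w], in which [Gam]
  depends on the distances of [w] to [0] and [(r, 0)]; the right side is an integral
  over these two distances. They agree by [bipolar_coordinates]. *)
Lemma average_collision_ge0 :
  \int[leb]_al (if I al then \int[leb3 R]_v'
    (orbit_kernel C v al v' * Psi (gyro_position omega x v al, v'))%:E else 0) =
  (2 * pi)%R%:E * ((omega ^+ 2)%R%:E * \int[leb2 R]_xb' \int[leb3 R]_v'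
    (nonlocal_kernel omega C x v xb' v' * Psi ((xb', x.2), v'))%:E).
Proof.
have R0 xb' v' : 0 <= (right_kernel xb' v' * Psi ((xb', x.2), v'))%:E.
  by rewrite lee_fin; apply: mulr_ge0; [apply: bipolar_kernel_ge0 => w; exact: C0|exact: Phi0].
rewrite -[LHS]/(\int[leb]_al (if I al then \int[leb3 R]_v' (left_integrand al v')%:E else 0)).
rewrite left_identity left_bipolar.
rewrite (tonelli_swap (leb2 R) (leb3 R) right_measurable)//.
have mi : meas_fun (fun v' : mvec3 R => \int[leb2 R]_xb' (right_kernel xb' v' * Psi ((xb', x.2), v'))%:E).
  exact: (@measurable_integral2 _ _ _ _ _ (leb2 R) (fun xb' v' => (right_kernel xb' v' * Psi ((xb', x.2), v'))%:E) right_measurable R0).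
have i0 v' : 0 <= \int[leb2 R]_xb' (right_kernel xb' v' * Psi ((xb', x.2), v'))%:E.
  by apply: integral_ge0.
have o0 : 0 <= (omega ^+ 2)%R%:E by rewrite lee_fin sqr_ge0.
have p0 : 0 <= (2 * pi)%R%:E :> \bar R by rewrite lee_fin mulr_ge0 ?pi_ge0.
rewrite -ge0_integralZl// -ge0_integralZl//.
rewrite (@tonelli21 _ _ _ _ _ (leb2 R) leb); first last.
- by move=> w; rewrite mule_ge0// mule_ge0.
- apply: measurable_funeM; apply: measurable_funeM; exact: mi.
- by apply: eq_integral => v3' _; apply: eq_integral => w _; rewrite right_inner.
- exact: measurable_funeM.
- by move=> v' _; apply: mule_ge0.
Qed.

End nonnegative_identity.

(** * Signed data *)

Section iterated_real_integrals.
Context d1 d2 (T1 : measurableType d1) (T2 : measurableType d2) (R : realType).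
Variables (m1 : {sigma_finite_measure set T1 -> \bar R}).
Variables (m2 : {sigma_finite_measure set T2 -> \bar R}).

Lemma measurable_Rintegral (f : T1 -> T2 -> R) :
  meas_fun (fun z => f z.1 z.2) ->
  meas_fun (fun x => \int[m2]_y f x y).
Proof.
move=> mf; apply: (measurableT_comp (f := fine)); first exact: fine_measurable.
have mE : meas_fun (fun z => (f z.1 z.2)%:E) by exact: measE.
rewrite (_ : (fun x => _) = (fun x => \int[m2]_y ((EFin \o f x)^\+ y) - \int[m2]_y ((EFin \o f x)^\- y)))%E; last first.
  by apply/funext => x; rewrite integralE.
apply: emeasurable_funB.
- apply: (measurable_integral1 m2 (f := fun x y => (EFin \o f x)^\+ y)%E) => //.
  + by rewrite (_ : (fun z => _) = (fun z => (f z.1 z.2)%:E)^\+%E); [exact: measurable_funepos|apply/funext => z; rewrite !funeposE].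
- apply: (measurable_integral1 m2 (f := fun x y => (EFin \o f x)^\- y)%E) => //.
  + by rewrite (_ : (fun z => _) = (fun z => (f z.1 z.2)%:E)^\-%E); [exact: measurable_funeneg|apply/funext => z; rewrite !funenegE].
Qed.

Lemma Rintegral_fubini (f : T1 -> T2 -> R) :
  (sfprod m1 m2).-integrable setT (fun z => (f z.1 z.2)%:E) ->
  \int[m1]_x \int[m2]_y f x y = \int[sfprod m1 m2]_z f z.1 z.2.
Proof.
move=> fi; have mfE := measurable_int _ fi.
have mf : meas_fun (fun z => f z.1 z.2) by exact/measurable_EFinP.
rewrite /Rintegral -[in RHS](integral12_prod_meas1 fi); congr fine.
apply: ae_eq_integral => //.
- by apply: measE; exact: measurable_Rintegral.
- exact: (measurable_fubini_F fi).
- have := ae_integrable1 fi; apply: filterS => x fx _.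
  by rewrite fineK//; exact: (integrable_fin_num _ fx).
Qed.

End iterated_real_integrals.

Section bilinear_integrals.
Context d (T : measurableType d) (R : realType).
Variables (mu : {measure set T -> \bar R}).

Lemma Rintegral_bilinear (a1 a2 b1 b2 : T -> R) :
  meas_fun a1 -> meas_fun a2 ->
  meas_fun b1 -> meas_fun b2 ->
  (forall x, 0 <= a1 x) -> (forall x, 0 <= a2 x) ->
  (forall x, 0 <= b1 x) -> (forall x, 0 <= b2 x) ->
  (\int[mu]_x ((a1 x + a2 x) * (b1 x + b2 x))%:E < +oo)%E ->
  mu.-integrable setT (fun x => ((a1 x - a2 x) * (b1 x - b2 x))%:E) /\
  \int[mu]_x ((a1 x - a2 x) * (b1 x - b2 x)) =
  \int[mu]_x (a1 x * b1 x) + \int[mu]_x (a2 x * b2 x) -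
  (\int[mu]_x (a1 x * b2 x) + \int[mu]_x (a2 x * b1 x)).
Proof.
move=> ma1 ma2 mb1 mb2 a10 a20 b10 b20 oo.
have I (a b : T -> R) : meas_fun a -> meas_fun b ->
    (forall x, 0 <= a x <= a1 x + a2 x) -> (forall x, 0 <= b x <= b1 x + b2 x) ->
    mu.-integrable setT (EFin \o (fun x => a x * b x)).
  move=> ma mb ha hb; apply/integrableP; split; first by apply: measE; exact: measM.
  apply: le_lt_trans oo; apply: ge0_le_integral => //.
  - by apply: measurableT_comp => //; apply: measE; exact: measM.
  - by apply: measE; apply: measM; exact: measD.
  - move=> x _; have /andP[h1 h2] := ha x; have /andP[h3 h4] := hb x.
    by rewrite /= lee_fin ger0_norm ?mulr_ge0// ler_pM.
have ha1 x : 0 <= a1 x <= a1 x + a2 x by rewrite a10 lerDl a20.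
have ha2 x : 0 <= a2 x <= a1 x + a2 x by rewrite a20 lerDr a10.
have hb1 x : 0 <= b1 x <= b1 x + b2 x by rewrite b10 lerDl b20.
have hb2 x : 0 <= b2 x <= b1 x + b2 x by rewrite b20 lerDr b10.
have I11 := I _ _ ma1 mb1 ha1 hb1. have I12 := I _ _ ma1 mb2 ha1 hb2.
have I21 := I _ _ ma2 mb1 ha2 hb1. have I22 := I _ _ ma2 mb2 ha2 hb2.
have IP : mu.-integrable setT (EFin \o (fun x => a1 x * b1 x + a2 x * b2 x)).
  have := integrableD measurableT I11 I22.
  by apply: eq_integrable => // x _; rewrite /= EFinD.
have IM : mu.-integrable setT (EFin \o (fun x => a1 x * b2 x + a2 x * b1 x)).
  have := integrableD measurableT I12 I21.
  by apply: eq_integrable => // x _; rewrite /= EFinD.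
split.
  have := integrableB measurableT IP IM.
  by apply: eq_integrable => // x _; rewrite /= -EFinB; congr EFin; ring.
rewrite /Rintegral (eq_integral (fun x => ((a1 x * b1 x + a2 x * b2 x) - (a1 x * b2 x + a2 x * b1 x))%:E)); last first.
  by move=> x _; congr EFin; ring.
rewrite -!/(Rintegral _ _ _) (RintegralB measurableT IP IM).
by rewrite (RintegralD measurableT I11 I22) (RintegralD measurableT I12 I21).
Qed.

End bilinear_integrals.

Lemma ge0_integral_eq0 d (T : measurableType d) (R : realType)
    (mu : {measure set T -> \bar R}) (g : T -> \bar R) : (forall x, 0 <= g x)%E ->
  meas_fun g -> (\int[mu]_x g x = 0)%E -> {ae mu, forall x, g x = 0%E}.
Proof.
move=> g0 mg gE; have := @ae_eq_integral_abs _ _ _ mu setT measurableT _ mg.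
rewrite (_ : integral _ _ _ = 0%E); last first.
  by rewrite -gE; apply: eq_integral => x _; rewrite gee0_abs.
by move=> [/(_ erefl) + _]; apply: filterS => x /= /(_ Logic.I).
Qed.

Section ae_products.
Context d1 d2 (T1 : measurableType d1) (T2 : measurableType d2) (R : realType).
Variables (m1 : {sigma_finite_measure set T1 -> \bar R}).
Variables (m2 : {sigma_finite_measure set T2 -> \bar R}).

Let measurable_notin d (T : measurableType d) (N : set T) :
  measurable N -> meas_fun (fun z => z \notin N).
Proof.
move=> mN; apply: (measurable_fun_bool false); rewrite setTI.
rewrite (_ : _ @^-1` _ = N)//; apply/seteqP; split => z /=.
  by move/negbFE; rewrite inE.
by move=> Nz; apply/negbF; rewrite inE.
Qed.

Lemma ae_section1 (P : T1 * T2 -> Prop) : {ae sfprod m1 m2, forall z, P z} ->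
  {ae m1, forall x, {ae m2, forall y, P (x, y)}}.
Proof.
move=> [N [mN N0 PN]].
have mn := measurable_notin mN.
have mi : meas_fun (fun z : T1 * T2 => (if z \notin N then 0 else 1)%E : \bar R).
  exact: meas_if.
have i0 (z : T1 * T2) : (0 <= (if z \notin N then 0 else 1) :> \bar R)%E by case: ifP.
have /(ae_integral0P _ mn) : {ae sfprod m1 m2, forall z, z \notin N}.
  by exists N; split => // z /= /negP/negPn; rewrite inE.
rewrite (@tonelli12 _ _ _ _ _ m1 m2)// => /ge0_integral_eq0 E.
apply: filterS (E _ _) => [x|x|].
- move=> /(ae_integral0P m2 (P := fun y => (x, y) \notin N)) h.
  have mx : meas_fun (fun y => (x, y) \notin N).
    have mp : meas_fun (fun y : T2 => (x, y)) by exact/measurable_fun_pair.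
    exact: (measurableT_comp mn mp).
  apply: filterS (h mx) => y; apply: contraNP => nP; rewrite inE; exact: PN.
- exact: integral_ge0.
- apply: (measurable_integral1 m2 (f := fun x y => if (x, y) \notin N then 0 else 1)%E) => //.
  by rewrite (_ : (fun z => _) = (fun z => if z \notin N then 0 else 1)%E)//; apply/funext => -[].
Qed.

Lemma ae_fst (P : T1 -> Prop) : {ae m1, forall x, P x} ->
  {ae sfprod m1 m2, forall z, P z.1}.
Proof.
move=> [N [mN N0 PN]]; exists (N `*` setT); split.
- exact: measurableX.
- by rewrite /sfprod product_measure1E//; rewrite [X in (X * _)%E](_ : _ = 0%E) ?mul0e.
- by move=> z nP; split => //; exact: PN.
Qed.

Lemma ae_snd (P : T2 -> Prop) : {ae m2, forall y, P y} ->
  {ae sfprod m1 m2, forall z, P z.2}.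
Proof.
move=> [N [mN N0 PN]]; exists (setT `*` N); split.
- exact: measurableX.
- by rewrite /sfprod product_measure1E//; rewrite [X in (_ * X)%E](_ : _ = 0%E) ?mule0.
- by move=> z nP; split => //; exact: PN.
Qed.

End ae_products.

Lemma ae_section2 d1 d2 (T1 : measurableType d1) (T2 : measurableType d2) (R : realType)
    (m1 : {sigma_finite_measure set T1 -> \bar R})
    (m2 : {sigma_finite_measure set T2 -> \bar R}) (P : T1 * T2 -> Prop) :
  {ae sfprod m1 m2, forall z, P z} -> {ae m2, forall y, {ae m1, forall x, P (x, y)}}.
Proof. by move/(mpres_ae (mpres_swap m2 m1))/ae_section1. Qed.

Section signed_identity.
Context {R : realType}.
Local Notation leb := (@lebesgue_measure R).
Variables (omega : R) (omega0 : omega != 0) (x v : vec3 R) (r0 : 0 < norm2 v.1).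
Local Notation I a := (0 <= a <= 2 * pi).
Local Notation mu1 := (sfprod leb (leb3 R)).
Local Notation mu2 := (sfprod (leb2 R) (leb3 R)).

Let A (C : vec3 R -> vec3 R -> R) (z : R * vec3 R) : R :=
  if I z.1 then orbit_kernel C v z.1 z.2 else 0.
Let B (Phi : vec3 R * vec2 R -> R) (z : R * vec3 R) : R :=
  of_invariants omega Phi (gyro_position omega x v z.1, z.2).
Let K (C : vec3 R -> vec3 R -> R) (z : vec2 R * vec3 R) : R :=
  nonlocal_kernel omega C x v z.1 z.2.
Let G (Phi : vec3 R * vec2 R -> R) (z : vec2 R * vec3 R) : R :=
  of_invariants omega Phi ((z.1, x.2), z.2).

Local Notation mkernel C := (meas_fun (fun p : mphase R => C p.1 p.2)).
Local Notation minv Phi := (meas_fun (Phi : mvec3 R * mvec2 R -> R)).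

Let mI : meas_fun (fun z : mR R * mvec3 R => I z.1).
Proof. by apply: measurable_and; apply: meas_ler; meas. Qed.

Let mA C : mkernel C -> meas_fun (A C : mR R * mvec3 R -> R).
Proof. by move=> mC; apply: meas_if => //; exact: measurable_orbit_kernel. Qed.

Let mB Phi : minv Phi -> meas_fun (B Phi : mR R * mvec3 R -> R).
Proof. by move=> mPhi; exact: measurable_orbit_invariants. Qed.

Let mK C : mkernel C -> meas_fun (K C : mvec2 R * mvec3 R -> R).
Proof. by move=> mC; exact: measurable_nonlocal_kernel. Qed.

Let mG Phi : minv Phi -> meas_fun (G Phi : mvec2 R * mvec3 R -> R).
Proof. by move=> mPhi; exact: measurable_slice_invariants. Qed.

Let identity_ge0 (C : vec3 R -> vec3 R -> R) (Phi : vec3 R * vec2 R -> R) : mkernel C -> minv Phi -> (forall v v', 0 <= C v v') ->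
  (forall y, 0 <= Phi y) -> rotation_invariant C ->
  (\int[mu1]_z (A C z * B Phi z)%:E =
   (2 * pi * omega ^+ 2)%:E * \int[mu2]_z (K C z * G Phi z)%:E)%E.
Proof.
move=> mC mPhi C0 Phi0 Crot.
have mAB := measE (measM (mA mC) (mB mPhi)).
have mKG := measE (measM (mK mC) (mG mPhi)).
have AB0 z : (0 <= (A C z * B Phi z)%:E)%E.
  by rewrite lee_fin mulr_ge0//; [rewrite /A; case: ifP => // _; exact: C0|exact: Phi0].
have KG0 z : (0 <= (K C z * G Phi z)%:E)%E.
  by rewrite lee_fin mulr_ge0//; [apply: bipolar_kernel_ge0 => w; exact: C0|exact: Phi0].
rewrite (@tonelli12 _ _ _ _ _ leb (leb3 R))// (@tonelli12 _ _ _ _ _ (leb2 R) (leb3 R))//.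
rewrite EFinM -muleA -(average_collision_ge0 omega0 mC C0 Crot mPhi Phi0 x r0).
apply: eq_integral => al _; case: ifPn => Ial.
  by apply: eq_integral => v' _; rewrite /A /= Ial.
by rewrite integral0_eq// => v' _; rewrite /A /= (negbTE Ial) mul0r.
Qed.

Variables (C : vec3 R -> vec3 R -> R) (Phi : vec3 R * vec2 R -> R).
Hypotheses (mC : mkernel C) (mPhi : minv Phi) (Crot : rotation_invariant C).
Hypothesis finite_orbit : (\int[leb]_al (if I al then \int[leb3 R]_v'
  `|orbit_kernel C v al v' * of_invariants omega Phi (gyro_position omega x v al, v')|%:E
  else 0) < +oo)%E.

Let pos (a : R) : R := Num.max a 0.
Let pos0 a : 0 <= pos a. Proof. by rewrite /pos le_max lexx orbT. Qed.
Let posB a : pos a - pos (- a) = a.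
Proof. by rewrite /pos; case: (leP a 0); case: (leP (- a) 0); lra. Qed.
Let posD a : pos a + pos (- a) = `|a|.
Proof. by rewrite /pos; case: (leP a 0) => h; [rewrite ler0_norm//|rewrite gtr0_norm//]; case: (leP (- a) 0); lra. Qed.

Let C1 v v' := pos (C v v').
Let C2 v v' := pos (- C v v').
Let P1 y := pos (Phi y).
Let P2 y := pos (- Phi y).

Let mpos d (T : measurableType d) (g : T -> R) : meas_fun g ->
  meas_fun (fun t => pos (g t)).
Proof. by move=> mg; apply: measurable_maxr => //; meas_cst. Qed.

Let mC1 : mkernel C1. Proof. exact: mpos. Qed.
Let mC2 : mkernel C2. Proof. by apply: mpos; exact: measN. Qed.
Let mP1 : minv P1. Proof. exact: mpos. Qed.
Let mP2 : minv P2. Proof. by apply: mpos; exact: measN. Qed.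
Let C1rot : rotation_invariant C1.
Proof. by move=> O HO u u'; rewrite /C1 Crot. Qed.
Let C2rot : rotation_invariant C2.
Proof. by move=> O HO u u'; rewrite /C2 Crot. Qed.

Let AE z : A C z = A C1 z - A C2 z.
Proof. by rewrite /A; case: ifP => _; rewrite ?subr0// /orbit_kernel /C1 /C2 posB. Qed.
Let BE z : B Phi z = B P1 z - B P2 z.
Proof. by rewrite /B /of_invariants /P1 /P2 posB. Qed.
Let KE z : K C z = K C1 z - K C2 z.
Proof.
rewrite /K /nonlocal_kernel /bipolar_kernel; case: ifP => _; rewrite ?subr0//.
rewrite -mulrBl; congr (_ * _); rewrite /C1 /C2.
set a := C _ _; set b := C _ _; rewrite -[in LHS](posB a) -[in LHS](posB b); ring.
Qed.
Let GE z : G Phi z = G P1 z - G P2 z.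
Proof. by rewrite /G /of_invariants /P1 /P2 posB. Qed.

Let KD z : K C1 z + K C2 z = K (fun v v' => C1 v v' + C2 v v') z.
Proof.
rewrite /K /nonlocal_kernel /bipolar_kernel; case: ifP => _; rewrite ?addr0//.
by rewrite -mulrDl; congr (_ * _); ring.
Qed.

Let finite_mu1 : (\int[mu1]_z ((A C1 z + A C2 z) * (B P1 z + B P2 z))%:E < +oo)%E.
Proof.
rewrite (@tonelli12 _ _ _ _ _ leb (leb3 R)); first last.
- move=> z; rewrite lee_fin mulr_ge0// addr_ge0 ?pos0// /A; case: ifP => // _; exact: pos0.
- by apply: measE; apply: measM; apply: measD; [exact: mA|exact: mA|exact: mB|exact: mB].
apply: le_lt_trans finite_orbit; rewrite le_eqVlt; apply/orP; left; apply/eqP.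
apply: eq_integral => al _; case: ifPn => Ial.
  apply: eq_integral => v' _; congr EFin.
  by rewrite /A /= Ial /B /of_invariants /P1 /P2 posD /orbit_kernel /C1 /C2 posD normrM.
by rewrite integral0_eq// => v' _; rewrite /A /= (negbTE Ial) addr0 mul0r.
Qed.

Let c0 : 0 < 2 * pi * omega ^+ 2.
Proof. by apply: mulr_gt0; [rewrite mulr_gt0 ?pi_gt0|rewrite exprn_even_gt0]. Qed.

Let finite_mu2 : (\int[mu2]_z ((K C1 z + K C2 z) * (G P1 z + G P2 z))%:E < +oo)%E.
Proof.
pose Cs v v' := C1 v v' + C2 v v'; pose Ps y := P1 y + P2 y.
have mCs : mkernel Cs by exact: measD.
have mPs : minv Ps by exact: measD.
have Cs0 u u' : 0 <= Cs u u' by rewrite addr_ge0 ?pos0.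
have Ps0 y : 0 <= Ps y by rewrite addr_ge0 ?pos0.
have Csrot : rotation_invariant Cs by move=> O HO u u'; rewrite /Cs C1rot// C2rot.
have E := identity_ge0 mCs mPs Cs0 Ps0 Csrot.
have E1 : (\int[mu1]_z (A Cs z * B Ps z)%:E =
    \int[mu1]_z ((A C1 z + A C2 z) * (B P1 z + B P2 z))%:E)%E.
  apply: eq_integral => z _; congr EFin; congr (_ * _).
  by rewrite /A; case: ifP => _ //; rewrite addr0.
have E2 : (\int[mu2]_z (K Cs z * G Ps z)%:E =
    \int[mu2]_z ((K C1 z + K C2 z) * (G P1 z + G P2 z))%:E)%E.
  by apply: eq_integral => z _; rewrite KD.
rewrite -E2; have := finite_mu1; rewrite -E1 E.
have : (0 <= \int[mu2]_z (K Cs z * G Ps z)%:E)%E.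
  apply: integral_ge0 => z _; rewrite lee_fin mulr_ge0//; last exact: Ps0.
  by apply: bipolar_kernel_ge0 => w; exact: Cs0.
case: integral => [s|//|//] _; first by move=> _; rewrite ltry.
by rewrite gt0_muley ?lte_fin// ltxx.
Qed.

Let scale_part (C' : vec3 R -> vec3 R -> R) (P' : vec3 R * vec2 R -> R) : mkernel C' -> minv P' -> (forall v v', 0 <= C' v v') ->
  (forall y, 0 <= P' y) -> rotation_invariant C' ->
  \int[mu1]_z (A C' z * B P' z) = (2 * pi * omega ^+ 2) * \int[mu2]_z (K C' z * G P' z).
Proof.
move=> mC' mP' C'0 P'0 C'rot; rewrite /Rintegral (identity_ge0 mC' mP' C'0 P'0 C'rot).
case: (integral mu2 _ _) => [s //| |] /=.
- by rewrite gt0_muley ?lte_fin//= mulr0.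
- by rewrite gt0_muleNy ?lte_fin//= mulr0.
Qed.

(** Decompose [C] and [Phi] into positive and negative parts and apply
  [average_collision_ge0] to the four products. All the integrals are finite:
  on the left by hypothesis, on the right by the same identity for the absolute
  values. *)
Lemma average_collision :
  \int[leb]_(al in `[0, 2 * pi]) \int[leb3 R]_v'
    (orbit_kernel C v al v' * of_invariants omega Phi (gyro_position omega x v al, v')) =
  2 * pi * omega ^+ 2 * \int[leb2 R]_xb' \int[leb3 R]_v'
    (nonlocal_kernel omega C x v xb' v' * of_invariants omega Phi ((xb', x.2), v')).
Proof.
have A0 C' : (forall v v', 0 <= C' v v') -> forall z, 0 <= A C' z.
  by move=> C'0 z; rewrite /A; case: ifP => // _; exact: C'0.
have K0 C' : (forall v v', 0 <= C' v v') -> forall z, 0 <= K C' z.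
  by move=> C'0 z; apply: bipolar_kernel_ge0 => w; exact: C'0.
have [i1 e1] := Rintegral_bilinear (mA mC1) (mA mC2) (mB mP1) (mB mP2)
  (A0 _ (fun _ _ => pos0 _)) (A0 _ (fun _ _ => pos0 _)) (fun=> pos0 _) (fun=> pos0 _) finite_mu1.
have [i2 e2] := Rintegral_bilinear (mK mC1) (mK mC2) (mG mP1) (mG mP2)
  (K0 _ (fun _ _ => pos0 _)) (K0 _ (fun _ _ => pos0 _)) (fun=> pos0 _) (fun=> pos0 _) finite_mu2.
have j1 : mu1.-integrable setT (fun z => (A C (z.1, z.2) * B Phi (z.1, z.2))%:E).
  by apply: eq_integrable i1 => // z _; rewrite -AE -BE.
have j2 : mu2.-integrable setT (fun z => (K C (z.1, z.2) * G Phi (z.1, z.2))%:E).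
  by apply: eq_integrable i2 => // z _; rewrite -KE -GE.
transitivity (\int[leb]_al \int[leb3 R]_v' (A C (al, v') * B Phi (al, v'))).
  rewrite {1}/Rintegral integral_segment_if; congr fine; apply: eq_integral => al _.
  case: ifPn => Ial; first by congr EFin; apply: eq_Rintegral => v' _; rewrite /A /= Ial.
  by rewrite /Rintegral integral0_eq// => v' _; rewrite /A /= (negbTE Ial) mul0r.
rewrite (@Rintegral_fubini _ _ _ _ _ leb (leb3 R) (fun al v' => A C (al, v') * B Phi (al, v')) j1).
rewrite (@Rintegral_fubini _ _ _ _ _ (leb2 R) (leb3 R) (fun xb' v' => K C (xb', v') * G Phi (xb', v')) j2).
have E1 : \int[mu1]_z (A C (z.1, z.2) * B Phi (z.1, z.2)) =
    \int[mu1]_z ((A C1 z - A C2 z) * (B P1 z - B P2 z)).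
  by apply: eq_Rintegral => z _; rewrite -AE -BE.
have E2 : \int[mu2]_z (K C (z.1, z.2) * G Phi (z.1, z.2)) =
    \int[mu2]_z ((K C1 z - K C2 z) * (G P1 z - G P2 z)).
  by apply: eq_Rintegral => z _; rewrite -KE -GE.
rewrite E1 E2 e1 e2 !scale_part//; first by ring.
all: by move=> *; exact: pos0.
Qed.

End signed_identity.

(** * Integrability along almost every orbit *)

Section iterated_integrals.
Context d1 d2 (T1 : measurableType d1) (T2 : measurableType d2) (R : realType).
Variables (m1 : {sigma_finite_measure set T1 -> \bar R}).
Variables (m2 : {sigma_finite_measure set T2 -> \bar R}).

Lemma ae_eq_Rintegral2 (f g : T1 -> T2 -> R) :
  meas_fun (fun z => f z.1 z.2) -> meas_fun (fun z => g z.1 z.2) ->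
  {ae m1, forall x, {ae m2, forall y, f x y = g x y}} ->
  \int[m1]_x \int[m2]_y f x y = \int[m1]_x \int[m2]_y g x y.
Proof.
move=> mf mg fg; congr fine; apply: ae_eq_integral => //.
- by apply: measE; exact: measurable_Rintegral.
- by apply: measE; exact: measurable_Rintegral.
apply: filterS fg => x fgx _; congr EFin; congr fine.
have ms (h : T1 -> T2 -> R) : meas_fun (fun z => h z.1 z.2) ->
    meas_fun (fun y => (h x y)%:E).
  by move=> mh; apply: measE; exact: (meas_section1 mh x).
apply: ae_eq_integral => //; [exact: ms|exact: ms|].
by apply: filterS fgx => y e _; rewrite e.
Qed.

End iterated_integrals.

Lemma Rintegral_segment_if (R : realType) (u v : R) (f : R -> R) :
  \int[lebesgue_measure]_(x in `[u, v]) f x =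
  \int[lebesgue_measure]_x (if u <= x <= v then f x else 0).
Proof.
rewrite /Rintegral integral_segment_if; congr fine; apply: eq_integral => x _.
by case: ifP.
Qed.

Section orbits.
Context {R : realType}.
Local Notation leb := (@lebesgue_measure R).
Variables (omega : R).
Local Notation I a := (0 <= a <= 2 * pi).
Local Open Scope ereal_scope.

Let flow (al : R) (p : phase R) : phase R := unguide omega (rotv (cos al) (sin al) (guide omega p)).

Definition orbit (p : phase R) (al : R) : phase R :=
  (gyro_position omega p.1 p.2 al, (norm2 p.2.1 *: expi al, p.2.2)%R).

Lemma orbitE p al :
  orbit p al = unguide omega ((guide omega p).1, (norm2 p.2.1 *: expi al, p.2.2)%R).
Proof.
rewrite /orbit /gyro_position; case: p => [[[x1 x2] x3] [[v1 v2] v3]].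
rewrite /unguide /guide /perp /=.
congr pair; congr pair; rewrite [LHS]surjective_pairing /=; congr pair;
  by rewrite /GRing.scale /= /scale_pair /GRing.scale /=; ring.
Qed.

Let mflow : meas_fun (fun z : mR R * mphase R => flow z.1 z.2 : mphase R).
Proof.
rewrite /flow; apply: (measurableT_comp (measurable_unguide omega)).
have mg : meas_fun (fun z : mR R * mphase R => guide omega z.2 : mphase R).
  exact: (measurableT_comp (measurable_guide omega) measurable_snd).
by rewrite /rotv; meas_plane.
Qed.

Let mpres_flow al : mpres (leb6 R) (leb6 R) (flow al : mphase R -> mphase R).
Proof.
exact: (mpres_comp (mpres_comp (mpres_guide omega) (mpres_rotv (cos2Dsin2 al)))
  (mpres_unguide omega)).
Qed.

(* [orbit p] and [flow ^~ p] describe the same circle, from different angles; the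
   latter preserves the measure at fixed angle. *)
Let integral_orbitE (B : phase R -> \bar R) (p : phase R) :
  meas_fun (B : mphase R -> \bar R) -> (forall q, 0 <= B q) ->
  \int[leb]_al (if I al then B (orbit p al) else 0) =
  \int[leb]_al (if I al then B (flow al p) else 0).
Proof.
move=> mB B0.
pose H (w : vec2 R) := B (unguide omega ((guide omega p).1, (w, p.2.2))).
have mH : meas_fun (H : mvec2 R -> \bar R).
  apply: (measurableT_comp mB); apply: (measurableT_comp (measurable_unguide omega)).
  by meas_plane.
have := @ge0_integral_circle R H p.2.1 mH (fun=> B0 _).
rewrite !integral_segment_if => E; transitivity (\int[leb]_al (if I al then H (norm2 p.2.1 *: expi al)%R else 0)).
  apply: eq_integral => al _; case: ifP => // _; by rewrite /H orbitE.
by rewrite -E.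
Qed.

Let integral_flow (D : phase R -> \bar R) :
  meas_fun (D : mphase R -> \bar R) -> (forall q, 0 <= D q) ->
  \int[leb6 R]_p \int[leb]_al (if I al then D (flow al p) else 0) =
  (2 * pi)%:E * \int[leb6 R]_q D q.
Proof.
move=> mD D0.
have mI : meas_fun (fun z : mR R * mphase R => I z.1).
  by apply: measurable_and; apply: meas_ler; meas.
have mk : meas_fun (fun z : mR R * mphase R =>
    if I z.1 then D (flow z.1 z.2) else 0).
  by apply: meas_if => //; exact: (measurableT_comp mD mflow).
rewrite -(tonelli_swap leb (leb6 R) mk); last by move=> al p; case: ifP.
transitivity (\int[leb]_(al in `[0%R, (2 * pi)%R]) (cst (\int[leb6 R]_q D q) al)).
  rewrite integral_segment_if; apply: eq_integral => al _; case: ifPn => Ial.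
    exact: (mpres_ge0_integral (mpres_flow al) mD D0).
  by rewrite integral0_eq.
rewrite integral_cst//= lebesgue_measure_itv/= lte_fin mulr_gt0 ?pi_gt0//= oppr0 adde0.
by rewrite muleC.
Qed.

Lemma measurable_orbit p : meas_fun (orbit p : mR R -> mphase R).
Proof.
rewrite (_ : orbit p = (fun al : mR R =>
  unguide omega ((guide omega p).1, (norm2 p.2.1 *: expi al, p.2.2)%R) : mphase R)).
  by apply: (measurableT_comp (measurable_unguide omega)); meas_plane.
by apply/funext => al; rewrite orbitE.
Qed.

Let mflowI (D : phase R -> \bar R) : meas_fun (D : mphase R -> \bar R) ->
  meas_fun (fun z : mphase R * mR R => if I z.2 then D (flow z.2 z.1) else 0).
Proof.
move=> mD; apply: meas_if => //; first by apply: measurable_and; apply: meas_ler; meas.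
apply: (measurableT_comp mD).
have mp : meas_fun (fun z : mphase R * mR R => (z.2, z.1)).
  exact/measurable_fun_pair.
exact: (measurableT_comp mflow mp).
Qed.

Let measurable_integral_flow (D : phase R -> \bar R) :
  meas_fun (D : mphase R -> \bar R) -> (forall q, 0 <= D q) ->
  meas_fun (fun p : mphase R => \int[leb]_al (if I al then D (flow al p) else 0)).
Proof.
move=> mD D0; apply: (measurable_integral1 leb (f := fun p al => if I al then D (flow al p) else 0)).
  exact: mflowI.
by move=> p al; case: ifP.
Qed.

(** The gyration preserves phase volume, so a null set of phase space meets
  almost every orbit in a null set of angles. *)
Lemma ae_orbit (P : phase R -> Prop) : {ae leb6 R, forall q : mphase R, P q} ->
  {ae leb6 R, forall p : mphase R, {ae leb, forall al : mR R, (I al)%R -> P (orbit p al)}}.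
Proof.
move=> [N [mN N0 PN]].
pose D (q : mphase R) : \bar R := (\1_N q)%:E.
have mD : meas_fun D by apply: measE; exact: measurable_indic.
have D0 q : 0 <= D q by rewrite lee_fin.
have := integral_flow mD D0.
rewrite /D integral_indic// setIT [X in _ * X](_ : _ = 0) ?mule0; last exact: N0.
move=> /(@ge0_integral_eq0 _ _ _ (leb6 R)) E.
apply: filterS (E _ _) => [p|p|]; last 2 first.
- by apply: integral_ge0 => al _; case: ifP.
- exact: (measurable_integral_flow mD D0).
rewrite -(integral_orbitE p mD D0) => /(@ge0_integral_eq0 _ _ _ leb) F.
apply: filterS (F _ _) => [al|al|].
- move=> + Ial; rewrite Ial /D => /eqP.
  rewrite eqe indicE; case: (boolP (orbit p al \in N)) => [|nN _]; first by rewrite oner_eq0.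
  by apply: contrapT => nP; move/negP: nN; apply; rewrite inE; exact: PN.
- by case: ifP.
- apply: meas_if => //; first by apply: measurable_and; apply: meas_ler; meas.
  exact: (measurableT_comp mD (measurable_orbit p)).
Qed.

Let bound (N : R) : R :=
  (2 * (N + `|omega^-1| * N) + `|omega^-1| * (2 * (N + `|omega^-1| * N)))%R.

Let inbox_flow (N : R) al p : inbox N p -> inbox (bound N) (flow al p).
Proof.
by move=> pN; apply: inbox_unguide; apply: inbox_rotv (cos2Dsin2 al) _; exact: inbox_guide.
Qed.

(** The flow at a given angle maps a box into another one, so the integral of [B]
  along the orbits of the points of a box is bounded by its integral over the
  larger box. *)
Lemma ae_orbit_finite (B : phase R -> \bar R) :
  meas_fun (B : mphase R -> \bar R) -> (forall q, 0 <= B q) ->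
  (forall N : R, \int[leb6 R]_q (if inbox N q then B q else 0) < +oo) ->
  {ae leb6 R, forall p : mphase R, \int[leb]_al (if I al then B (orbit p al) else 0) < +oo}.
Proof.
move=> mB B0 Boo.
have H (n : nat) : {ae leb6 R, forall p : mphase R, inbox n%:R p ->
    \int[leb]_al (if I al then B (orbit p al) else 0) < +oo}.
  pose D (q : mphase R) : \bar R := if inbox (bound n%:R) q then B q else 0.
  have mD : meas_fun D by apply: meas_if => //; exact: measurable_inbox.
  have D0 q : 0 <= D q by rewrite /D; case: ifP.
  have i0 p : 0 <= \int[leb]_al (if I al then D (flow al p) else 0).
    by apply: integral_ge0 => al _; case: ifP.
  have Di : (leb6 R).-integrable setT (fun p => \int[leb]_al (if I al then D (flow al p) else 0)).
    apply/integrableP; split; first exact: measurable_integral_flow.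
    under eq_integral do rewrite gee0_abs//.
    rewrite integral_flow//; apply: lte_mul_pinfty; rewrite ?lee_fin ?mulr_ge0 ?pi_ge0//.
    exact: Boo.
  apply: filterS (integrable_ae measurableT Di) => p /(_ Logic.I) pfin pn.
  rewrite (integral_orbitE p mB B0).
  rewrite (_ : \int[leb]_al _ = \int[leb]_al (if I al then D (flow al p) else 0)).
    by rewrite -ge0_fin_numE.
  apply: eq_integral => al _; case: ifP => // _.
  by rewrite /D (inbox_flow al pn).
apply: filterS (ae_foralln H) => p Hp.
pose s := (`|p.1.1.1| + `|p.1.1.2| + `|p.1.2| + `|p.2.1.1| + `|p.2.1.2| + `|p.2.2|)%R.
apply: (Hp (Num.bound s)).
have s0 : (0 <= s)%R by rewrite !addr_ge0.
have sb := ltW (archi_boundP s0).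
rewrite /inbox !(le_trans _ sb)// /s.
all: have h1 := normr_ge0 p.1.1.1; have h2 := normr_ge0 p.1.1.2; have h3 := normr_ge0 p.1.2;
  have h4 := normr_ge0 p.2.1.1; have h5 := normr_ge0 p.2.1.2; have h6 := normr_ge0 p.2.2; lra.
Qed.

End orbits.

Section collision_local_integrability.
Context {R : realType}.
Local Open Scope ereal_scope.
Variables (m theta : R).
Hypotheses (m0 : (0 < m)%R) (theta0 : (0 < theta)%R).
Variables (C : vec3 R -> vec3 R -> R) (u : phase R -> R).
Hypotheses (C_L2 : L2_kernel m theta C) (u_L2 : L2_phase m theta u).
Local Notation M := (maxwellian m theta).

Let mC : meas_fun (fun p : mphase R => C p.1 p.2). Proof. by case: C_L2. Qed.
Let mu : meas_fun (u : mphase R -> R). Proof. by case: u_L2. Qed.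
Let mM : meas_fun (M : mvec3 R -> R). Proof. exact: measurable_maxwellian. Qed.

Definition collision_abs (q : phase R) : \bar R :=
  \int[leb3 R]_v' `|C q.2 v' * u (q.1, v')|%:E.

Let mCu : meas_fun (fun z : mphase R * mvec3 R => (C z.1.2 z.2 * u (z.1.1, z.2))%R).
Proof.
apply: measM.
  have mp : meas_fun (fun z : mphase R * mvec3 R => (z.1.2, z.2)) by meas_plane.
  exact: (measurableT_comp mC mp).
have mp : meas_fun (fun z : mphase R * mvec3 R => (z.1.1, z.2)) by meas_plane.
exact: (measurableT_comp mu mp).
Qed.

Lemma measurable_collision_abs : meas_fun (collision_abs : mphase R -> \bar R).
Proof.
apply: (measurable_integral1 (leb3 R) (f := fun q v' => `|C q.2 v' * u (q.1, v')|%:E)).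
  by apply: measE; exact: meas_norm mCu.
by move=> q v'; rewrite lee_fin.
Qed.

Let box (N : R) (w : vec3 R) : bool := [&& `|w.1.1| <= N, `|w.1.2| <= N & `|w.2| <= N]%R.

Let mbox N : meas_fun (fun w : mvec3 R => (if box N w then 1 else 0)%R%:E : \bar R).
Proof.
apply: measE; apply: meas_if; try exact: measurable_cstT.
rewrite /box; repeat (apply: measurable_and; [|]); apply: meas_ler;
  try exact: measurable_cstT; apply: meas_norm; by meas.
Qed.

Let inboxE N p : inbox N p = box N p.1 && box N p.2.
Proof. by rewrite /inbox /box !andbA. Qed.

Let box_finite N : \int[leb3 R]_w (if box N w then 1 else 0)%R%:E < +oo.
Proof.
have b0 (w : vec3 R) : 0 <= (if box N w then 1 else 0)%R%:E :> \bar R.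
  by rewrite lee_fin; case: ifP.
have E := @ge0_integral_tensor _ _ _ _ _ (leb3 R) (leb3 R) _ _ (mbox N) (mbox N) b0 b0.
have mi : measurable [set p : mphase R | inbox N p].
  by rewrite -[X in measurable X]setTI; exact: measurable_inbox.
have : leb6 R [set p | inbox N p] =
    \int[leb3 R]_w (if box N w then 1 else 0)%R%:E * \int[leb3 R]_w (if box N w then 1 else 0)%R%:E.
  rewrite -E -[LHS]mul1e -(integral_cst (leb6 R) mi) (integral_if _ _ (erefl _)).
  apply: eq_integral => p _; rewrite inboxE.
  by case: (box N p.1); case: (box N p.2); rewrite /= -EFinM ?mulr0 ?mul0r ?mulr1.
have := leb6_inbox N; move=> /[swap] ->.
have : 0 <= \int[leb3 R]_w (if box N w then 1 else 0)%R%:E by apply: integral_ge0.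
by case: integral => [s|//|//] _; rewrite ?ltry// mulyy ltxx.
Qed.

(** With [M] and [M'] the Maxwellian at [v] and [v'],
  [|C * u| <= C ^ 2 * M' / M + u ^ 2 * M / M']. The first term is integrable in
  [(v, v')] by hypothesis and [x] runs over a box; the second one is integrable
  in [(x, v')], up to the bound of [M], and [v] runs over a box. *)
Lemma collision_abs_locint (N : R) :
  \int[leb6 R]_q (if inbox N q then collision_abs q else 0) < +oo.
Proof.
set c0 := ((2 * pi * theta / m) `^ (- (3 / 2)))%R.
pose h (v v' : vec3 R) : \bar R := (C v v' ^+ 2 / M v * M v')%R%:E.
pose k (x v' : vec3 R) : \bar R := (c0 * (u (x, v') ^+ 2 / M v'))%R%:E.
pose b (w : vec3 R) : \bar R := (if box N w then 1 else 0)%R%:E.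
have M0 w : (0 < M w)%R by exact: maxwellian_gt0.
have c00 : (0 <= c0)%R by rewrite powR_ge0.
have h0 v v' : 0 <= h v v'
  by rewrite lee_fin mulr_ge0 ?divr_ge0 ?sqr_ge0// (ltW (M0 _)).
have k0 x v' : 0 <= k x v'.
  by rewrite lee_fin; apply: mulr_ge0 => //; rewrite divr_ge0 ?sqr_ge0// (ltW (M0 _)).
have b0 w : 0 <= b w by rewrite lee_fin; case: ifP.
have mh : meas_fun (fun p : mphase R => h p.1 p.2) by rewrite /h; meas_plane.
have mk : meas_fun (fun p : mphase R => k p.1 p.2).
  rewrite /k; apply: measE; apply: measM; first exact: measurable_cstT.
  by apply: measM; [apply: measX; rewrite (_ : (fun _ => _) = u)//; apply/funext => -[]|meas_plane].
have mH := measurable_integral1 (leb3 R) mh h0.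
have mK := measurable_integral1 (leb3 R) mk k0.
have H0 v : 0 <= \int[leb3 R]_v' h v v' by apply: integral_ge0.
have K0 x : 0 <= \int[leb3 R]_v' k x v' by apply: integral_ge0.
have mb := mbox N.
have hoo : \int[leb3 R]_v \int[leb3 R]_v' h v v' < +oo.
  rewrite -(@tonelli12 _ _ _ _ _ (leb3 R) (leb3 R) (fun z => h z.1 z.2))//.
  by case: C_L2.
have koo : \int[leb3 R]_x \int[leb3 R]_v' k x v' < +oo.
  rewrite -(@tonelli12 _ _ _ _ _ (leb3 R) (leb3 R) (fun z => k z.1 z.2))//.
  have mu2 : meas_fun (fun z : mphase R => (u z ^+ 2 / M z.2)%R%:E) by meas_plane.
  have E : \int[leb6 R]_z k z.1 z.2 = c0%:E * \int[leb6 R]_z (u z ^+ 2 / M z.2)%:E.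
    rewrite -ge0_integralZl//.
      by apply: eq_integral => -[y w] _; rewrite /k /= EFinM.
    by move=> z _; rewrite lee_fin divr_ge0 ?sqr_ge0// (ltW (M0 _)).
  rewrite E; apply: lte_mul_pinfty => //; by case: u_L2.
have S1 : \int[leb6 R]_q (b q.1 * \int[leb3 R]_v' h q.2 v') < +oo.
  rewrite (@ge0_integral_tensor _ _ _ _ _ (leb3 R) (leb3 R) _ _ mb mH b0 H0); apply: lte_mul_pinfty => //.
  - by apply: integral_ge0 => w _; exact: b0.
  - by rewrite ge0_fin_numE; [exact: box_finite|apply: integral_ge0 => w _; exact: b0].
have S2 : \int[leb6 R]_q (\int[leb3 R]_v' k q.1 v' * b q.2) < +oo.
  rewrite (@ge0_integral_tensor _ _ _ _ _ (leb3 R) (leb3 R) _ _ mK mb K0 b0); apply: lte_mul_pinfty => //.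
  - by apply: integral_ge0 => w _; exact: K0.
  - by rewrite ge0_fin_numE; [exact: koo|apply: integral_ge0 => w _; exact: K0].
have mf1 : meas_fun (fun q : mphase R => b q.1 * \int[leb3 R]_v' h q.2 v').
  by apply: measMe; [exact: (measurableT_comp mb measurable_fst)|exact: (measurableT_comp mH measurable_snd)].
have mf2 : meas_fun (fun q : mphase R => \int[leb3 R]_v' k q.1 v' * b q.2).
  by apply: measMe; [exact: (measurableT_comp mK measurable_fst)|exact: (measurableT_comp mb measurable_snd)].
apply: le_lt_trans (lte_add_pinfty S1 S2).
rewrite -ge0_integralD//; last 2 first.
- by move=> q _; exact: mule_ge0.
- by move=> q _; exact: mule_ge0.
apply: ge0_le_integral => //.
- by move=> q _; case: ifP => // _; apply: integral_ge0 => v' _; rewrite lee_fin.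
- apply: meas_if => //; [exact: measurable_inbox|exact: measurable_collision_abs].
- exact: emeasurable_funD.
move=> q _; rewrite inboxE; case: ifPn => [/andP[q1 q2]|_].
  2: by rewrite adde_ge0//; apply: mule_ge0 => //; exact: b0.
rewrite /b q1 q2.
rewrite mul1e mule1.
have mhq := meas_section1 mh q.2.
have mkq := meas_section1 mk q.1.
rewrite -ge0_integralD//; apply: ge0_le_integral => //.
- exact: (meas_section1 (f := fun q v' => `|C q.2 v' * u (q.1, v')|%:E) (measE (meas_norm mCu)) q).
- exact: emeasurable_funD.
move=> v' _; rewrite /h /k -EFinD lee_fin normrM.
have c1 : (M q.2 <= c0)%R by exact: maxwellian_le.
have V0 := M0 q.2; have V1 := M0 v'.
apply: (@le_trans _ _ (C q.2 v' ^+ 2 / M q.2 * M v' + M q.2 * (u (q.1, v') ^+ 2 / M v'))%R); last first.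
  by rewrite lerD2l ler_wpM2r// divr_ge0 ?sqr_ge0 ?ltW.
move: (C q.2 v') (u _) (M q.2) (M v') V0 V1 => c w V V' V0 V1.
pose t := (V' / V)%R; have t0 : (0 < t)%R by rewrite divr_gt0.
have -> : (c ^+ 2 / V * V' + V * (w ^+ 2 / V') = c ^+ 2 * t + w ^+ 2 / t)%R.
  by rewrite /t; field; rewrite !gt_eqF.
rewrite -(ler_pM2r t0) mulrDl divfK ?gt_eqF//.
have := sqr_ge0 (`|c| * t - `|w|)%R; have := sqr_ge0 `|w|%R; have := sqr_ge0 (`|c| * t)%R.
rewrite -(real_normK (num_real c)) -(real_normK (num_real w)); nra.
Qed.

End collision_local_integrability.

(** * The averaged collision operator *)

Section averaged_collision_operator.
Context {R : realType}.
Local Notation leb := (@lebesgue_measure R).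
Local Notation I a := (0 <= a <= 2 * pi).
Variables (m theta omega : R).
Hypotheses (m0 : 0 < m) (theta0 : 0 < theta) (omega0 : omega != 0).

(** The gyroaverage only depends on the invariants. *)
Lemma ker_transport_invariants (f : phase R -> R) : ker_transport m theta omega f ->
  exists2 Phi : vec3 R * vec2 R -> R,
    meas_fun (Phi : mvec3 R * mvec2 R -> R) &
    {ae leb6 R, forall p : mphase R, f p = of_invariants omega Phi p}.
Proof.
move=> kerf; have mf : meas_fun (f : mphase R -> R) by case: kerf => -[].
exists (fun y => (2 * pi)^-1 * \int[leb]_(al in `[0, 2 * pi])
    f (unguide omega (y.1, (y.2.1 *: expi al, y.2.2)))).
  apply: measM; first exact: measurable_cstT.
  under eq_fun do rewrite Rintegral_segment_if.
  apply: (measurable_Rintegral leb (f := fun (y : mvec3 R * mvec2 R) al => if I al then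
    f (unguide omega (y.1, (y.2.1 *: expi al, y.2.2))) else 0)).
  apply: meas_if; last exact: measurable_cstT.
    by apply: measurable_and; apply: meas_ler; meas.
  apply: (measurableT_comp mf); apply: (measurableT_comp (measurable_unguide omega)).
  by meas_plane.
apply: filterS (ker_transport_average m0 theta0 omega0 kerf) => p ->.
by rewrite averageE.
Qed.

Variables (C : vec3 R -> vec3 R -> R).
Hypotheses (C_L2 : L2_kernel m theta C) (Crot : rotation_invariant C).
Variables (f : phase R -> R) (Phi : vec3 R * vec2 R -> R).
Hypotheses (f_L2 : L2_phase m theta f).
Hypotheses (mPhi : meas_fun (Phi : mvec3 R * mvec2 R -> R)).
Local Notation g := (of_invariants omega Phi).
Hypotheses (fg : {ae leb6 R, forall p : mphase R, f p = g p}).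

Let mC : meas_fun (fun p : mphase R => C p.1 p.2). Proof. by case: C_L2. Qed.
Let mf : meas_fun (f : mphase R -> R). Proof. by case: f_L2. Qed.
Let mg : meas_fun (g : mphase R -> R). Proof. exact: measurable_of_invariants. Qed.

Let g_L2 : L2_phase m theta g.
Proof.
case: f_L2 => _ foo; split => //.
have mw (u : phase R -> R) : meas_fun (u : mphase R -> R) ->
    meas_fun (fun p : mphase R => (u p ^+ 2 / maxwellian m theta p.2)%:E).
  move=> mu; apply: measE; apply: measM; first exact: measX.
  by apply: measV; apply: (measurableT_comp (measurable_maxwellian m theta)); meas.
rewrite (ae_eq_integral (fun p : mphase R => (f p ^+ 2 / maxwellian m theta p.2)%:E))//.
- exact: mw.
- exact: mw.
- by apply: filterS fg => p -> _.
Qed.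

Let ae_speed : {ae leb6 R, forall p : mphase R, 0 < norm2 p.2.1}.
Proof.
have h1 : {ae leb, forall t : mR R, t != 0}.
  exists [set 0]; split => //; first exact: lebesgue_measure_set1.
  by move=> t /= /negP/negPn/eqP.
have h2 : {ae leb2 R, forall w : mvec2 R, w.1 != 0} := ae_fst leb h1.
have h3 : {ae leb3 R, forall v : mvec3 R, v.1.1 != 0} := ae_fst leb h2.
have h6 : {ae leb6 R, forall p : mphase R, p.2.1.1 != 0} := ae_snd (leb3 R) h3.
apply: filterS h6 => p p0; rewrite lt_neqAle norm2_ge0 andbT eq_sym.
by apply: contra p0 => /eqP/norm2_eq0 ->.
Qed.

Let fg_slice : {ae leb3 R, forall x : mvec3 R, {ae leb3 R, forall v' : mvec3 R, f (x, v') = g (x, v')}}.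
Proof. exact: (ae_section1 fg). Qed.

Let ae_finite_orbit : {ae leb6 R, forall p : mphase R,
  (\int[leb]_al (if I al then \int[leb3 R]_v'
    `|orbit_kernel C p.2 al v' * g (gyro_position omega p.1 p.2 al, v')|%:E
    else 0) < +oo)%E}.
Proof.
have := @ae_orbit_finite R omega _ (measurable_collision_abs C_L2 g_L2) _
  (collision_abs_locint m0 theta0 C_L2 g_L2).
by apply => q; apply: integral_ge0.
Qed.

(* On almost every orbit [f] may be replaced by [g], at almost every angle and for
   almost every [v']. *)
Let left_ae : {ae leb6 R, forall p : mphase R,
  average omega (fun q => \int[leb3 R]_v' (C q.2 v' * f (q.1, v'))) p =
  (2 * pi)^-1 * \int[leb]_(al in `[0, 2 * pi]) \int[leb3 R]_v'
    (orbit_kernel C p.2 al v' * g (gyro_position omega p.1 p.2 al, v'))}.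
Proof.
have h : {ae leb6 R, forall q : mphase R, {ae leb3 R, forall v' : mvec3 R, f (q.1, v') = g (q.1, v')}}.
  exact: (ae_fst (leb3 R) fg_slice).
apply: filterS (ae_orbit omega h) => p hp.
rewrite /average; congr (_ * _); rewrite !Rintegral_segment_if.
have ifE (u : phase R -> R) al : (if I al then \int[leb3 R]_v' (orbit_kernel C p.2 al v' *
      u (gyro_position omega p.1 p.2 al, v')) else 0) =
    \int[leb3 R]_v' (if I al then orbit_kernel C p.2 al v' *
      u (gyro_position omega p.1 p.2 al, v') else 0).
  by case: ifP => // _; rewrite /Rintegral integral0_eq.
have mk (u : phase R -> R) : meas_fun (u : mphase R -> R) ->
    meas_fun (fun z : mR R * mvec3 R =>
      if I z.1 then orbit_kernel C p.2 z.1 z.2 * u (gyro_position omega p.1 p.2 z.1, z.2) else 0).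
  move=> mu; apply: meas_if; last exact: measurable_cstT.
    by apply: measurable_and; apply: meas_ler; meas.
  apply: measM; first exact: measurable_orbit_kernel.
  have mo := measurable_orbit omega p.
  have mp : meas_fun (fun z : mR R * mvec3 R => (gyro_position omega p.1 p.2 z.1, z.2) : mphase R).
    apply/measurable_fun_pair; last exact: measurable_snd.
    exact: (measurableT_comp measurable_fst (measurableT_comp mo measurable_fst)).
  exact: (measurableT_comp mu mp).
transitivity (\int[leb]_al \int[leb3 R]_v' (if I al then orbit_kernel C p.2 al v' *
    f (gyro_position omega p.1 p.2 al, v') else 0)).
  by apply: eq_Rintegral => al _; rewrite -ifE.
transitivity (\int[leb]_al \int[leb3 R]_v' (if I al then orbit_kernel C p.2 al v' *
    g (gyro_position omega p.1 p.2 al, v') else 0)).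
  apply: (ae_eq_Rintegral2 (mk f mf) (mk _ mg)).
  apply: filterS hp => al; case: (boolP (I al)) => Ial.
    by move=> /(_ isT); apply: filterS => v' /= ->.
  by move=> _; apply: aeW.
by apply: eq_Rintegral => al _; rewrite -ifE.
Qed.

(* The right side only involves the values of [f] at height [x3]. *)
Let right_ae : {ae leb6 R, forall p : mphase R,
  \int[leb2 R]_xb' \int[leb3 R]_v' (nonlocal_kernel omega C p.1 p.2 xb' v' * f ((xb', p.1.2), v')) =
  \int[leb2 R]_xb' \int[leb3 R]_v' (nonlocal_kernel omega C p.1 p.2 xb' v' * g ((xb', p.1.2), v'))}.
Proof.
have h2 : {ae leb, forall x3 : mR R, {ae leb2 R, forall xb : mvec2 R,
    {ae leb3 R, forall v' : mvec3 R, f ((xb, x3), v') = g ((xb, x3), v')}}}.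
  exact: (ae_section2 fg_slice).
have h3 : {ae leb3 R, forall x : mvec3 R, {ae leb2 R, forall xb : mvec2 R,
    {ae leb3 R, forall v' : mvec3 R, f ((xb, x.2), v') = g ((xb, x.2), v')}}}.
  exact: (ae_snd (leb2 R) h2).
apply: filterS (ae_fst (leb3 R) h3) => p hp.
have mk (u : phase R -> R) : meas_fun (u : mphase R -> R) ->
    meas_fun (fun z : mvec2 R * mvec3 R =>
      nonlocal_kernel omega C p.1 p.2 z.1 z.2 * u ((z.1, p.1.2), z.2)).
  move=> mu; apply: measM; first exact: measurable_nonlocal_kernel.
  have mp : meas_fun (fun z : mvec2 R * mvec3 R => ((z.1, p.1.2), z.2) : mphase R).
    by meas_plane.
  exact: (measurableT_comp mu mp).
apply: (@ae_eq_Rintegral2 _ _ _ _ _ (leb2 R) (leb3 R) _ _ (mk f mf) (mk _ mg)).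
by apply: filterS hp => xb; apply: filterS => v' /= ->.
Qed.

Lemma average_collision_ae (Ct : R -> R -> R -> R -> R -> R) : cylindrical_form C Ct ->
  {ae leb6 R, forall p : mphase R,
    average omega (fun q => \int[leb3 R]_v' (C q.2 v' * f (q.1, v'))) p =
    omega ^+ 2 * \int[leb2 R]_xb' \int[leb3 R]_v'
       (averaged_kernel Ct (norm2 p.2.1) p.2.2 (norm2 v'.1) v'.2
          (omega *: p.1.1 + perp p.2.1 - (omega *: xb' + perp v'.1)) *
        f ((xb', p.1.2), v'))}.
Proof.
move=> cyl; apply: filterS2 (filterI left_ae right_ae) (filterI ae_speed ae_finite_orbit).
move=> p [-> righte] [r0 foo].
rewrite (average_collision omega0 r0 mC mPhi Crot foo) -righte.
rewrite -[X in _ * X = _]mulrA mulKf; last by rewrite mulf_neq0// gt_eqF// pi_gt0.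
congr (_ * _); apply: eq_Rintegral => xb' _; apply: eq_Rintegral => v' _.
congr (_ * _); rewrite (averaged_kernelE _ _ _ cyl r0 (norm2_ge0 _)).
by [].
Qed.

End averaged_collision_operator.

Theorem proposition4p2 (R : realType) (m theta omega : R)
    (m_gt0 : 0 < m) (theta_gt0 : 0 < theta) (omega_neq0 : omega != 0)
    (C : vec3 R -> vec3 R -> R)
    (C_L2 : L2_kernel m theta C) (C_rot : rotation_invariant C) :
  (exists Ct, cylindrical_form C Ct) /\
  (forall Ct, cylindrical_form C Ct ->
   forall f : phase R -> R, ker_transport m theta omega f ->
   {ae leb6 R, forall p : phase R, let x := p.1 in let v := p.2 in
     average omega
       (fun q => \int[leb3 R]_v' (C q.2 v' * f (q.1, v'))) (x, v) =
     omega ^+ 2 *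
     \int[leb2 R]_xb' \int[leb3 R]_v'
       (averaged_kernel Ct (norm2 v.1) v.2 (norm2 v'.1) v'.2
          (omega *: x.1 + perp v.1 - (omega *: xb' + perp v'.1)) *
        f ((xb', x.2), v'))}).
Proof.
split; first by exists (cylindrical_kernel C); exact: cylindrical_form_exists.
move=> Ct cyl f kerf.
have [Phi mPhi fE] := ker_transport_invariants m_gt0 theta_gt0 omega_neq0 kerf.
have f_L2 : L2_phase m theta f by case: kerf.
have := average_collision_ae m_gt0 theta_gt0 omega_neq0 C_L2 C_rot f_L2 mPhi fE cyl.
by apply: filterS => -[x v].
Qed.
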